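(* Let $p_0,u_0,\rho_0>0$ be constants with $M_0>1$, and let $u_*>0$ and $M^*<1$ be fixed numbers. Consider Problem A$'$ in the infinite duct $\mathcal D'=\{-1<x<\infty,\ 0<y<1\}$ with the uniform supersonic data $(p,u,v,\rho)=(p_0,u_0,0,\rho_0)$ on the entry $\{x=-1\}$ and slip condition $v=0$ on the walls $\{y=0\}$ and $\{y=1\}$ (no condition at infinity). Let $U=(p,u,v,\rho)$ be a transonic shock solution to Problem A$'$ such that the flow behind the shock-front satisfies $u>u_*$ and $M<M^*$, and such that the shock-front passes through a point $(t,0)\in\overline{\mathcal D'}$. Then $U$ is the special solution $U_b$: the shock-front is $x\equiv t$, $U\equiv(p_0,u_0,0,\rho_0)$ for $x<t$, and $U\equiv(p^+,u^+,0,\rho^+)$ for $x>t$.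
   Context: Fix $\gamma>1$. The steady full compressible Euler system for $(p,u,v,\rho)$ (pressure, velocity components, density; $p,\rho>0$) is $$\partial_x(\rho u)+\partial_y(\rho v)=0,\quad \partial_x(\rho u^2+p)+\partial_y(\rho uv)=0,\quad \partial_x(\rho uv)+\partial_y(\rho v^2+p)=0,\quad \tfrac12(u^2+v^2)+\tfrac{c^2}{\gamma-1}=b_0,$$ where $c=\sqrt{\gamma p/\rho}$ is the sonic speed and $b_0=\tfrac12u_0^2+\frac{\gamma p_0}{(\gamma-1)\rho_0}$ is a constant (the same on both sides of the shock-front). The Mach number is $M=\sqrt{u^2+v^2}/c$; the flow is supersonic if $M>1$ and subsonic if $M<1$. Set $c_0=\sqrt{\gamma p_0/\rho_0}$, $M_0=u_0/c_0$. Transonic shock solution of Problem A$'$: a function $f\in C^2([0,1])$ with $f\ge -1$ on $[0,1]$ and $f>-1$ on $(0,1)$, shock-front $\mathcal S=\{(f(y),y):0\le y\le 1\}$, $\mathcal D^-=\{(x,y)\in\mathcal D': x<f(y)\}$, $\mathcal D^+=\{(x,y)\in\mathcal D': x>f(y)\}$, and functions $p,u,v,\rho\in L^\infty_{loc}$ that are $C^1$ on $\mathcal D^-$ and on $\mathcal D^+$, in each case locally up to the boundary (including $\mathcal S$, with one-sided values there), such that: the flow is supersonic in $\mathcal D^-$ and subsonic in $\mathcal D^+$; the Euler system holds pointwise in $\mathcal D^-\cup\mathcal D^+$; the boundary conditions hold pointwise; and across $\mathcal S$ the Rankine–Hugoniot conditions $$[\rho u]-f'(y)[\rho v]=0,\quad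 [\rho u^2+p]-f'(y)[\rho uv]=0,\quad [\rho uv]-f'(y)[\rho v^2+p]=0$$ and the entropy condition $[p]>0$ hold, where $[q]$ denotes the value of $q$ on $\mathcal S$ from $\mathcal D^+$ minus its value from $\mathcal D^-$. ''Behind the shock-front'' means in $\mathcal D^+$. ''Passing through $(t,0)$'' means $f(0)=t$. The constants of the special solution are the state behind a normal shock: $$p^+=p_0\Big(1+\tfrac{2\gamma}{\gamma+1}(M_0^2-1)\Big),\quad u^+=u_0-\frac{p^+-p_0}{\rho_0u_0},\quad \rho^+=\rho_0\frac{(\gamma+1)p^++(\gamma-1)p_0}{(\gamma-1)p^++(\gamma+1)p_0}.$$ *)

(* Defs.v *)
From HB Require Import structures.
From mathcomp Require Import all_boot all_order all_algebra.
From mathcomp Require Import all_classical all_reals all_analysis.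

Set Implicit Arguments.
Unset Strict Implicit.
Unset Printing Implicit Defensive.

Import Order.TTheory GRing.Theory Num.Theory.
Import numFieldNormedType.Exports.

Local Open Scope classical_set_scope.
Local Open Scope ring_scope.

(* The value at z (usually a boundary point of Om) of the continuous extension
   of q from Om; since the limit is taken inside Om only, it is the one-sided
   value when Om lies on one side of a curve through z. *)
Definition trace (R : realType) (Om : set (R * R)) (q : R * R -> R)
    (z : R * R) : R :=
  lim (q w @[w --> within Om (nbhs z)]).

Definition has_trace (R : realType) (Om : set (R * R)) (q : R * R -> R)
    (z : R * R) : Prop :=
  cvg (q w @[w --> within Om (nbhs z)]).

Definition dx (R : realType) (q : R * R -> R) (z : R * R) : R :=
  'D_(1 : R, 0 : R) q z.

Definition dy (R : realType) (q : R * R -> R) (z : R * R) : R :=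
  'D_(0 : R, 1 : R) q z.

(* For Om open, [C1_closure Om q] says that q is C^1 on Om and that q and its
   first partial derivatives extend continuously to the closure of Om.  At
   z in Om itself, existence of the limit in [has_trace] means continuity at z,
   because the filter [within Om (nbhs z)] does not exclude z.  No uniformity is
   required for unbounded Om. *)
Definition C1_closure (R : realType) (Om : set (R * R)) (q : R * R -> R) :
    Prop :=
  (forall z, Om z -> differentiable q z) /\
  (forall z, closure Om z ->
     [/\ has_trace Om q z, has_trace Om (dx q) z & has_trace Om (dy q) z]).

(* Membership of the a.e. class of q in L^oo_loc(Om). *)
Definition Linfty_loc (R : realType) (Om : set (R * R)) (q : R * R -> R) :
    Prop :=
  exists g : R * R -> R,
    [/\ measurable_fun Om g,
        {ae (@lebesgue_measure R \x @lebesgue_measure R)%E,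
           forall z, Om z -> q z = g z} &
        forall K : set (R * R), compact K -> K `<=` Om ->
          exists C : R,
            {ae (@lebesgue_measure R \x @lebesgue_measure R)%E,
               forall z, K z -> `|g z| <= C}].

(* Difference quotients are restricted to [0, 1], so that [deriv01] is the
   ordinary derivative on ]0, 1[ and the one-sided one at 0 and 1. *)
Definition diffquot01 (R : realType) (f : R -> R) (y : R) :=
  (f s - f y) / (s - y) @[s --> within `[0, 1] (y^')].

Definition deriv01 (R : realType) (f : R -> R) (y : R) : R :=
  lim (diffquot01 f y).

Definition derivable01 (R : realType) (f : R -> R) : Prop :=
  forall y, 0 <= y <= 1 -> cvg (diffquot01 f y).

Definition C2_01 (R : realType) (f : R -> R) : Prop :=
  [/\ derivable01 f, derivable01 (deriv01 f) &
      {within `[0, 1], continuous (deriv01 (deriv01 f))}].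

Record flow (R : realType) : Type := Flow {
  prs : R * R -> R ;  (* pressure *)
  vlx : R * R -> R ;  (* velocity component u *)
  vly : R * R -> R ;  (* velocity component v *)
  rho : R * R -> R    (* density *)
}.

Definition flow_is (R : realType) (U : flow R) (z : R * R) (p u v r : R) :
    Prop :=
  [/\ prs U z = p, vlx U z = u, vly U z = v & rho U z = r].

Definition sonic (R : realType) (gamma p r : R) : R :=
  Num.sqrt (gamma * p / r).

Definition mach (R : realType) (gamma : R) (U : flow R) (z : R * R) : R :=
  Num.sqrt (vlx U z ^+ 2 + vly U z ^+ 2) / sonic gamma (prs U z) (rho U z).

Definition mass_x (R : realType) (U : flow R) (z : R * R) : R :=
  rho U z * vlx U z.
Definition mass_y (R : realType) (U : flow R) (z : R * R) : R :=
  rho U z * vly U z.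
Definition mom_xx (R : realType) (U : flow R) (z : R * R) : R :=
  rho U z * vlx U z ^+ 2 + prs U z.
Definition mom_xy (R : realType) (U : flow R) (z : R * R) : R :=
  rho U z * vlx U z * vly U z.
Definition mom_yy (R : realType) (U : flow R) (z : R * R) : R :=
  rho U z * vly U z ^+ 2 + prs U z.

Definition euler (R : realType) (gamma b0 : R) (U : flow R) (z : R * R) :
    Prop :=
  [/\ dx (mass_x U) z + dy (mass_y U) z = 0,
      dx (mom_xx U) z + dy (mom_xy U) z = 0,
      dx (mom_xy U) z + dy (mom_yy U) z = 0 &
      2^-1 * (vlx U z ^+ 2 + vly U z ^+ 2)
        + sonic gamma (prs U z) (rho U z) ^+ 2 / (gamma - 1) = b0].

Definition duct (R : realType) : set (R * R) :=
  [set z | -1 < z.1 /\ 0 < z.2 < 1].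

Definition Dminus (R : realType) (f : R -> R) : set (R * R) :=
  [set z | duct z /\ z.1 < f z.2].

Definition Dplus (R : realType) (f : R -> R) : set (R * R) :=
  [set z | duct z /\ f z.2 < z.1].

Definition jump (R : realType) (f : R -> R) (q : R * R -> R) (y : R) : R :=
  trace (Dplus f) q (f y, y) - trace (Dminus f) q (f y, y).

Definition rankine_hugoniot (R : realType) (f : R -> R) (U : flow R) (y : R) :
    Prop :=
  [/\ jump f (mass_x U) y - deriv01 f y * jump f (mass_y U) y = 0,
      jump f (mom_xx U) y - deriv01 f y * jump f (mom_xy U) y = 0 &
      jump f (mom_xy U) y - deriv01 f y * jump f (mom_yy U) y = 0].

Definition bernoulli_const (R : realType) (gamma p0 u0 r0 : R) : R :=
  2^-1 * u0 ^+ 2 + gamma * p0 / ((gamma - 1) * r0).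

(* The inlet and wall conditions are imposed on the boundary values from the
   side(s) whose closure contains the boundary point. *)
Record transonic_shock (R : realType) (gamma p0 u0 r0 : R) (f : R -> R)
    (U : flow R) : Prop := TransonicShock {
  shock_C2 : C2_01 f ;
  shock_ge : forall y, 0 <= y <= 1 -> -1 <= f y ;
  shock_gt : forall y, 0 < y < 1 -> -1 < f y ;
  flow_Linfty :
    [/\ Linfty_loc (@duct R) (prs U), Linfty_loc (@duct R) (vlx U),
        Linfty_loc (@duct R) (vly U) & Linfty_loc (@duct R) (rho U)] ;
  flow_C1_minus :
    [/\ C1_closure (Dminus f) (prs U), C1_closure (Dminus f) (vlx U),
        C1_closure (Dminus f) (vly U) & C1_closure (Dminus f) (rho U)] ;
  flow_C1_plus :
    [/\ C1_closure (Dplus f) (prs U), C1_closure (Dplus f) (vlx U),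
        C1_closure (Dplus f) (vly U) & C1_closure (Dplus f) (rho U)] ;
  flow_pos : forall z, (Dminus f `|` Dplus f) z ->
    0 < prs U z /\ 0 < rho U z ;
  flow_supersonic : forall z, Dminus f z -> 1 < mach gamma U z ;
  flow_subsonic : forall z, Dplus f z -> mach gamma U z < 1 ;
  flow_euler : forall z, (Dminus f `|` Dplus f) z ->
    euler gamma (bernoulli_const gamma p0 u0 r0) U z ;
  flow_inlet : forall y, 0 <= y <= 1 ->
    [/\ trace (Dminus f) (prs U) (-1, y) = p0,
        trace (Dminus f) (vlx U) (-1, y) = u0,
        trace (Dminus f) (vly U) (-1, y) = 0 &
        trace (Dminus f) (rho U) (-1, y) = r0] ;
  flow_wall_minus : forall z, closure (Dminus f) z -> z.2 = 0 \/ z.2 = 1 ->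
    trace (Dminus f) (vly U) z = 0 ;
  flow_wall_plus : forall z, closure (Dplus f) z -> z.2 = 0 \/ z.2 = 1 ->
    trace (Dplus f) (vly U) z = 0 ;
  shock_RH : forall y, 0 <= y <= 1 -> rankine_hugoniot f U y ;
  shock_entropy : forall y, 0 <= y <= 1 -> 0 < jump f (prs U) y
}.

Definition post_p (R : realType) (gamma p0 u0 r0 : R) : R :=
  p0 * (1 + 2 * gamma / (gamma + 1) * ((u0 / sonic gamma p0 r0) ^+ 2 - 1)).

Definition post_u (R : realType) (gamma p0 u0 r0 : R) : R :=
  u0 - (post_p gamma p0 u0 r0 - p0) / (r0 * u0).

Definition post_rho (R : realType) (gamma p0 u0 r0 : R) : R :=
  let pp := post_p gamma p0 u0 r0 in
  r0 * (((gamma + 1) * pp + (gamma - 1) * p0) /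
        ((gamma - 1) * pp + (gamma + 1) * p0)).

(* Main.v *)
Require Import Defs.
From HB Require Import structures.
From mathcomp Require Import all_boot all_order all_algebra.
From mathcomp Require Import all_classical all_reals all_analysis.
From mathcomp Require Import ring lra.
Import Order.TTheory GRing.Theory Num.Theory.
Import numFieldNormedType.Exports.
Local Open Scope classical_set_scope.
Local Open Scope ring_scope.

(** Uniqueness has two halves, one on each side of the shock front.

    Ahead of the front the flow is supersonic and only the uniform stream is
    compatible with the inlet data.  The deviation from the uniform stream
    solves a constant coefficient system, the Euler system linearized at that
    stream, up to an error proportional to the deviation itself
    ([linearized_bound]).  Its Riemann invariants are transported along straight
    characteristics, which reflect at the walls; an exponential weight in the
    stream direction absorbs the error, and a weight across the duct makes the
    reflections contracting, so that every bound on the deviation can be halved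
    ([supersonic_uniform]).  This works in any region that contains its backward
    characteristic cones.  The region ahead of the front is of this kind as long
    as the front is less steep than the characteristics.  At the lowest point
    where it would be as steep, the stream ahead is still uniform, and a
    compressive shock facing the uniform stream is strictly less steep: hence
    there is no such point ([front_slope_lt]).

    Behind the front let w = v / u be the flow direction.  For a subsonic flow
    the Jacobian of the pair (p, w) is a positive definite quadratic form in the
    gradient of the pressure ([jacobian_ge]).  The Jacobian is an exact
    2-form: with Q an increasing function of p, its integral over the region
    between two translates of the front is the difference of the circulations
    G of Q dw along them ([leaf_stokes]).  The circulation along the
    front itself vanishes, because there (p, w) runs along the shock polar, a
    curve, from the normal shock at one wall back to the normal shock at the
    other ([front_circulation]).  On the other translates w = 0 at the walls, so
    G is minus the integral of w dQ and G ^ 2 is bounded by a multiple of G'.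
    The choice Q = - 1 / (p0 + p) makes this multiple independent of the size of
    the density.  A nonzero G would blow up at a finite distance, so G = 0
    ([riccati_eq0]) and the Jacobian vanishes ([leaf_rigidity]): the pressure is
    constant, the flow is horizontal, the front is straight, and the state
    behind it is that of the normal shock ([subsonic_rigidity]). *)

(** * One-sided traces and derivatives along curves *)

Lemma nbhs_box {R : realType} (z : R * R) (P : set (R * R)) :
  nbhs z P <-> exists2 d, 0 < d & forall w,
    `|w.1 - z.1| < d -> `|w.2 - z.2| < d -> P w.
Proof.
split=> [/(@nbhs_ballP R (R * R)%type z)[d /= d0 dP]|[d d0 dP]].
  by exists d => // w w1 w2; apply: dP; split; rewrite /ball/= distrC.
apply/(@nbhs_ballP R (R * R)%type z); exists d => //= w [w1 w2].
by apply: dP; rewrite distrC; [exact: w1|exact: w2].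
Qed.

Lemma cvg_box {R : realType} (Om : set (R * R)) (q : R * R -> R)
    (z : R * R) (l : R) :
  (q w @[w --> within Om (nbhs z)] --> l) <->
  (forall e, 0 < e -> exists2 d, 0 < d & forall w, Om w ->
     `|w.1 - z.1| < d -> `|w.2 - z.2| < d -> `|q w - l| < e).
Proof.
split=> [ql e e0|H].
  have /cvgrPdist_lt/(_ e e0) := ql.
  rewrite near_withinE => /nbhs_box[d d0 dP].
  exists d => // w Omw w1 w2.
  by rewrite distrC; apply: (dP w).
apply/cvgrPdist_lt => e e0.
have [d d0 dP] := H e e0.
rewrite near_withinE; apply/nbhs_box; exists d => //= w w1 w2 Omw.
by rewrite distrC; exact: dP.
Qed.

Lemma continuous_box {R : realType} (q : R * R -> R) (z : R * R) :
  {for z, continuous q} <->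
  (forall e, 0 < e -> exists2 d, 0 < d & forall w,
     `|w.1 - z.1| < d -> `|w.2 - z.2| < d -> `|q w - q z| < e).
Proof.
split=> H.
  have /cvg_box K : q w @[w --> within setT (nbhs z)] --> q z.
    by apply: cvg_within_filter.
  by move=> e /K[d d0 dP]; exists d => // w; exact: dP.
have /cvg_box : forall e, 0 < e -> exists2 d, 0 < d & forall w, setT w ->
     `|w.1 - z.1| < d -> `|w.2 - z.2| < d -> `|q w - q z| < e.
  by move=> e /H[d d0 dP]; exists d => // w _; exact: dP.
move=> K A /K; rewrite /fmap/= /within/=.
by rewrite /nbhs/=; apply: filterS => x; exact.
Qed.

Lemma closure_box {R : realType} (Om : set (R * R)) (z : R * R) :
  closure Om z <->
  (forall d, 0 < d ->
     exists2 w, Om w & (`|w.1 - z.1| < d /\ `|w.2 - z.2| < d)).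
Proof.
split=> [cz d d0|H].
  have /cz[w [Omw [w1 w2]]] :
      nbhs z [set w | `|w.1 - z.1| < d /\ `|w.2 - z.2| < d].
    by apply/nbhs_box; exists d.
  by exists w.
move=> A /nbhs_box[d d0 dA].
have [w Omw [w1 w2]] := H d d0.
by exists w; split => //; exact: dA.
Qed.

Lemma within_closure_proper {R : realType} {Om : set (R * R)} {z : R * R} :
  closure Om z -> ProperFilter (within Om (nbhs z)).
Proof.
move=> /closure_box cz.
apply: Build_ProperFilter_ex => A; rewrite /within/= => /nbhs_box[d d0 dA].
have [w Omw [w1 w2]] := cz d d0.
by exists w; exact: dA.
Qed.

Lemma trace_box {R : realType} {Om : set (R * R)} {q : R * R -> R} {z : R * R} :
  closure Om z -> has_trace Om q z ->
  forall e, 0 < e -> exists2 d, 0 < d & forall w, Om w ->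
     `|w.1 - z.1| < d -> `|w.2 - z.2| < d -> `|q w - trace Om q z| < e.
Proof. by move=> cz hz; exact/cvg_box. Qed.

Lemma trace_eq {R : realType} {Om : set (R * R)} {q : R * R -> R} {z : R * R}
    (l : R) : closure Om z ->
  (forall e, 0 < e -> exists2 d, 0 < d & forall w, Om w ->
     `|w.1 - z.1| < d -> `|w.2 - z.2| < d -> `|q w - l| < e) ->
  trace Om q z = l.
Proof.
move=> cz /cvg_box ql; have ? := within_closure_proper cz.
exact: cvg_lim ql.
Qed.

(** The trace being known to exist, one convenient approach to [z] inside [Om]
    is enough to compute it. *)
Lemma trace_approach {R : realType} {Om : set (R * R)} {q : R * R -> R}
    {z : R * R} (l : R) : has_trace Om q z ->
  (forall e d, 0 < e -> 0 < d -> exists2 w, Om w &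
     [/\ `|w.1 - z.1| < d, `|w.2 - z.2| < d & `|q w - l| < e]) ->
  trace Om q z = l.
Proof.
move=> hz H.
have cz : closure Om z.
  apply/closure_box => d d0.
  by have [w Omw [w1 w2 _]] := H 1 d ltr01 d0; exists w.
apply/eqP; rewrite -subr_eq0 -normr_le0 leNgt; apply/negP => D0.
set D := `|_| in D0.
have [d d0 dP] := trace_box cz hz _ (divr_gt0 D0 (ltr0n R 2)).
have [w Omw [w1 w2 w3]] := H _ _ (divr_gt0 D0 (ltr0n R 2)) d0.
have := dP w Omw w1 w2 => w4.
have : D <= `|q w - l| + `|q w - trace Om q z|.
  rewrite (distrC (q w) (trace Om q z)) addrC.
  by rewrite (le_trans _ (ler_normD _ _))// addrA subrK.
rewrite leNgt; apply/negP; rewrite negbK.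
by rewrite (splitr D) ltrD.
Qed.

Lemma trace_interior {R : realType} {Om : set (R * R)} {q : R * R -> R}
    {z : R * R} : has_trace Om q z -> Om z -> trace Om q z = q z.
Proof.
move=> hz Oz; apply: trace_approach => // e d e0 d0; exists z => //.
by rewrite !subrr !normr0.
Qed.

Lemma trace_continuous {R : realType} {Om : set (R * R)} {q : R * R -> R}
    {z : R * R} : (forall w, closure Om w -> has_trace Om q w) ->
  closure Om z ->
  forall e, 0 < e -> exists2 d, 0 < d & forall w, closure Om w ->
     `|w.1 - z.1| < d -> `|w.2 - z.2| < d ->
     `|trace Om q w - trace Om q z| < e.
Proof.
move=> hq cz e e0.
have e20 : 0 < e / 2 by rewrite divr_gt0.
have [d d0 dP] := trace_box cz (hq _ cz) _ e20.
exists d => // w cw w1 w2.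
have [d' d'0 d'P] := trace_box cw (hq _ cw) _ e20.
have m0 : 0 < Num.min d' (Num.min (d - `|w.1 - z.1|) (d - `|w.2 - z.2|)).
  by rewrite !lt_min d'0 !subr_gt0 w1 w2.
have [x Ox []] := (closure_box _ _).1 cw _ m0.
rewrite !lt_min => /and3P[a1 a2 _] /and3P[b1 _ b2].
have t1 := d'P x Ox a1 b1.
have t2 : `|q x - trace Om q z| < e / 2.
  apply: dP => //.
    rewrite -(subrK w.1 x.1) -addrA (le_lt_trans (ler_normD _ _))//.
    by rewrite -ltrBrDr.
  rewrite -(subrK w.2 x.2) -addrA (le_lt_trans (ler_normD _ _))//.
  by rewrite -ltrBrDr.
rewrite -(subrK (q x) (trace Om q w)) -addrA (le_lt_trans (ler_normD _ _))//.
by rewrite (splitr e) ltrD// distrC.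
Qed.

(** A point of [K] has a neighbourhood where [q] stays near its trace, or one
    that [Om] does not meet; compactness makes the bound uniform. *)
Lemma bounded_of_trace {R : realType} {Om K : set (R * R)} {q : R * R -> R} :
  (forall w, closure Om w -> has_trace Om q w) -> compact K ->
  exists C, forall z, K z -> Om z -> `|q z| <= C.
Proof.
move=> hq /compact_near_coveringP cK.
have : \forall C \near +oo, K `<=` (fun z => Om z -> `|q z| <= C).
  apply: cK => z Kz.
  have [cz|ncz] := pselect (closure Om z).
    have [d d0 dP] := trace_box cz (hq _ cz) _ ltr01.
    exists (ball z d, [set C | `|trace Om q z| + 1 < C]).
      split; first exact: nbhsx_ballx.
      by apply: nbhs_pinfty_gt; rewrite num_real.
    move=> [w C] [/= [w1 w2] wC] Ow.
    apply/ltW/(lt_trans _ wC); rewrite addrC -ltrBlDr.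
    apply: (le_lt_trans (lerB_dist _ _)).
    by apply: dP => //; rewrite distrC.
  have /existsNP[d /not_implyP[d0 nd]] : ~ forall d, 0 < d ->
     exists2 w, Om w & (`|w.1 - z.1| < d /\ `|w.2 - z.2| < d).
    by move=> /closure_box.
  exists (ball z d, setT); first by split; [exact: nbhsx_ballx|exact: filterT].
  move=> [w C] [/= [w1 w2] _] Ow.
  by exfalso; apply: nd; exists w => //; split; rewrite distrC.
move=> /filter_ex[C HC]; exists C => z; exact: HC.
Qed.

Lemma is_derive_curve {R : realType} {q : R * R -> R} {a b : R -> R}
    {x da db : R} :
  differentiable q (a x, b x) ->
  is_derive x 1 a da -> is_derive x 1 b db ->
  is_derive x 1 (fun t => q (a t, b t))
    (da * dx q (a x, b x) + db * dy q (a x, b x)).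
Proof.
move=> dq [dera ea] [derb eb].
have Da : differentiable a x by apply/derivable1_diffP.
have Db : differentiable b x by apply/derivable1_diffP.
have Dab : differentiable (fun t => (a t, b t)) x.
  exact: differentiable_pair.
have Dc : differentiable (q \o (fun t => (a t, b t))) x.
  exact: differentiable_comp.
apply: DeriveDef; first exact/derivable1_diffP.
rewrite deriveE// diff_comp//= diff_pair//= -!deriveE// ea eb.
rewrite /dx /dy !deriveE//.
have -> : (da, db) = da *: (1, 0) + db *: (0, 1) :> R * R.
  congr pair; rewrite /= scaler0 ?(addr0, add0r).
    exact/esym/mulr1.
  exact/esym/mulr1.
by rewrite linearD !linearZ.
Qed.

(** * Integrals of continuous functions over the unit interval *)

Set Implicit Arguments.
Unset Strict Implicit.
Unset Printing Implicit Defensive.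

Section continuity.
Context {R : realType} {T : topologicalType}.
Implicit Types f g : T -> R.

Lemma contD f g : continuous f -> continuous g ->
  continuous (fun x => f x + g x).
Proof. by move=> cf cg x; apply: cvgD; [exact: cf|exact: cg]. Qed.

Lemma contN f : continuous f -> continuous (fun x => - f x).
Proof. by move=> cf x; apply: cvgN; exact: cf. Qed.

Lemma contM f g : continuous f -> continuous g ->
  continuous (fun x => f x * g x).
Proof. by move=> cf cg x; apply: cvgM; [exact: cf|exact: cg]. Qed.

Lemma contX f n : continuous f -> continuous (fun x => f x ^+ n).
Proof.
move=> cf x; apply: (@continuous_comp _ _ _ f (fun y => y ^+ n)).
  exact: cf.
exact: exprn_continuous.
Qed.

Lemma contV f : (forall x, f x != 0) -> continuous f ->
  continuous (fun x => (f x)^-1).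
Proof. by move=> f0 cf x; apply: cvgV; [exact: f0|exact: cf]. Qed.

Lemma contC (c : R) : continuous (fun _ : T => c).
Proof. by move=> x; exact: cvg_cst. Qed.

Lemma cont_max f g : continuous f -> continuous g ->
  continuous (fun x => Num.max (f x) (g x)).
Proof. by move=> cf cg x; exact: (continuous_max (cf x) (cg x)). Qed.

Lemma cont_min f g : continuous f -> continuous g ->
  continuous (fun x => Num.min (f x) (g x)).
Proof. by move=> cf cg x; exact: (continuous_min (cf x) (cg x)). Qed.

Lemma cont_pair f g : continuous f -> continuous g ->
  continuous (fun x => (f x, g x)).
Proof. by move=> cf cg x; exact: (cvg_pair (cf x) (cg x)). Qed.

Lemma cont_comp {V : topologicalType} (g : T -> V) (h : V -> R) :
  continuous g -> continuous h -> continuous (fun x => h (g x)).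
Proof. by move=> cg ch x; apply: continuous_comp; [exact: cg|exact: ch]. Qed.

End continuity.

Ltac cont := repeat match goal with
  | |- continuous (fun=> ?c) => exact: contC
  | |- continuous (fun x => @?a x + @?b x) => apply: (@contD _ _ a b)
  | |- continuous (fun x => - @?a x) => apply: (@contN _ _ a)
  | |- continuous (fun x => @?a x * @?b x) => apply: (@contM _ _ a b)
  | |- continuous (fun x => @?a x ^+ ?n) => apply: (@contX _ _ a n)
  | |- _ => assumption
  end.

Definition int01 {R : realType} (g : R -> R) : R :=
  \int[@lebesgue_measure R]_(y in `[0, 1]) g y.

Section calculus.
Context {R : realType}.

Lemma is_derive_derive1 (F : R -> R) (x a : R) : is_derive x 1 F a -> (F^`() x)%classic = a.
Proof. by move=> [_ <-]; rewrite derive1E. Qed.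

Lemma is_derive_continuous (F : R -> R) (x a : R) :
  is_derive x 1 F a -> {for x, continuous F}.
Proof.
by move=> [dF _]; apply/differentiable_continuous/derivable1_diffP.
Qed.

Lemma mvt_cc (F dF : R -> R) (a b : R) : a <= b ->
  (forall x, a <= x <= b -> is_derive x 1 F (dF x)) ->
  exists2 c, a <= c <= b & F b - F a = dF c * (b - a).
Proof.
move=> ab dFP.
have [||c] := @MVT_segment R F dF a b ab.
- by move=> x; rewrite in_itv/= => /andP[/ltW ax /ltW xb]; apply: dFP; rewrite ax.
- apply: continuous_in_subspaceT => x; rewrite inE/= in_itv/= => xab.
  by apply: is_derive_continuous (dFP x _).
by rewrite in_itv/=; exists c.
Qed.

Lemma ge0_derive_le (F dF : R -> R) (a b : R) : a <= b ->
  (forall x, a <= x <= b -> is_derive x 1 F (dF x)) ->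
  (forall x, a <= x <= b -> 0 <= dF x) -> F a <= F b.
Proof.
move=> ab dFP dF0; rewrite -subr_ge0.
have [c /dF0 c0 ->] := mvt_cc ab dFP.
by rewrite mulr_ge0// subr_ge0.
Qed.

Lemma near_interior (y d : R) : 0 <= y <= 1 -> 0 < d ->
  exists2 x : R, 0 < x < 1 & `|x - y| < d.
Proof.
move=> y01 d0; pose m := Num.min (2^-1) d.
have m0 : 0 < m by rewrite !lt_min d0 invr_gt0 ltr0n.
have [m1 m2] : m <= 2^-1 /\ m <= d by rewrite !ge_min !lexx !orbT.
have [y2|y2] := leP y 2^-1.
  exists (y + m / 2); first by apply/andP; split; lra.
  by rewrite ltr_norml; lra.
exists (y - m / 2); first by apply/andP; split; lra.
by rewrite ltr_norml; lra.
Qed.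

End calculus.

Section int01.
Context {R : realType}.
Implicit Types g h : R -> R.

Lemma integrable01 g : continuous g ->
  (@lebesgue_measure R).-integrable `[0, 1] (EFin \o g).
Proof.
move=> cg; apply: continuous_compact_integrable; first exact: segment_compact.
exact: continuous_subspaceT.
Qed.

Lemma int01D g h : continuous g -> continuous h ->
  int01 (fun y => g y + h y) = int01 g + int01 h.
Proof. by move=> cg ch; apply: RintegralD => //; exact: integrable01. Qed.

Lemma int01Z c g : continuous g -> int01 (fun y => c * g y) = c * int01 g.
Proof. by move=> cg; apply: RintegralZl => //; exact: integrable01. Qed.

Lemma int01B g h : continuous g -> continuous h ->
  int01 (fun y => g y - h y) = int01 g - int01 h.
Proof. by move=> cg ch; apply: RintegralB => //; exact: integrable01. Qed.

Lemma int01_cst (c : R) : int01 (fun=> c) = c.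
Proof.
rewrite /int01 Rintegral_cst// [X in fine X](_ : _ = (1 - 0)%:E).
  by rewrite /= subr0 mulr1.
by have := @lebesgue_measure_itv R `[0, 1]; rewrite /= lte_fin ltr01.
Qed.

Lemma primitive_exists g (A : R) : continuous g ->
  exists F : R -> R, forall x : R, - A < x < A -> is_derive x 1 F (g x).
Proof.
move=> cg; exists (fun x => \int[@lebesgue_measure R]_(t in `[- A, x]) g t).
move=> x /andP[x1 x2].
have ig : (@lebesgue_measure R).-integrable `[- A, A] (EFin \o g).
  apply: continuous_compact_integrable; first exact: segment_compact.
  exact: continuous_subspaceT.
have := @continuous_FTC1_closed R g (- A) x A x2 ig x1 (cg x).
set F := fun x => _; move=> [dF F'].
by apply: DeriveDef; [exact: dF|rewrite -derive1E; exact: F'].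
Qed.

Lemma int01_primitive g (F : R -> R) : continuous g ->
  (forall x : R, - 2 < x < 2 -> is_derive x 1 F (g x)) -> int01 g = F 1 - F 0.
Proof.
move=> cg dF.
have cF (x : R) : - 2 < x < 2 -> {for x, continuous F}.
  by move=> /dF; exact: is_derive_continuous.
rewrite /int01 /Rintegral (@continuous_FTC2 R g F) ?ltr01//.
- exact: continuous_subspaceT.
- split.
  + by move=> x; rewrite in_itv/= => x01; have [] : is_derive x 1 F (g x);
      [apply: dF; lra|].
  + by apply: cvg_at_right_filter; apply: cF; lra.
  + by apply: cvg_at_left_filter; apply: cF; lra.
- move=> x; rewrite in_itv/= => x01.
  by apply: is_derive_derive1; apply: dF; lra.
Qed.

(** An inequality between continuous functions passes to the end points. *)
Lemma ge0_boundary g : continuous g -> (forall y : R, 0 < y < 1 -> 0 <= g y) ->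
  forall y : R, 0 <= y <= 1 -> 0 <= g y.
Proof.
move=> cg g0 y y01; rewrite leNgt; apply/negP => gy.
have e0 : 0 < - g y by rewrite oppr_gt0.
have /cvgrPdist_lt/(_ _ e0)/nbhs_ballP[d /= d0 dP] := cg y.
have [x x01 xy] := near_interior y01 d0.
have : `|g y - g x| < - g y by apply: dP; rewrite /ball/= distrC.
by have := g0 x x01; rewrite ltr_norml; lra.
Qed.

Lemma int01_ge0 g : continuous g -> (forall y : R, 0 < y < 1 -> 0 <= g y) ->
  0 <= int01 g /\ (int01 g = 0 -> forall y : R, 0 < y < 1 -> g y = 0).
Proof.
move=> cg /(ge0_boundary cg) g0.
have [F dF] := primitive_exists 2 cg.
have nF (x y : R) : 0 <= x -> x <= y -> y <= 1 -> F x <= F y.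
  move=> x0 xy y1; apply: (@ge0_derive_le _ F g) => // z zxy.
    by apply: dF; lra.
  by apply: g0; lra.
rewrite (int01_primitive cg dF); split; first by rewrite subr_ge0 nF.
move=> F10 y y01.
have Fc (z : R) : 0 < z < 1 -> F z = F 0.
  by move=> z01; have := nF 0 z (lexx _); have := nF z 1; lra.
have /is_derive_derive1 <- : is_derive y 1 F (g y) by apply: dF; lra.
rewrite derive1E -(derive_cst (F 0) y 1).
apply: near_eq_derive.
have : y \in `]0, 1[ by rewrite in_itv.
by move=> /near_in_itvoo; apply: filterS => z; rewrite in_itv/=; exact: Fc.
Qed.

Lemma le_int01 g h : continuous g -> continuous h ->
  (forall y : R, 0 < y < 1 -> g y <= h y) -> int01 g <= int01 h.
Proof.
move=> cg ch gh.
rewrite -subr_ge0 -int01B//; apply: (int01_ge0 _ _).1; first by cont.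
by move=> y /gh; rewrite subr_ge0.
Qed.

Lemma int01_norm g (B : R) : continuous g ->
  (forall y : R, 0 < y < 1 -> `|g y| <= B) -> `|int01 g| <= B.
Proof.
move=> cg gB; rewrite ler_norml -{2}(int01_cst B) -(int01_cst (- B)).
by apply/andP; split; apply: le_int01 => //; try exact: cst_continuous;
  move=> y /gB; rewrite ler_norml => /andP[].
Qed.

(** Cauchy-Schwarz, from the nonnegative variance of [g]. *)
Lemma sqr_int01 g : continuous g ->
  int01 g ^+ 2 <= int01 (fun y => g y ^+ 2).
Proof.
move=> cg; set m := int01 g.
have cg2 : continuous (fun y => g y ^+ 2) by cont.
have cm : continuous (fun y => 2 * m * g y) by cont.
have : int01 (fun y => 2 * m * g y) <= int01 (fun y => g y ^+ 2 + m ^+ 2).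
  apply: le_int01 => //; first by cont.
  by move=> y _; have := sqr_ge0 (g y - m); nra.
rewrite int01Z// int01D//; last exact: cst_continuous.
rewrite int01_cst -/m; nra.
Qed.

End int01.

(** * Circulation along the leaves of a half strip *)

Section leaves.
Context {R : realType}.

Lemma continuous_leaf (g : R * R -> R) (s : R) : continuous g ->
  continuous (fun y => g (s, y)).
Proof.
move=> cg; apply: (cont_comp (g := fun y => (s, y))) => //.
by apply: cont_pair; [exact: contC|move=> y; exact: cvg_id].
Qed.

(** Uniform continuity across a leaf, by compactness of the leaf. *)
Lemma tube (g : R * R -> R) (s e : R) : continuous g -> 0 < e ->
  exists2 d, 0 < d & forall s' y : R, `|s' - s| < d -> 0 <= y <= 1 ->
    `|g (s', y) - g (s, y)| < e.
Proof.
move=> cg e0.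
have /compact_near_coveringP cK := @segment_compact R 0 1.
have e20 : 0 < e / 2 by rewrite divr_gt0.
have : \forall s' \near s, `[0, 1] `<=` (fun y => `|g (s', y) - g (s, y)| < e).
  apply: (cK _ (nbhs s) (fun s' y => `|g (s', y) - g (s, y)| < e)) => y _.
  have [d d0 dP] := (continuous_box _ _).1 (cg (s, y)) _ e20.
  exists (ball y d, ball s d); first by split; exact: nbhsx_ballx.
  move=> [y' s'] [/= y1 s1].
  have a1 : `|g (s', y') - g (s, y)| < e / 2.
    by apply: dP; rewrite distrC.
  have a2 : `|g (s, y') - g (s, y)| < e / 2.
    by apply: dP; rewrite ?subrr ?normr0// distrC.
  rewrite -(subrK (g (s, y)) (g (s', y'))) -addrA (le_lt_trans (ler_normD _ _))//.
  by rewrite (splitr e) ltrD// distrC.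
move=> /nbhs_ballP[d /= d0 dP]; exists d => // s' y s's y01.
by apply: dP; rewrite /ball/= ?in_itv//= distrC.
Qed.

Lemma leaf_bounded (g : R * R -> R) (s : R) : continuous g ->
  exists2 B, 0 <= B & forall y : R, 0 <= y <= 1 -> `|g (s, y)| <= B.
Proof.
move=> cg.
have cg' : continuous (fun y => `|g (s, y)|).
  apply: (cont_comp (h := Num.norm)); first exact: continuous_leaf.
  exact: norm_continuous.
have [c _ cP] := EVT_max (@ler01 R) (continuous_subspaceT cg').
by exists `|g (s, c)|.
Qed.

(** The derivatives are those on the open interval: the functions integrated
    below are extended past the end points by constants. *)
Lemma int01_by_parts (F dF G dG : R -> R) :
  continuous F -> continuous G -> continuous dF -> continuous dG ->
  (forall y : R, 0 < y < 1 -> is_derive y 1 F (dF y)) ->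
  (forall y : R, 0 < y < 1 -> is_derive y 1 G (dG y)) ->
  G 0 = 0 -> G 1 = 0 ->
  int01 (fun y => F y * dG y) = - int01 (fun y => dF y * G y).
Proof.
move=> cF cG cdF cdG dFP dGP G0 G1.
rewrite /int01 (@Rintegration_by_parts R F G dF dG 0 1)//.
- by rewrite G0 G1 !mulr0 subrr sub0r.
- exact: continuous_subspaceT.
- split; last 2 first.
  + by apply: cvg_at_right_filter; exact: cF.
  + by apply: cvg_at_left_filter; exact: cF.
  + by move=> x; rewrite in_itv/= => /dFP[].
- by move=> x; rewrite in_itv/= => /dFP/is_derive_derive1.
- exact: continuous_subspaceT.
- split; last 2 first.
  + by apply: cvg_at_right_filter; exact: cG.
  + by apply: cvg_at_left_filter; exact: cG.
  + by move=> x; rewrite in_itv/= => /dGP[].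
- by move=> x; rewrite in_itv/= => /dGP/is_derive_derive1.
Qed.

(** Continuous differentiability up to the boundary of the half strip
    0 < s, 0 < y < 1: all three functions are continuous on the plane, which
    encodes the continuous extension of the partial derivatives of [Q] from the
    open half strip. *)
Definition leaf_C1 (Q Qs Qy : R * R -> R) : Prop :=
  [/\ continuous Q, continuous Qs, continuous Qy,
      forall s y : R, 0 < s -> 0 < y < 1 ->
        is_derive s 1 (fun s' => Q (s', y)) (Qs (s, y)) &
      forall s y : R, 0 < s -> 0 < y < 1 ->
        is_derive y 1 (fun y' => Q (s, y')) (Qy (s, y))].

(** The mean value theorem, made uniform along the leaf. *)
Lemma leaf_C1_uniform {Q Qs Qy : R * R -> R} {s : R} {e : R} :
  leaf_C1 Q Qs Qy -> 0 < s -> 0 < e ->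
  exists2 d, 0 < d & forall s' y : R, `|s' - s| < d -> 0 < y < 1 ->
   `|Q (s', y) - Q (s, y) - Qs (s, y) * (s' - s)| <= e * `|s' - s|.
Proof.
move=> [cQ cQs cQy dQs dQy] s0 e0.
have [d d0 dP] := tube s cQs e0.
exists (Num.min d s); first by rewrite lt_min d0.
move=> s' y; rewrite lt_min => /andP[s1 s2] y01.
have y01' : 0 <= y <= 1 by lra.
have [ss'|s's] := leP s s'.
  have [|c cc ->] := @mvt_cc _ (fun s' => Q (s', y)) (fun s => Qs (s, y)) _ _ ss'.
    by move=> x xx; apply: dQs => //; lra.
  rewrite -mulrBl normrM ler_wpM2r//; apply/ltW/dP => //.
  by move: s1; rewrite !ger0_norm ?subr_ge0//; lra.
have [|c cc E] := @mvt_cc _ (fun s' => Q (s', y)) (fun s => Qs (s, y)) _ _ (ltW s's).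
  move=> x xx; apply: dQs => //; move: s2; rewrite ltr_norml; lra.
have -> : Q (s', y) - Q (s, y) - Qs (s, y) * (s' - s) =
    (Qs (c, y) - Qs (s, y)) * (s' - s) by lra.
rewrite normrM ler_wpM2r//; apply/ltW/dP => //.
by move: s1; rewrite !ler0_norm ?subr_le0//; lra.
Qed.

Lemma is_derive_diffquot (G : R -> R) (s a : R) :
  (forall e, 0 < e -> exists2 d, 0 < d & forall s', `|s' - s| < d ->
     `|G s' - G s - a * (s' - s)| <= e * `|s' - s|) ->
  is_derive s 1 G a.
Proof.
move=> H.
have Ha : h^-1 *: ((G \o shift s) h%:A - G s) @[h --> 0^'] --> a.
  apply/cvgrPdist_le => e e0.
  have [d d0 dP] := H e e0.
  rewrite near_withinE; apply/nbhs_ballP; exists d => //= h.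
  rewrite /ball/= sub0r normrN => hd h0.
  have := dP (h + s); rewrite addrK => /(_ hd) K.
  rewrite /= [h%:A]mulr1 -[h^-1 *: _]/(h^-1 * _).
  have -> : a - h^-1 * (G (h + s) - G s) =
    - (h^-1 * (G (h + s) - G s - a * h)) by field.
  by rewrite normrN normrM normfV mulrC ler_pdivrMr// normr_gt0.
by apply: DeriveDef; [apply/cvg_ex; exists a|exact: cvg_lim Ha].
Qed.

Lemma stokes_error_bound (a b qs qy w w' D h B1 B2 B3 : R) :
  0 <= h -> `|a| <= h * `|D| -> `|b| <= h * `|D| -> `|w' - w| <= h ->
  `|qs| <= B1 -> `|w| <= B2 -> `|qy| <= B3 ->
  `|a * w' + D * qs * (w' - w) - qy * b| <= h * (B1 + B2 + B3 + h) * `|D|.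
Proof.
move=> h0 aD bD dw qsB wB qyB.
have w'B : `|w'| <= B2 + h.
  by rewrite -(subrK w w') addrC (le_trans (ler_normD _ _))// lerD.
have -> : h * (B1 + B2 + B3 + h) * `|D| =
  h * `|D| * (B2 + h) + `|D| * B1 * h + B3 * (h * `|D|) by ring.
apply: (le_trans (ler_normB _ _)); apply: lerD.
  apply: (le_trans (ler_normD _ _)); apply: lerD; rewrite !normrM.
    exact: ler_pM.
  by apply: ler_pM => //; rewrite ?mulr_ge0// ler_wpM2l.
by rewrite normrM; apply: ler_pM.
Qed.

(** Stokes' formula for [d (Q dW) = dQ /\ dW] on the strip between two leaves,
    in differential form.  The by-parts step exchanges the order of the two
    derivatives of [W], so one derivative of [Q] and [W] is enough. *)
Lemma leaf_stokes (Q Qs Qy W Ws Wy : R * R -> R) (s : R) :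
  leaf_C1 Q Qs Qy -> leaf_C1 W Ws Wy ->
  (forall s : R, 0 < s -> W (s, 0) = 0 /\ W (s, 1) = 0) -> 0 < s ->
  is_derive s 1 (fun s => int01 (fun y => Q (s, y) * Wy (s, y)))
    (int01 (fun y => Qs (s, y) * Wy (s, y) - Qy (s, y) * Ws (s, y))).
Proof.
move=> CQ CW W0 s0.
have [cQ cQs cQy dQs dQy] := CQ; have [cW cWs cWy dWs dWy] := CW.
apply: is_derive_diffquot => e e0.
have [B1 B10 B1P] := leaf_bounded s cQs.
have [B2 B20 B2P] := leaf_bounded s cWy.
have [B3 B30 B3P] := leaf_bounded s cQy.
pose B := B1 + B2 + B3 + 2.
have B0 : 0 < B by rewrite /B; lra.
pose h := Num.min 1 (e / B).
have h0 : 0 < h by rewrite lt_min ltr01 divr_gt0.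
have [h1 hB] : h <= 1 /\ h * B <= e.
  by rewrite -ler_pdivlMr// !ge_min !lexx !orbT.
have [d1 d10 d1P] := leaf_C1_uniform CQ s0 h0.
have [d2 d20 d2P] := leaf_C1_uniform CW s0 h0.
have [d3 d30 d3P] := tube s cWy h0.
exists (Num.min s (Num.min d1 (Num.min d2 d3))).
  by rewrite !lt_min s0 d10 d20.
move=> s'; rewrite !lt_min => /and4P[s1 s2 s3 s4].
have s'0 : 0 < s' by move: s1; rewrite ltr_norml; lra.
have cL (g : R * R -> R) : continuous g -> continuous (fun y => g (s, y)).
  exact: continuous_leaf.
have cL' (g : R * R -> R) : continuous g -> continuous (fun y => g (s', y)).
  exact: continuous_leaf.
have cQL := cL _ cQ; have cQL' := cL' _ cQ.
have cWL := cL _ cW; have cWL' := cL' _ cW.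
have cQyL := cL _ cQy; have cWyL := cL _ cWy; have cWyL' := cL' _ cWy.
have cQsL := cL _ cQs; have cWsL := cL _ cWs.
have E1 : int01 (fun y => Q (s, y) * (Wy (s', y) - Wy (s, y))) =
    - int01 (fun y => Qy (s, y) * (W (s', y) - W (s, y))).
  apply: (@int01_by_parts (fun y => Q (s, y)) (fun y => Qy (s, y))
    (fun y => W (s', y) - W (s, y)) (fun y => Wy (s', y) - Wy (s, y)));
    [by cont..|by move=> y; exact: dQy| | |].
  - move=> y y01; apply: is_deriveB; exact: dWy.
  - by rewrite (W0 _ s0).1 (W0 _ s'0).1 subrr.
  - by rewrite (W0 _ s0).2 (W0 _ s'0).2 subrr.
set D := s' - s.
(* What remains of the increment of the circulation after the derivative has
   been subtracted and the derivatives of [W] have been exchanged. *)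
pose err y := (Q (s', y) - Q (s, y) - Qs (s, y) * D) * Wy (s', y) +
   D * Qs (s, y) * (Wy (s', y) - Wy (s, y)) -
   Qy (s, y) * (W (s', y) - W (s, y) - Ws (s, y) * D).
have cerr : continuous err by rewrite /err; cont.
have -> : int01 (fun y => Q (s', y) * Wy (s', y)) -
   int01 (fun y => Q (s, y) * Wy (s, y)) -
   int01 (fun y => Qs (s, y) * Wy (s, y) - Qy (s, y) * Ws (s, y)) * D =
   int01 err.
  pose X y := Q (s, y) * (Wy (s', y) - Wy (s, y)).
  pose Y y := Qy (s, y) * (W (s', y) - W (s, y)).
  pose F1 y := Q (s', y) * Wy (s', y).
  pose F2 y := Q (s, y) * Wy (s, y).
  pose F3 y := Qs (s, y) * Wy (s, y) - Qy (s, y) * Ws (s, y).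
  have cX : continuous X by rewrite /X; cont.
  have cY : continuous Y by rewrite /Y; cont.
  have cF1 : continuous F1 by rewrite /F1; cont.
  have cF2 : continuous F2 by rewrite /F2; cont.
  have cF3 : continuous F3 by rewrite /F3; cont.
  have cDF : continuous (fun y => D * F3 y) by cont.
  have cF12 : continuous (fun y => F1 y - F2 y) by cont.
  have XY0 : int01 (fun y => X y + Y y) = 0.
    by rewrite int01D// [int01 X]E1 addNr.
  have -> : err = (fun y => (F1 y - F2 y - D * F3 y) - (X y + Y y)).
    by apply/funext => y; rewrite /err /F1 /F2 /F3 /X /Y; ring.
  have cXY : continuous (fun y => X y + Y y) by cont.
  have cF123 : continuous (fun y => F1 y - F2 y - D * F3 y) by cont.
  by rewrite (int01B cF123 cXY) XY0 subr0 (int01B cF12 cDF) (int01B cF1 cF2)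
    (int01Z _ cF3) mulrC.
apply: int01_norm => // y y01.
have y01' : 0 <= y <= 1 by case/andP: y01 => /ltW -> /ltW ->.
apply: (@le_trans _ _ (h * (B1 + B2 + B3 + h) * `|D|)); last first.
  apply: ler_wpM2r => //; apply: le_trans hB.
  by rewrite ler_wpM2l ?ltW// /B; lra.
apply: stokes_error_bound; first exact/ltW.
- exact: d1P.
- exact: d2P.
- exact/ltW/d3P.
- exact: B1P.
- exact: B2P.
- exact: B3P.
Qed.

End leaves.

(** * A Riccati inequality *)

(** A solution of [G' >= c G ^ 2] on a half line that starts from [0] would
    blow up in finite time if it became positive. *)
Lemma riccati_eq0 {R : realType} (G dG : R -> R) (c : R) : 0 < c ->
  (forall s : R, 0 < s -> is_derive s 1 G (dG s)) ->
  (forall s : R, 0 < s -> c * G s ^+ 2 <= dG s) ->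
  (forall e : R, 0 < e -> exists2 d, 0 < d & forall s : R, 0 < s < d -> `|G s| < e) ->
  forall s : R, 0 < s -> dG s = 0.
Proof.
move=> c0 dGP dGc G0.
have dG0 (s : R) : 0 < s -> 0 <= dG s.
  by move=> s0; apply: le_trans (dGc s s0); rewrite mulr_ge0 ?sqr_ge0// ltW.
have mG (s s' : R) : 0 < s -> s <= s' -> G s <= G s'.
  move=> s0 ss'; apply: (@ge0_derive_le _ G dG) => // x /andP[x1 _].
    by apply: dGP; lra.
  by apply: dG0; lra.
have pG (s : R) : 0 < s -> 0 <= G s.
  move=> s0; rewrite leNgt; apply/negP => Gs.
  have [|d d0 dP] := G0 (- G s); first by rewrite oppr_gt0.
  pose x := Num.min s (d / 2).
  have x0 : 0 < x by rewrite lt_min s0 divr_gt0.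
  have [xs xd] : x <= s /\ x <= d / 2 by rewrite !ge_min !lexx orbT.
  have := mG x s x0 xs; have := dP x.
  rewrite x0 ltr_norml => /(_ _)/andP[]; first by lra.
  lra.
have zG (s : R) : 0 < s -> G s = 0.
  move=> s0; apply/eqP; rewrite eq_le pG// andbT leNgt; apply/negP => Gs.
  (* By this point [- 1 / G], which increases at rate at least [c], would have
     left the negative half line. *)
  pose b := s + (c * G s)^-1.
  have cG0 : 0 < (c * G s)^-1 by rewrite invr_gt0 mulr_gt0.
  have Gx (x : R) : s <= x -> 0 < G x by move=> sx; apply: lt_le_trans (mG s x s0 sx).
  pose F x := - (G x)^-1 - c * x.
  have : F s <= F b.
    apply: (@ge0_derive_le _ F (fun x => G x ^- 2 * dG x - c)).
    - by rewrite /b; lra.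
    - move=> x /andP[sx _].
      have Gx0 := Gx x sx.
      have dx : is_derive x 1 G (dG x) by apply: dGP; lra.
      have d1 := is_deriveV (lt0r_neq0 Gx0) dx.
      apply: is_derive_eq.
      by rewrite -[- G x ^- 2 *: dG x]/(- G x ^- 2 * dG x) [c%:A]mulr1
        mulNr opprK.
    - move=> x /andP[sx _].
      rewrite subr_ge0 mulrC ler_pdivlMr ?exprn_gt0 ?Gx//.
      by apply: dGc; lra.
  rewrite /F /b.
  have Gb : 0 < (G (s + (c * G s)^-1))^-1 by rewrite invr_gt0 Gx//; lra.
  have -> : c * (s + (c * G s)^-1) = c * s + (G s)^-1.
    by field; rewrite !lt0r_neq0.
  move: Gb; lra.
move=> s s0.
have /is_derive_derive1 <- := dGP s s0.
rewrite derive1E -(derive_cst (0 : R) s 1).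
apply: near_eq_derive.
by near=> z; apply: zG; near: z; exact: lt_nbhsr.
Unshelve. all: by end_near. Qed.

(** * Rigidity of pairs with nonnegative Jacobian *)

Section leaf_calculus.
Context {R : realType}.

Lemma leaf_C1M (Q Qs Qy W Ws Wy : R * R -> R) :
  leaf_C1 Q Qs Qy -> leaf_C1 W Ws Wy ->
  leaf_C1 (fun z => Q z * W z) (fun z => Q z * Ws z + W z * Qs z)
    (fun z => Q z * Wy z + W z * Qy z).
Proof.
move=> [cQ cQs cQy dQs dQy] [cW cWs cWy dWs dWy]; split; try by cont.
- by move=> s y s0 y01; apply: is_deriveM; [exact: dQs|exact: dWs].
- by move=> s y s0 y01; apply: is_deriveM; [exact: dQy|exact: dWy].
Qed.

Lemma leaf_C1_addl (c : R) (Q Qs Qy : R * R -> R) :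
  leaf_C1 Q Qs Qy -> leaf_C1 (fun z => c + Q z) Qs Qy.
Proof.
move=> [cQ cQs cQy dQs dQy]; split; try by cont.
- move=> s y s0 y01; rewrite -[Qs _]add0r.
  exact: (is_deriveD (is_derive_cst c s 1) (dQs s y s0 y01)).
- move=> s y s0 y01; rewrite -[Qy _]add0r.
  exact: (is_deriveD (is_derive_cst c y 1) (dQy s y s0 y01)).
Qed.

Lemma leaf_C1V (Q Qs Qy : R * R -> R) : (forall z, Q z != 0) ->
  leaf_C1 Q Qs Qy ->
  leaf_C1 (fun z => (Q z)^-1) (fun z => - (Q z)^-1 ^+ 2 * Qs z)
    (fun z => - (Q z)^-1 ^+ 2 * Qy z).
Proof.
move=> Q0 [cQ cQs cQy dQs dQy].
have cV := contV Q0 cQ.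
split; try by cont.
- move=> s y s0 y01; rewrite exprVn.
  exact: (is_deriveV (f := fun s' => Q (s', y)) (Q0 _) (dQs s y s0 y01)).
- move=> s y s0 y01; rewrite exprVn.
  exact: (is_deriveV (f := fun y' => Q (s, y')) (Q0 _) (dQy s y s0 y01)).
Qed.

(** On the boundary leaf only one-sided information is available: the derivative
    along it is the limit of the derivatives along the neighbouring leaves. *)
Lemma leaf_C1_boundary (Q Qs Qy : R * R -> R) (y : R) :
  leaf_C1 Q Qs Qy -> 0 < y < 1 ->
  is_derive y 1 (fun y => Q (0, y)) (Qy (0, y)).
Proof.
move=> [cQ cQs cQy dQs dQy] y01.
apply: is_derive_diffquot => e e0.
have [d d0 dP] := (continuous_box _ _).1 (cQy (0, y)) _ e0.
exists (Num.min d (Num.min y (1 - y))).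
  by rewrite !lt_min d0 subr_gt0.
move=> y'; rewrite !lt_min => /and3P[y'd y'0 y'1].
have y'01 : 0 < y' < 1 by move: y'0 y'1; rewrite !ltr_norml; lra.
have near0 (s : R) : 0 < s < d ->
    `|Q (s, y') - Q (s, y) - Qy (0, y) * (y' - y)| <= e * `|y' - y|.
  move=> /andP[s0 sd].
  have Qyc (c : R) : `|c - y| < d -> `|Qy (s, c) - Qy (0, y)| <= e.
    by move=> cd; apply/ltW/dP; rewrite //= subr0 gtr0_norm.
  have [yy'|y'y] := leP y y'.
    have [|c cc ->] := @mvt_cc _ (fun y => Q (s, y)) (fun y => Qy (s, y)) _ _ yy'.
      by move=> x xx; apply: dQy => //; lra.
    rewrite -mulrBl normrM ler_wpM2r//; apply: Qyc.
    by move: y'd; rewrite !ltr_norml; lra.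
  have [|c cc E] := @mvt_cc _ (fun y => Q (s, y)) (fun y => Qy (s, y)) _ _ (ltW y'y).
    by move=> x xx; apply: dQy => //; lra.
  have -> : Q (s, y') - Q (s, y) - Qy (0, y) * (y' - y) =
    (Qy (s, c) - Qy (0, y)) * (y' - y) by lra.
  rewrite normrM ler_wpM2r//; apply: Qyc.
  by move: y'd; rewrite !ltr_norml; lra.
apply/ler_addgt0Pr => h h0.
have h20 : 0 < h / 2 by rewrite divr_gt0.
have [d1 d10 d1P] := (continuous_box _ _).1 (cQ (0, y)) _ h20.
have [d2 d20 d2P] := (continuous_box _ _).1 (cQ (0, y')) _ h20.
pose s := Num.min d (Num.min d1 d2) / 2.
have m0 : 0 < Num.min d (Num.min d1 d2) by rewrite !lt_min d0 d10.
have s0 : 0 < s by rewrite divr_gt0.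
have [sd [sd1 sd2]] : s < d /\ s < d1 /\ s < d2.
  have : s < Num.min d (Num.min d1 d2) by rewrite /s; lra.
  by rewrite !lt_min => /and3P[].
have := near0 s; rewrite s0 sd => /(_ isT) b0.
have b1 : `|Q (s, y) - Q (0, y)| < h / 2.
  by apply: d1P; rewrite /= ?subr0 ?subrr ?normr0 ?gtr0_norm.
have b2 : `|Q (s, y') - Q (0, y')| < h / 2.
  by apply: d2P; rewrite /= ?subr0 ?subrr ?normr0 ?gtr0_norm.
have -> : Q (0, y') - Q (0, y) - Qy (0, y) * (y' - y) =
  (Q (s, y') - Q (s, y) - Qy (0, y) * (y' - y)) +
  ((Q (s, y) - Q (0, y)) - (Q (s, y') - Q (0, y'))) by ring.
apply: (le_trans (ler_normD _ _)); apply: lerD => //.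
apply: (le_trans (ler_normB _ _)).
by rewrite (splitr h) lerD// ltW.
Qed.

(** The circulation of [Q dW] along the leaves starts from [0], grows at the
    rate of the integral of the Jacobian, and is controlled by that rate; the
    Riccati inequality leaves room only for a vanishing Jacobian. *)
Lemma leaf_rigidity (Q Qs Qy W Ws Wy : R * R -> R) (B C : R) :
  leaf_C1 Q Qs Qy -> leaf_C1 W Ws Wy ->
  (forall s : R, 0 < s -> W (s, 0) = 0 /\ W (s, 1) = 0) ->
  int01 (fun y => Q (0, y) * Wy (0, y)) = 0 ->
  0 <= B -> 0 <= C ->
  (forall s y : R, 0 < s -> 0 < y < 1 -> `|W (s, y)| <= B) ->
  (forall s y : R, 0 < s -> 0 < y < 1 ->
     0 <= Qs (s, y) * Wy (s, y) - Qy (s, y) * Ws (s, y) /\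
     Qy (s, y) ^+ 2 <= C * (Qs (s, y) * Wy (s, y) - Qy (s, y) * Ws (s, y))) ->
  forall s y : R, 0 < s -> 0 < y < 1 ->
    Qs (s, y) * Wy (s, y) - Qy (s, y) * Ws (s, y) = 0.
Proof.
move=> CQ CW W0 G00 B0 C0 WB JP s y s0 y01.
have [cQ cQs cQy dQs dQy] := CQ; have [cW cWs cWy dWs dWy] := CW.
pose J z := Qs z * Wy z - Qy z * Ws z.
have cJ : continuous J by rewrite /J; cont.
pose K := B ^+ 2 * C + 1.
have K0 : 0 < K by rewrite /K ltr_pwDr// mulr_ge0// sqr_ge0.
pose G s := int01 (fun y => Q (s, y) * Wy (s, y)).
pose dG s := int01 (fun y => J (s, y)).
have dG0 : dG s = 0.
  apply: (@riccati_eq0 _ G dG K^-1) => //; first by rewrite invr_gt0.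
  - by move=> x x0; exact: (leaf_stokes CQ CW W0 x0).
  - move=> x x0; rewrite mulrC ler_pdivrMr//.
    have cQx := @continuous_leaf _ _ x cQ; have cQyx := @continuous_leaf _ _ x cQy.
    have cWx := @continuous_leaf _ _ x cW; have cWyx := @continuous_leaf _ _ x cWy.
    have cJx := @continuous_leaf _ _ x cJ.
    have -> : G x = - int01 (fun y => Qy (x, y) * W (x, y)).
      apply: (@int01_by_parts _ (fun y => Q (x, y)) (fun y => Qy (x, y))
        (fun y => W (x, y)) (fun y => Wy (x, y))) => //.
      + by move=> z; exact: dQy.
      + by move=> z; exact: dWy.
      + exact: (W0 x x0).1.
      + exact: (W0 x x0).2.
    rewrite sqrrN.
    have cQW : continuous (fun y => Qy (x, y) * W (x, y)) by cont.
    apply: (le_trans (sqr_int01 cQW)).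
    rewrite mulrC -int01Z//.
    apply: le_int01; [by cont|by cont|move=> z z01].
    have [J0 QJ] := JP x z x0 z01.
    have wB : W (x, z) ^+ 2 <= B ^+ 2.
      by rewrite -[W _ ^+ 2]real_normK ?num_real// ler_sqr ?nnegrE// WB.
    rewrite exprMn mulrC /K mulrDl mul1r -[J (x, z)]/(Qs (x, z) * _ - _) -mulrA.
    apply: (@le_trans _ _ (B ^+ 2 * Qy (x, z) ^+ 2)).
      by rewrite ler_wpM2r// sqr_ge0.
    by apply: ler_wpDr => //; rewrite ler_wpM2l// sqr_ge0.
  - move=> e e0.
    have e20 : 0 < e / 2 by rewrite divr_gt0.
    have cQWy : continuous (fun z => Q z * Wy z) by cont.
    have [d d0 dP] := tube 0 cQWy e20.
    exists d => // x /andP[x0 xd].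
    have cL (g : R * R -> R) t : continuous g -> continuous (fun y => g (t, y)).
      exact: continuous_leaf.
    have cQx := cL _ x cQ; have cWyx := cL _ x cWy.
    have cQ0 := cL _ 0 cQ; have cWy0 := cL _ 0 cWy.
    have -> : G x = int01 (fun y => Q (x, y) * Wy (x, y) - Q (0, y) * Wy (0, y)).
      by rewrite int01B ?G00 ?subr0//; cont.
    apply: (@le_lt_trans _ _ (e / 2)); last lra.
    apply: int01_norm; first by cont.
    move=> z /andP[z0 z1]; apply/ltW/dP; last by rewrite !ltW.
    by rewrite subr0 gtr0_norm.
have cJs := @continuous_leaf _ _ s cJ.
have J0 (z : R) : 0 < z < 1 -> 0 <= J (s, z) by move=> z01; have [] := JP s z s0 z01.
exact: (int01_ge0 cJs J0).2 dG0 y y01.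
Qed.

End leaf_calculus.

(** * Straightening the region behind a shock front *)

Section shock_curve.
Context {R : realType}.
Implicit Types (f : R -> R) (y : R).

(** The one-sided derivative at the end points and the ordinary one inside
    obey the same first order expansion. *)
Lemma deriv01_box f y : derivable01 f -> 0 <= y <= 1 ->
  forall e, 0 < e -> exists2 d, 0 < d & forall s, 0 <= s <= 1 ->
    `|s - y| < d -> `|f s - f y - deriv01 f y * (s - y)| <= e * `|s - y|.
Proof.
move=> df y01 e e0.
have /cvgrPdist_le/(_ e e0) := df y y01.
rewrite near_withinE near_withinE => /nbhs_ballP[d /= d0 dP].
exists d => // s s01 sy.
have [->|sy0] := eqVneq s y; first by rewrite !subrr mulr0 subr0 normr0 mulr0.
have := dP s; rewrite /ball/= distrC => /(_ sy sy0).
rewrite in_itv/= => /(_ s01); rewrite -/(deriv01 f y) => K.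
have sy' : s - y != 0 by rewrite subr_eq0.
have -> : f s - f y - deriv01 f y * (s - y) =
  - ((deriv01 f y - (f s - f y) / (s - y)) * (s - y)) by field.
by rewrite normrN normrM ler_wpM2r.
Qed.

Lemma derivable01_continuous f y : derivable01 f -> 0 <= y <= 1 ->
  forall e, 0 < e -> exists2 d, 0 < d & forall s, 0 <= s <= 1 ->
    `|s - y| < d -> `|f s - f y| < e.
Proof.
move=> df y01 e e0.
have [d d0 dP] := deriv01_box df y01 ltr01.
set D := `|deriv01 f y| + 2.
have D0 : 0 < D by rewrite /D ltr_wpDl.
exists (Num.min d (e / D)); first by rewrite lt_min d0 divr_gt0.
move=> s s01; rewrite lt_min => /andP[s1 s2].
have := dP s s01 s1; rewrite mul1r => K.
have -> : f s - f y =
  (f s - f y - deriv01 f y * (s - y)) + deriv01 f y * (s - y) by ring.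
apply: (le_lt_trans (ler_normD _ _)); rewrite normrM.
apply: (@le_lt_trans _ _ (D * `|s - y|)).
  by rewrite /D mulrDl; have := normr_ge0 (s - y); lra.
by rewrite mulrC -ltr_pdivlMr.
Qed.

Lemma is_derive_deriv01 f y : derivable01 f -> 0 < y < 1 ->
  is_derive y 1 f (deriv01 f y).
Proof.
move=> df /andP[y0 y1]; apply: is_derive_diffquot => e e0.
have [|d d0 dP] := deriv01_box df _ e0 (y := y); first by rewrite !ltW.
exists (Num.min d (Num.min y (1 - y))); first by rewrite !lt_min d0 y0 subr_gt0.
move=> s; rewrite !lt_min => /and3P[sd s0 s1]; apply: dP => //.
by move: s0 s1; rewrite !ltr_norml; lra.
Qed.

(** Composing with this projection onto the unit interval makes functions on
    [0, 1] globally defined without changing their continuity. *)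
Definition clamp y : R := Num.max 0 (Num.min y 1).

Lemma clamp01 y : 0 <= clamp y <= 1.
Proof. by rewrite /clamp le_max lexx ge_max ler01 ge_min lexx orbT. Qed.

Lemma clamp_id y : 0 <= y <= 1 -> clamp y = y.
Proof.
by move=> /andP[y0 y1]; rewrite /clamp min_l// max_r.
Qed.

Lemma continuous_clamp : continuous clamp.
Proof.
apply: cont_max; first exact: contC.
by apply: cont_min; [move=> y; exact: cvg_id|exact: contC].
Qed.

Lemma continuous_clamp_comp f : derivable01 f -> continuous (fun y => f (clamp y)).
Proof.
move=> df y; apply/cvgrPdist_lt => e e0.
have [d d0 dP] := derivable01_continuous df (clamp01 y) e0.
have /cvgrPdist_lt/(_ d d0) := @continuous_clamp y.
apply: filterS => s sd; rewrite distrC; apply: dP; first exact: clamp01.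
by rewrite distrC.
Qed.

End shock_curve.

Section strip.
Context {R : realType} (f : R -> R).
Hypotheses (f_C2 : C2_01 f)
  (f_gt : forall y : R, 0 < y < 1 -> -1 < f y).

Let df : derivable01 f. Proof. by case: f_C2. Qed.
Let ddf : derivable01 (deriv01 f). Proof. by case: f_C2. Qed.

(** Straightening of the region behind the shock: the strip point [(s, y)] is
    sent to the point at horizontal distance [s] behind the shock. *)
Definition behind (z : R * R) : R * R :=
  (f (clamp z.2) + Num.max 0 z.1, clamp z.2).

Definition strip (q : R * R -> R) (z : R * R) : R :=
  trace (Dplus f) q (behind z).

(** The points of the closed strip are limits of points behind the shock, also
    at the walls and on the shock itself. *)
Lemma closure_behind (z : R * R) : closure (Dplus f) (behind z).
Proof.
apply/closure_box => d d0.
pose y := clamp z.2; have y01 := clamp01 z.2.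
have d20 : 0 < d / 2 by rewrite divr_gt0.
have [h h0 hP] := derivable01_continuous df y01 d20.
have [|x x01] := @near_interior _ y (Num.min d h) y01; first by rewrite lt_min d0.
rewrite lt_min => /andP[xd xh].
have x01' : 0 <= x <= 1 by lra.
have := hP x x01' xh; rewrite -/y => fx.
have s0 : 0 <= Num.max 0 z.1 by rewrite le_max lexx.
have fx1 := f_gt x01.
exists (f y + Num.max 0 z.1 + d / 2, x).
  by move: fx; rewrite ltr_norml => fx; split; [split|]; rewrite /=; lra.
rewrite /behind /= -/y; split; last exact: xd.
by rewrite addrAC subrr add0r gtr0_norm//; lra.
Qed.

Lemma Dplus_behind (s y : R) : 0 < s -> 0 < y < 1 -> Dplus f (f y + s, y).
Proof.
by move=> s0 y01; have := f_gt y01; split; [split|]; rewrite /=; lra.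
Qed.

Lemma behindE (s y : R) : 0 <= s -> 0 <= y <= 1 -> behind (s, y) = (f y + s, y).
Proof. by move=> s0 y01; rewrite /behind/= clamp_id// max_r. Qed.

Lemma stripE q (s y : R) : (forall z, closure (Dplus f) z -> has_trace (Dplus f) q z) ->
  0 < s -> 0 < y < 1 -> strip q (s, y) = q (f y + s, y).
Proof.
move=> hq s0 y01; have Dz := Dplus_behind s0 y01.
rewrite /strip behindE; [|exact: ltW|lra].
by apply: trace_interior => //; apply: hq; exact: subset_closure.
Qed.

Lemma continuous_strip q : (forall z, closure (Dplus f) z -> has_trace (Dplus f) q z) ->
  continuous (strip q).
Proof.
move=> hq z; apply/continuous_box => e e0.
have [d d0 dP] := trace_continuous hq (closure_behind (z := z)) _ e0.
have c1 : continuous (fun z => (behind z).1).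
  rewrite /behind/=; apply: contD.
    apply: (cont_comp (g := snd) (h := fun y => f (clamp y))).
      by move=> ?; exact: cvg_snd.
    exact: continuous_clamp_comp.
  apply: cont_max; first exact: contC.
  by move=> x; exact: cvg_fst.
have c2 : continuous (fun z => (behind z).2).
  apply: (cont_comp (g := snd) (h := clamp)); first by move=> ?; exact: cvg_snd.
  exact: continuous_clamp.
have [d1 d10 d1P] := (continuous_box _ _).1 (c1 z) _ d0.
have [d2 d20 d2P] := (continuous_box _ _).1 (c2 z) _ d0.
exists (Num.min d1 d2); first by rewrite lt_min d10.
move=> w; rewrite !lt_min => /andP[w1 w2] /andP[w3 w4].
by apply: dP; [exact: closure_behind|exact: d1P|exact: d2P].
Qed.

Lemma leaf_C1_strip q : C1_closure (Dplus f) q ->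
  leaf_C1 (strip q) (strip (dx q))
    (fun z => deriv01 f (clamp z.2) * strip (dx q) z + strip (dy q) z).
Proof.
move=> [dq tq].
have hq z : closure (Dplus f) z -> has_trace (Dplus f) q z by case/tq.
have hx z : closure (Dplus f) z -> has_trace (Dplus f) (dx q) z by case/tq.
have hy z : closure (Dplus f) z -> has_trace (Dplus f) (dy q) z by case/tq.
have cx := continuous_strip hx; have cy := continuous_strip hy.
split; [exact: continuous_strip|by []| | |].
- have cd : continuous (fun z : R * R => deriv01 f (clamp z.2)).
    apply: (cont_comp (g := snd) (h := fun y => deriv01 f (clamp y))).
      by move=> ?; exact: cvg_snd.
    exact: continuous_clamp_comp.
  exact: (contD (contM cd cx) cy).
- move=> s y s0 y01.
  have e1 : is_derive s 1 (fun s => f y + s) 1.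
    rewrite -[X in is_derive _ _ _ X]add0r.
    exact: (is_deriveD (is_derive_cst (f y) s 1) (is_derive_id s 1)).
  have := is_derive_curve (dq _ (Dplus_behind s0 y01)) e1 (is_derive_cst y s 1).
  rewrite mul1r mul0r addr0 -(stripE hx)//.
  apply: near_eq_is_derive; near=> s'; rewrite stripE//.
  by near: s'; exact: lt_nbhsr.
- move=> s y s0 y01.
  have y01' : 0 <= y <= 1 by lra.
  have e1 : is_derive y 1 (fun y => f y + s) (deriv01 f y).
    rewrite -[X in is_derive _ _ _ X]addr0.
    exact: (is_deriveD (is_derive_deriv01 df y01) (is_derive_cst s y 1)).
  have := is_derive_curve (a := fun y => f y + s) (b := id)
    (dq _ (Dplus_behind s0 y01)) e1 (is_derive_id y 1).
  rewrite mul1r -(stripE hx)// -(stripE hy)// clamp_id//.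
  apply: near_eq_is_derive.
  have : y \in `]0, 1[ by rewrite in_itv.
  move=> /near_in_itvoo; apply: filterS => y'; rewrite in_itv/= => y'01.
  by rewrite stripE.
Unshelve. all: by end_near. Qed.

End strip.

(** * The Euler system in primitive variables *)

Section directional.
Context {R : realType}.
Implicit Types (g h : R * R -> R) (z w : R * R).

Lemma deriveM_fun g h z w : differentiable g z -> differentiable h z ->
  'D_w (fun x => g x * h x) z = g z * 'D_w h z + h z * 'D_w g z.
Proof. by move=> dg dh; rewrite deriveM//; exact: diff_derivable. Qed.

Lemma deriveD_fun g h z w : differentiable g z -> differentiable h z ->
  'D_w (fun x => g x + h x) z = 'D_w g z + 'D_w h z.
Proof. by move=> dg dh; rewrite deriveD//; exact: diff_derivable. Qed.

Lemma derive_sqr g z w : differentiable g z ->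
  'D_w (fun x => g x ^+ 2) z = 2 * g z * 'D_w g z.
Proof.
move=> dg.
have -> : (fun x => g x ^+ 2) = (fun x => g x * g x) by apply/funext => x; rewrite expr2.
by rewrite deriveM_fun//; ring.
Qed.

Lemma differentiableM_fun g h z : differentiable g z -> differentiable h z ->
  differentiable (fun x => g x * h x) z.
Proof. by move=> dg dh; exact: differentiableM. Qed.

Lemma differentiableD_fun g h z : differentiable g z -> differentiable h z ->
  differentiable (fun x => g x + h x) z.
Proof. by move=> dg dh; exact: differentiableD. Qed.

Lemma differentiable_sqr g z : differentiable g z ->
  differentiable (fun x => g x ^+ 2) z.
Proof.
move=> dg.
have -> : (fun x => g x ^+ 2) = (fun x => g x * g x) by apply/funext => x; rewrite expr2.
exact: differentiableM_fun.
Qed.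

End directional.

Section gas.
Context {R : realType} (gamma p0 u0 r0 : R).
Hypotheses (gamma1 : 1 < gamma) (p0_gt0 : 0 < p0) (u0_gt0 : 0 < u0) (r0_gt0 : 0 < r0).

(** Twice the Bernoulli constant is [u0 ^ 2 + 2 gamma p0 / ((gamma - 1) r0)]; the
    Bernoulli law is stated without division, so that it survives passage to
    the boundary, where the density could a priori vanish. *)
Definition bernoulli_law (p u v r : R) : Prop :=
  2 * gamma * r0 * p =
  r * ((gamma - 1) * r0 * (u0 ^+ 2 - u ^+ 2 - v ^+ 2) + 2 * gamma * p0).

Definition primitive_euler (p u v r px py ux uy vx vy : R) : Prop :=
  [/\ u * px + v * py + gamma * p * (ux + vy) = 0,
      r * (u * ux + v * uy) + px = 0 &
      r * (u * vx + v * vy) + py = 0].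

Lemma sonic_sqr (p r : R) : 0 < p -> 0 < r -> sonic gamma p r ^+ 2 = gamma * p / r.
Proof.
move=> p_gt0 r_gt0; rewrite /sonic sqr_sqrtr// ltW// divr_gt0// mulr_gt0//.
exact: lt_trans gamma1.
Qed.

Lemma euler_bernoulli (U : flow R) z : 0 < prs U z -> 0 < rho U z ->
  euler gamma (bernoulli_const gamma p0 u0 r0) U z ->
  bernoulli_law (prs U z) (vlx U z) (vly U z) (rho U z).
Proof.
move=> p_gt0 r_gt0 [_ _ _]; rewrite sonic_sqr// /bernoulli_const /bernoulli_law.
have g0 : gamma - 1 != 0 by rewrite subr_eq0 gt_eqF.
move=> E.
have r_neq0 := lt0r_neq0 r_gt0; have r0_neq0 := lt0r_neq0 r0_gt0.
have -> : 2 * gamma * r0 * prs U z =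
  2 * (gamma - 1) * r0 * rho U z * (gamma * prs U z / rho U z / (gamma - 1)).
  by field; rewrite g0.
have -> : gamma * prs U z / rho U z / (gamma - 1) =
  2^-1 * u0 ^+ 2 + gamma * p0 / ((gamma - 1) * r0) -
  2^-1 * (vlx U z ^+ 2 + vly U z ^+ 2) by lra.
by field; rewrite r0_neq0.
Qed.

(** Eliminating the density gradient between the conservation laws and the
    differentiated Bernoulli law. *)
Lemma primitive_of_conservation (p u v r px ux vx rx py uy vy ry : R) :
  bernoulli_law p u v r ->
  2 * gamma * r0 * px = r * (- 2 * ((gamma - 1) * r0) * (u * ux + v * vx)) +
    rx * ((gamma - 1) * r0 * u0 ^+ 2 + 2 * gamma * p0 -
          (gamma - 1) * r0 * (u ^+ 2 + v ^+ 2)) ->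
  2 * gamma * r0 * py = r * (- 2 * ((gamma - 1) * r0) * (u * uy + v * vy)) +
    ry * ((gamma - 1) * r0 * u0 ^+ 2 + 2 * gamma * p0 -
          (gamma - 1) * r0 * (u ^+ 2 + v ^+ 2)) ->
  rx * u + r * ux + ry * v + r * vy = 0 ->
  rx * u ^+ 2 + 2 * r * u * ux + px + (ry * u * v + r * uy * v + r * u * vy) = 0 ->
  rx * u * v + r * ux * v + r * u * vx + (ry * v ^+ 2 + 2 * r * v * vy + py) = 0 ->
  primitive_euler p u v r px py ux uy vx vy.
Proof.
rewrite /bernoulli_law => Eb Ebx Eby Em Ex Ey.
have Ex' : r * (u * ux + v * uy) + px = 0.
  transitivity (rx * u ^+ 2 + 2 * r * u * ux + px + (ry * u * v + r * uy * v + r * u * vy)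
    - u * (rx * u + r * ux + ry * v + r * vy)); first by ring.
  by rewrite Ex Em mulr0 subr0.
have Ey' : r * (u * vx + v * vy) + py = 0.
  transitivity (rx * u * v + r * ux * v + r * u * vx + (ry * v ^+ 2 + 2 * r * v * vy + py)
    - v * (rx * u + r * ux + ry * v + r * vy)); first by ring.
  by rewrite Ey Em mulr0 subr0.
split=> //.
have r0_neq0 := lt0r_neq0 r0_gt0.
apply: (mulfI (x := 2 * r0)); first by rewrite mulf_neq0// pnatr_eq0.
rewrite mulr0.
transitivity ((2 * gamma * r0 * px) * u + (2 * gamma * r0 * py) * v
  - 2 * (gamma - 1) * r0 * (u * px + v * py) + (2 * gamma * r0 * p) * (ux + vy)).
  by ring.
rewrite Eb Ebx Eby.
transitivity (((gamma - 1) * r0 * (u0 ^+ 2 - u ^+ 2 - v ^+ 2) + 2 * gamma * p0) *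
  (rx * u + r * ux + ry * v + r * vy) - 2 * (gamma - 1) * r0 *
  (u * (r * (u * ux + v * uy) + px) + v * (r * (u * vx + v * vy) + py))).
  by ring.
by rewrite Em Ex' Ey' !mulr0 addr0 mulr0 subrr.
Qed.

(** The conservation laws and the Bernoulli law combine, along streamlines, into
    a quasilinear system for pressure and velocity alone. *)
Lemma euler_primitive (U : flow R) (Om : set (R * R)) (z : R * R) :
  nbhs z Om -> differentiable (prs U) z -> differentiable (vlx U) z ->
  differentiable (vly U) z -> differentiable (rho U) z ->
  (forall w, Om w -> 0 < prs U w /\ 0 < rho U w) ->
  (forall w, Om w -> euler gamma (bernoulli_const gamma p0 u0 r0) U w) ->
  primitive_euler (prs U z) (vlx U z) (vly U z) (rho U z)
    (dx (prs U) z) (dy (prs U) z) (dx (vlx U) z) (dy (vlx U) z)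
    (dx (vly U) z) (dy (vly U) z).
Proof.
move=> Omz dp du dv dr pos eul.
have Oz := nbhs_singleton Omz.
have [p_gt0 r_gt0] := pos z Oz.
have du2 := differentiable_sqr du; have dv2 := differentiable_sqr dv.
have dru := differentiableM_fun dr du.
have druv := differentiableM_fun dru dv.
have dru2 := differentiableM_fun dr du2; have drv2 := differentiableM_fun dr dv2.
have [Em Ex Ey _] := eul z Oz.
pose c1 : R := (gamma - 1) * r0; pose c2 : R := c1 * u0 ^+ 2 + 2 * gamma * p0.
have bern w : 2 * gamma * r0 * 'D_w (prs U) z =
    rho U z * (- 2 * c1 * (vlx U z * 'D_w (vlx U) z + vly U z * 'D_w (vly U) z)) +
    'D_w (rho U) z * (c2 - c1 * (vlx U z ^+ 2 + vly U z ^+ 2)).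
  have dcst (c : R) : differentiable (fun _ : R * R => c) z by [].
  have Dcst (c : R) : 'D_w (fun _ : R * R => c) z = 0 by exact: derive_cst.
  have dq2 := differentiableD_fun du2 dv2.
  have dcq := differentiableM_fun (dcst (- c1)) dq2.
  have ds := differentiableD_fun (dcst c2) dcq.
  transitivity ('D_w (fun x => 2 * gamma * r0 * prs U x) z).
    by rewrite deriveM_fun// Dcst; ring.
  have -> : 'D_w (fun x => 2 * gamma * r0 * prs U x) z =
     'D_w (fun x => rho U x * (c2 + - c1 * (vlx U x ^+ 2 + vly U x ^+ 2))) z.
    apply: near_eq_derive; apply: filterS Omz => x Ox.
    have [px rx] := pos x Ox.
    have := euler_bernoulli px rx (eul x Ox); rewrite /bernoulli_law => ->.
    by rewrite /c2 /c1; ring.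
  rewrite (deriveM_fun w dr ds) (deriveD_fun w (dcst c2) dcq) Dcst.
  rewrite (deriveM_fun w (dcst (- c1)) dq2) Dcst (deriveD_fun w du2 dv2).
  by rewrite !derive_sqr//; ring.
have bz := euler_bernoulli p_gt0 r_gt0 (eul z Oz).
rewrite /bernoulli_law in bz.
move: Em Ex Ey.
rewrite /dx /dy /mass_x /mass_y /mom_xx /mom_xy /mom_yy.
rewrite !deriveM_fun// !deriveD_fun// !deriveM_fun// ?derive_sqr//.
have := bern (1, 0); have := bern (0, 1); rewrite /c2 /c1.
move: ('D_(1, 0) (prs U) z) ('D_(1, 0) (vlx U) z) ('D_(1, 0) (vly U) z)
  ('D_(1, 0) (rho U) z) ('D_(0, 1) (prs U) z) ('D_(0, 1) (vlx U) z)
  ('D_(0, 1) (vly U) z) ('D_(0, 1) (rho U) z) => px ux vx rx py uy vy ry.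
move=> Ey Ex Em Ex2 Ey2.
apply: (primitive_of_conservation (rx := rx) (ry := ry)) => //.
- by rewrite -Em; ring.
- by rewrite -Ex2; ring.
- by rewrite -Ey2; ring.
Qed.

End gas.

(** * The shock polar *)

Section loop.
Context {R : realType}.

Lemma is_derive_subst (F : R -> R) (x a b : R) :
  is_derive x 1 F a -> a = b -> is_derive x 1 F b.
Proof. by move=> dF <-. Qed.

Lemma is_derive_unique (F : R -> R) (x a b : R) :
  is_derive x 1 F a -> is_derive x 1 F b -> a = b.
Proof. by move=> [_ <-] [_ <-]. Qed.

Lemma derive0_eq (F : R -> R) (a b : R) : a <= b -> continuous F ->
  (forall x : R, a < x < b -> is_derive x 1 F 0) -> F a = F b.
Proof.
move=> ab cF dF; apply/esym/eqP; rewrite -subr_eq0; apply/eqP.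
have dF' (x : R) : x \in `]a, b[ -> is_derive x 1 F 0.
  by rewrite in_itv; exact: dF.
have [c _ E] := @MVT_segment R F (fun=> 0) a b ab dF' (continuous_subspaceT cF).
by rewrite E mul0r.
Qed.

(** A 1-form on a line has no circulation along a closed path. *)
Lemma int01_loop (q w dw sg dsg g : R -> R) (A : R) :
  continuous q -> continuous dw -> (forall x : R, is_derive x 1 w (dw x)) ->
  continuous sg -> (forall y : R, `|sg y| < A) -> sg 0 = sg 1 ->
  (forall y : R, 0 < y < 1 -> is_derive y 1 sg (dsg y)) ->
  continuous g ->
  (forall y : R, 0 < y < 1 -> g y = q (sg y) * (dw (sg y) * dsg y)) ->
  int01 g = 0.
Proof.
move=> cq cdw dwP csg sgA sg01 dsgP cg gE.
have cqdw : continuous (fun x => q x * dw x) by cont.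
have [H dH] := primitive_exists A cqdw.
have sgA' (y : R) : - A < sg y < A by rewrite -ltr_norml.
have cH : continuous (fun y => H (sg y) - H (sg 0)).
  apply: contD; last exact: contC.
  move=> y; apply: (continuous_comp (f := sg)); first exact: csg.
  exact: is_derive_continuous (dH _ (sgA' y)).
have := @int01_by_parts _ (fun=> 1) (fun=> 0) (fun y => H (sg y) - H (sg 0)) g.
have -> : (fun y => 1 * g y) = g by apply/funext => y; rewrite mul1r.
have -> : (fun y => 0 * (H (sg y) - H (sg 0))) = (fun=> 0).
  by apply/funext => y; rewrite mul0r.
rewrite int01_cst oppr0; apply => //; try exact: contC.
- move=> y y01; rewrite -[g y]subr0.
  apply: is_deriveB; rewrite gE// mulrA.
  exact: (is_derive1_comp (f := H) (g := sg) (dH _ (sgA' y)) (dsgP y y01)).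
- by rewrite subrr.
- by rewrite -sg01 subrr.
Qed.

End loop.

Section polar.
Context {R : realType} (gamma p0 u0 r0 : R).
Hypotheses (gamma1 : 1 < gamma) (p0_gt0 : 0 < p0) (u0_gt0 : 0 < u0)
  (r0_gt0 : 0 < r0).

(** Pressure jump across a shock of slope [s] = dx/dy facing the uniform
    stream. *)
Definition polar_jump (s : R) : R :=
  2 / (gamma + 1) * (r0 * u0 ^+ 2 / (1 + s ^+ 2) - gamma * p0).

(** The mass flux through the shock is [r0 * u0], so that the momentum balance
    is affine in the pressure jump; substituted in the Bernoulli law it leaves
    the jump times an affine function of the jump, and the entropy condition
    excludes the zero jump. *)
Lemma shock_polar (p u v r s : R) :
  bernoulli_law gamma p0 u0 r0 p u v r -> p0 < p ->
  r * u - r0 * u0 - s * (r * v) = 0 ->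
  r * u ^+ 2 + p - (r0 * u0 ^+ 2 + p0) - s * (r * u * v) = 0 ->
  r * u * v - s * (r * v ^+ 2 + p - p0) = 0 ->
  [/\ p = p0 + polar_jump s, u = u0 - polar_jump s / (r0 * u0) &
      v = s * polar_jump s / (r0 * u0)].
Proof.
rewrite /bernoulli_law => Eb pp0 Em Ex Ey.
pose m := r0 * u0; have m_gt0 : 0 < m by rewrite mulr_gt0.
have m_neq0 := lt0r_neq0 m_gt0.
pose J := p - p0; have J_gt0 : 0 < J by rewrite subr_gt0.
have k_gt0 : 0 < 1 + s ^+ 2 by rewrite ltr_pwDl ?sqr_ge0.
have pE : p = p0 + J by rewrite /J; ring.
have rE : r * (u - s * v) = m by rewrite /m; lra.
have uE : u = u0 - J / m.
  have : m * u + p = m * u0 + p0.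
    rewrite -{1}rE /m; lra.
  move=> E; have : m * u = m * (u0 - J / m).
    by rewrite mulrBr mulrCA divff// mulr1 /J; lra.
  by move/(mulfI m_neq0).
have vE : v = s * J / m.
  have : m * v = m * (s * J / m).
    have -> : m * (s * J / m) = s * J by field.
    by rewrite -{1}rE /J; lra.
  by move/(mulfI m_neq0).
have : r0 * J * (2 * (r0 * u0 ^+ 2) - (1 + s ^+ 2) * (2 * gamma * p0 + (gamma + 1) * J)) = 0.
  have : 2 * gamma * r0 * p * (m * (u - s * v)) = m ^+ 2 *
    ((gamma - 1) * r0 * (u0 ^+ 2 - u ^+ 2 - v ^+ 2) + 2 * gamma * p0).
    by rewrite Eb -rE; ring.
  rewrite pE uE vE => /eqP; rewrite -subr_eq0 => /eqP <-.
  rewrite /m; field.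
  by rewrite !lt0r_neq0.
move=> /eqP; rewrite mulf_eq0 (negbTE (lt0r_neq0 (mulr_gt0 r0_gt0 J_gt0)))/=.
rewrite subr_eq0 => /eqP E.
have g_gt0 : 0 < gamma + 1 by move: gamma1; lra.
have JE : J = polar_jump s.
  rewrite /polar_jump.
  have -> : r0 * u0 ^+ 2 = (1 + s ^+ 2) * (2 * gamma * p0 + (gamma + 1) * J) / 2.
    by rewrite -E; field.
  by field; rewrite !lt0r_neq0.
by rewrite -JE; split.
Qed.

(** A compressive shock is less steep than the characteristics of the uniform
    stream: the stream is supersonic in the direction normal to the shock. *)
Lemma polar_jump_slope (s : R) : 0 < polar_jump s ->
  gamma * p0 * (1 + s ^+ 2) < r0 * u0 ^+ 2.
Proof.
have k_gt0 : 0 < 1 + s ^+ 2 by rewrite ltr_pwDl ?sqr_ge0.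
rewrite /polar_jump pmulr_rgt0; last by rewrite divr_gt0//; move: gamma1; lra.
by rewrite subr_gt0 ltr_pdivlMr.
Qed.

(** On the polar, for every slope, u and p0 + p stay positive; the polar is
    therefore a smooth curve parametrized by the whole line. *)
Lemma polar_jump_bounds (s : R) :
  0 < r0 * u0 ^+ 2 - polar_jump s /\ 0 < p0 + (p0 + polar_jump s).
Proof.
have k_gt0 : 0 < 1 + s ^+ 2 by rewrite ltr_pwDl ?sqr_ge0.
have g_gt0 : 0 < gamma + 1 by move: gamma1; lra.
have a_gt0 : 0 < r0 * u0 ^+ 2 by rewrite mulr_gt0 ?exprn_gt0.
have b_gt0 : 0 < r0 * u0 ^+ 2 / (1 + s ^+ 2) by rewrite divr_gt0.
have ba : r0 * u0 ^+ 2 / (1 + s ^+ 2) <= r0 * u0 ^+ 2.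
  by rewrite ler_pdivrMr// ler_peMr ?(ltW a_gt0)// lerDl sqr_ge0.
rewrite /polar_jump; set b := _ / (1 + _) in b_gt0 ba *.
have -> : 2 / (gamma + 1) * (b - gamma * p0) =
  (2 * b - 2 * gamma * p0) / (gamma + 1) by field; rewrite lt0r_neq0.
split.
  rewrite subr_gt0 ltr_pdivrMr//.
  have : 0 < gamma * p0 by rewrite mulr_gt0//; move: gamma1; lra.
  have : 0 < (gamma - 1) * (r0 * u0 ^+ 2) by rewrite mulr_gt0// subr_gt0.
  lra.
have -> : p0 + (p0 + (2 * b - 2 * gamma * p0) / (gamma + 1)) =
  2 * (b + p0) / (gamma + 1) by field; rewrite lt0r_neq0.
by rewrite divr_gt0// mulr_gt0// addr_gt0.
Qed.

(** The flow direction v / u on the polar. *)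
Definition polar_w (s : R) : R := s * (polar_jump s * (r0 * u0 ^+ 2 - polar_jump s)^-1).

(** The value - 1 / (p0 + p) on the polar. *)
Definition polar_q (s : R) : R := - (p0 + (p0 + polar_jump s))^-1.

Lemma polar_C1 : exists2 dw : R -> R, continuous dw &
  continuous polar_q /\ forall s : R, is_derive s 1 polar_w (dw s).
Proof.
pose k (s : R) := (1 + s ^+ 2)^-1.
have k_neq0 (s : R) : 1 + s ^+ 2 != 0 by rewrite lt0r_neq0// ltr_pwDl ?sqr_ge0.
have cid : continuous (fun s : R => s) by move=> s; exact: cvg_id.
have ck0 : continuous (fun s : R => 1 + s ^+ 2) by cont.
have ck : continuous k by exact: contV.
have cj : continuous polar_jump by rewrite /polar_jump; cont.
pose a (s : R) := (r0 * u0 ^+ 2 - polar_jump s)^-1.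
have a_neq0 (s : R) : r0 * u0 ^+ 2 - polar_jump s != 0.
  by rewrite lt0r_neq0//; case: (polar_jump_bounds s).
have ca : continuous a by apply: contV => //; cont.
have b_neq0 (s : R) : p0 + (p0 + polar_jump s) != 0.
  by rewrite lt0r_neq0//; case: (polar_jump_bounds s).
have cq : continuous polar_q.
  by apply: contN; apply: contV => //; cont.
pose dj (s : R) := 2 / (gamma + 1) * (r0 * u0 ^+ 2 * (- (2 * s) * k s ^+ 2)).
have cdj : continuous dj by rewrite /dj; cont.
have djP (s : R) : is_derive s 1 polar_jump (dj s).
  have d1 : is_derive s 1 (fun s : R => 1 + s ^+ 2) (2 * s).
    have -> : (fun s : R => 1 + s ^+ 2) = (fun s : R => 1 + s * s).
      by apply/funext => x; rewrite expr2.
    have := is_deriveD (is_derive_cst (1 : R) s 1)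
      (is_deriveM (is_derive_id s 1) (is_derive_id s 1)).
    move=> d0; apply: (is_derive_subst d0).
    by rewrite add0r /GRing.scale/=; ring.
  have d2 := is_deriveV (f := fun s : R => 1 + s ^+ 2) (k_neq0 s) d1.
  have d3 := is_deriveZ (r0 * u0 ^+ 2) d2.
  have d4 := is_deriveB d3 (is_derive_cst (gamma * p0) s 1).
  have d5 := is_deriveZ (2 / (gamma + 1)) d4.
  apply: (is_derive_subst d5).
  rewrite /dj subr0 /k exprVn.
  by rewrite /GRing.scale/=; ring.
pose dw (s : R) := s * (polar_jump s * (a s ^+ 2 * dj s) + a s * dj s) +
  polar_jump s * a s.
exists dw; first by rewrite /dw; cont.
split=> // s.
have d1 := is_deriveB (is_derive_cst (r0 * u0 ^+ 2) s 1) (djP s).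
have d2 := is_deriveV (f := fun s : R => r0 * u0 ^+ 2 - polar_jump s) (a_neq0 s) d1.
have d3 := is_deriveM (is_derive_id s 1) (is_deriveM (djP s) d2).
apply: (is_derive_subst d3).
by rewrite /dw /a exprVn !fctE /GRing.scale/= sub0r; ring.
Qed.

End polar.

(** * Traces on the shock front *)

Section trace_algebra.
Context {R : realType} {Om : set (R * R)} {z : R * R}.
Hypothesis cz : closure Om z.
Implicit Types q h : R * R -> R.

Lemma traceM q h : has_trace Om q z -> has_trace Om h z ->
  has_trace Om (fun w => q w * h w) z /\
  trace Om (fun w => q w * h w) z = trace Om q z * trace Om h z.
Proof.
move=> tq th; have ? := within_closure_proper cz.
have C : (fun w => q w * h w) w @[w --> within Om (nbhs z)] -->
  trace Om q z * trace Om h z by exact: cvgM.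
by split; [apply/cvg_ex; eexists; exact: C|exact: cvg_lim C].
Qed.

Lemma traceD q h : has_trace Om q z -> has_trace Om h z ->
  has_trace Om (fun w => q w + h w) z /\
  trace Om (fun w => q w + h w) z = trace Om q z + trace Om h z.
Proof.
move=> tq th; have ? := within_closure_proper cz.
have C : (fun w => q w + h w) w @[w --> within Om (nbhs z)] -->
  trace Om q z + trace Om h z by exact: cvgD.
by split; [apply/cvg_ex; eexists; exact: C|exact: cvg_lim C].
Qed.

Lemma trace_cst (c : R) :
  has_trace Om (fun=> c) z /\ trace Om (fun=> c) z = c.
Proof.
have ? := within_closure_proper cz.
have C : (fun=> c) w @[w --> within Om (nbhs z)] --> c by exact: cvg_cst.
by split; [apply/cvg_ex; eexists; exact: C|exact: cvg_lim C].
Qed.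

Lemma trace_le (q : R * R -> R) (c : R) : has_trace Om q z ->
  (forall w, Om w -> c <= q w) -> c <= trace Om q z.
Proof.
move=> tq cq; rewrite leNgt; apply/negP => qc.
have e0 : 0 < c - trace Om q z by rewrite subr_gt0.
have [d d0 dP] := trace_box cz tq _ e0.
have [w Ow [w1 w2]] := (closure_box _ _).1 cz d d0.
have := dP w Ow w1 w2; have := cq w Ow; rewrite ltr_norml; lra.
Qed.

Lemma trace_const_on (q : R * R -> R) (c : R) :
  (forall w, Om w -> q w = c) -> trace Om q z = c.
Proof.
move=> qc; apply: trace_eq => // e e0; exists 1 => // w Ow _ _.
by rewrite qc// subrr normr0.
Qed.

Context {U : flow R}.
Hypotheses (tp : has_trace Om (prs U) z) (tu : has_trace Om (vlx U) z)
  (tv : has_trace Om (vly U) z) (tr : has_trace Om (rho U) z).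
Let p := trace Om (prs U) z.
Let u := trace Om (vlx U) z.
Let v := trace Om (vly U) z.
Let r := trace Om (rho U) z.

Lemma trace_fluxes :
  [/\ trace Om (mass_x U) z = r * u, trace Om (mass_y U) z = r * v,
      trace Om (mom_xx U) z = r * u ^+ 2 + p,
      trace Om (mom_xy U) z = r * u * v &
      trace Om (mom_yy U) z = r * v ^+ 2 + p].
Proof.
have [tru eru] := traceM tr tu; have [trv erv] := traceM tr tv.
have [truv eruv] := traceM tru tv.
have [tu2 eu2] := traceM tu tu; have [tv2 ev2] := traceM tv tv.
have [tru2 eru2] := traceM tr tu2; have [trv2 erv2] := traceM tr tv2.
have [txx exx] := traceD tru2 tp; have [tyy eyy] := traceD trv2 tp.
split; rewrite /p /u /v /r //.
- by rewrite expr2 -eu2 -eru2 -exx.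
- by rewrite -eru -eruv.
- by rewrite expr2 -ev2 -erv2 -eyy.
Qed.

Lemma trace_bernoulli (gamma p0 u0 r0 : R) :
  (forall w, Om w -> bernoulli_law gamma p0 u0 r0 (prs U w) (vlx U w) (vly U w) (rho U w)) ->
  bernoulli_law gamma p0 u0 r0 p u v r.
Proof.
move=> H.
have [tu2 eu2] := traceM tu tu; have [tv2 ev2] := traceM tv tv.
have [tq2 eq2] := traceD tu2 tv2.
have [tc ec] := trace_cst (- ((gamma - 1) * r0)).
have [tb eb] := traceM tc tq2.
have [td ed] := trace_cst ((gamma - 1) * r0 * u0 ^+ 2 + 2 * gamma * p0).
have [te ee] := traceD td tb.
have [tf ef] := traceM tr te.
have [tg eg] := trace_cst (- (2 * gamma * r0)).
have [tk ek] := traceM tg tp.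
have [tl el] := traceD tf tk.
have : trace Om (fun w => rho U w * ((gamma - 1) * r0 * u0 ^+ 2 + 2 * gamma * p0 +
  - ((gamma - 1) * r0) * (vlx U w * vlx U w + vly U w * vly U w)) +
  - (2 * gamma * r0) * prs U w) z = 0.
  apply: trace_const_on => w /H; rewrite /bernoulli_law => E.
  by rewrite [- _ * prs U w]mulNr E; ring.
rewrite el ek eg ef ee ed eb ec eq2 ev2 eu2 /bernoulli_law -/p -/u -/v -/r => E.
by apply/eqP; rewrite -subr_eq0; apply/eqP; rewrite -[RHS]oppr0 -E; ring.
Qed.

End trace_algebra.

Section front.
Context {R : realType} {gamma p0 u0 r0 : R} {f : R -> R} {U : flow R}.
Hypotheses (gamma1 : 1 < gamma) (u0_gt0 : 0 < u0)
  (r0_gt0 : 0 < r0) (hU : transonic_shock gamma p0 u0 r0 f U).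

Let df : derivable01 f. Proof. by case: (shock_C2 hU). Qed.

Lemma front_continuous (y : R) : 0 <= y <= 1 -> forall e, 0 < e ->
  exists2 d, 0 < d & forall s, 0 <= s <= 1 -> `|s - y| < d -> `|f s - f y| < e.
Proof. exact: derivable01_continuous. Qed.

Lemma closure_Dminus_front (y : R) : 0 <= y <= 1 -> closure (Dminus f) (f y, y).
Proof.
move=> y01; apply/closure_box => d d0.
have d20 : 0 < d / 2 by rewrite divr_gt0.
have [h h0 hP] := front_continuous y01 d20.
have [|x x01] := @near_interior _ y (Num.min d h) y01; first by rewrite lt_min d0.
rewrite lt_min => /andP[xd xh].
have x01' : 0 <= x <= 1 by lra.
have := hP x x01' xh => fx.
have fx1 := shock_gt hU x01.
pose a := Num.max (f x - d / 2) ((f x - 1) / 2).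
have a1 : -1 < a by rewrite /a lt_max; apply/orP; right; lra.
have a2 : a < f x by rewrite /a gt_max; apply/andP; split; lra.
have a3 : f x - d / 2 <= a by rewrite /a le_max lexx.
exists (a, x); first by split; [split|].
split=> //=; move: fx; rewrite !ltr_norml; lra.
Qed.

Lemma closure_Dplus_front (y : R) : 0 <= y <= 1 -> closure (Dplus f) (f y, y).
Proof.
move=> y01; have := closure_behind (shock_C2 hU) (shock_gt hU) (z := (0, y)).
by rewrite behindE// addr0.
Qed.

Let C1p := flow_C1_plus hU.
Let C1m := flow_C1_minus hU.

Lemma plus_traces z : closure (Dplus f) z ->
  [/\ has_trace (Dplus f) (prs U) z, has_trace (Dplus f) (vlx U) z,
      has_trace (Dplus f) (vly U) z & has_trace (Dplus f) (rho U) z].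
Proof.
by case: C1p => -[_ a] [_ b] [_ c] [_ d] cz; split;
  [case: (a z cz)|case: (b z cz)|case: (c z cz)|case: (d z cz)].
Qed.

Lemma minus_traces z : closure (Dminus f) z ->
  [/\ has_trace (Dminus f) (prs U) z, has_trace (Dminus f) (vlx U) z,
      has_trace (Dminus f) (vly U) z & has_trace (Dminus f) (rho U) z].
Proof.
by case: C1m => -[_ a] [_ b] [_ c] [_ d] cz; split;
  [case: (a z cz)|case: (b z cz)|case: (c z cz)|case: (d z cz)].
Qed.

(** Both velocity traces are horizontal at the walls, so that the third jump
    condition leaves only the pressure jump, and the shock is normal there. *)
Lemma front_normal_at_walls (y : R) : y = 0 \/ y = 1 -> deriv01 f y = 0.
Proof.
move=> yw; have y01 : 0 <= y <= 1 by case: yw => ->; rewrite lexx ler01.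
have cm := closure_Dminus_front y01; have cp := closure_Dplus_front y01.
have [_ _] := shock_RH hU y01.
have [tp tu tv tr] := plus_traces cp; have [sp su sv sr] := minus_traces cm.
have [_ _ _ exy eyy] := trace_fluxes cp tp tu tv tr.
have [_ _ _ fxy fyy] := trace_fluxes cm sp su sv sr.
have := shock_entropy hU y01.
rewrite /jump exy eyy fxy fyy (flow_wall_plus hU)// (flow_wall_minus hU)//.
set a := trace _ _ _; set b := trace (Dminus f) (prs U) _ => ab.
rewrite expr0n/= => E.
have /eqP : deriv01 f y * (a - b) = 0 by lra.
by rewrite mulf_eq0 (gt_eqF ab) orbF => /eqP.
Qed.

Lemma bernoulli_plus z : Dplus f z ->
  bernoulli_law gamma p0 u0 r0 (prs U z) (vlx U z) (vly U z) (rho U z).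
Proof.
move=> Dz; have Dz' : (Dminus f `|` Dplus f) z by right.
have [p_gt0 r_gt0] := flow_pos hU Dz'.
exact: (euler_bernoulli gamma1 r0_gt0 p_gt0 r_gt0 (flow_euler hU Dz')).
Qed.

Lemma bernoulli_minus z : Dminus f z ->
  bernoulli_law gamma p0 u0 r0 (prs U z) (vlx U z) (vly U z) (rho U z).
Proof.
move=> Dz; have Dz' : (Dminus f `|` Dplus f) z by left.
have [p_gt0 r_gt0] := flow_pos hU Dz'.
exact: (euler_bernoulli gamma1 r0_gt0 p_gt0 r_gt0 (flow_euler hU Dz')).
Qed.

(** The jump conditions, the Bernoulli law behind the front and the entropy
    condition are the hypotheses of the shock polar. *)
Lemma state_behind (y : R) : 0 <= y <= 1 ->
  trace (Dminus f) (prs U) (f y, y) = p0 ->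
  trace (Dminus f) (vlx U) (f y, y) = u0 ->
  trace (Dminus f) (vly U) (f y, y) = 0 ->
  trace (Dminus f) (rho U) (f y, y) = r0 ->
  let J := polar_jump gamma p0 u0 r0 (deriv01 f y) in
  [/\ 0 < J, trace (Dplus f) (prs U) (f y, y) = p0 + J,
      trace (Dplus f) (vlx U) (f y, y) = u0 - J / (r0 * u0) &
      trace (Dplus f) (vly U) (f y, y) = deriv01 f y * J / (r0 * u0)].
Proof.
move=> y01 ep eu ev er J.
have cm := closure_Dminus_front y01; have cp := closure_Dplus_front y01.
have [tp tu tv tr] := plus_traces cp; have [sp su sv sr] := minus_traces cm.
have B := trace_bernoulli cp tp tu tv tr bernoulli_plus.
have [a1 a2 a3 a4 a5] := trace_fluxes cp tp tu tv tr.
have [b1 b2 b3 b4 b5] := trace_fluxes cm sp su sv sr.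
have := shock_entropy hU y01; rewrite /jump ep subr_gt0 => pJ.
have [] := shock_RH hU y01.
rewrite /jump a1 a2 a3 a4 a5 b1 b2 b3 b4 b5 ep eu ev er.
rewrite !mulr0 expr0n/= !mulr0 !subr0 add0r => E1 E2 E3.
have [] := shock_polar gamma1 u0_gt0 r0_gt0 B pJ E1 E2 E3.
rewrite -/J => eP eU eV; split => //.
by move: pJ; rewrite eP ltrDl.
Qed.

End front.

(** * The subsonic region *)

Section jacobian.
Context {R : realType} (gamma : R).
Hypothesis gamma1 : 1 < gamma.

(** The left-hand sides are [r * u ^ 2] times the derivatives of the flow
    direction [v / u]: the Euler system expresses these through the pressure
    gradient. *)
Lemma jacobian_direction (p u v r px py ux uy vx vy : R) :
  primitive_euler gamma p u v r px py ux uy vx vy -> 0 < p -> 0 < u -> 0 < r ->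
  r * (u * vx - v * ux) = - py + r / (gamma * p) * v * (u * px + v * py) /\
  r * (u * vy - v * uy) = px - r / (gamma * p) * u * (u * px + v * py).
Proof.
move=> [E1 E2 E3] p_gt0 u_gt0 r_gt0.
have g_neq0 : gamma != 0 by rewrite lt0r_neq0//; exact: lt_trans gamma1.
have p_neq0 := lt0r_neq0 p_gt0.
have gp_neq0 : gamma * p != 0 by rewrite mulf_neq0.
have E1' : ux + vy = - (u * px + v * py) / (gamma * p).
  apply: (mulfI gp_neq0); rewrite mulrCA divff// mulr1.
  by apply/eqP; rewrite -addr_eq0 addrC; apply/eqP.
split.
  have -> : r * (u * vx - v * ux) = r * (u * vx + v * vy) - r * v * (ux + vy) by ring.
  by rewrite E1'; move: E3 => /eqP; rewrite addr_eq0 => /eqP ->; field; rewrite ?g_neq0 ?p_neq0.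
have -> : r * (u * vy - v * uy) = r * u * (ux + vy) - r * (u * ux + v * uy) by ring.
by rewrite E1'; move: E2 => /eqP; rewrite addr_eq0 => /eqP ->; field; rewrite ?g_neq0 ?p_neq0.
Qed.

(** Multiplied by [r * u ^ 2], the Jacobian of pressure and flow direction is the
    square of the pressure gradient minus the square of its scalar product with
    the velocity divided by the sonic speed; by Cauchy-Schwarz the loss is at
    most the fraction [m2], a bound for the square of the Mach number. *)
Lemma jacobian_ge (p u v r px py ux uy vx vy m2 : R) :
  primitive_euler gamma p u v r px py ux uy vx vy -> 0 < p -> 0 < u -> 0 < r ->
  r * (u ^+ 2 + v ^+ 2) <= m2 * (gamma * p) ->
  (1 - m2) * (px ^+ 2 + py ^+ 2) <=
  r * (px * (u * vy - v * uy) - py * (u * vx - v * ux)).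
Proof.
move=> E p_gt0 u_gt0 r_gt0 hm.
have g_gt0 : 0 < gamma by exact: lt_trans gamma1.
have gp_gt0 : 0 < gamma * p by rewrite mulr_gt0.
have [Ex Ey] := jacobian_direction E p_gt0 u_gt0 r_gt0.
have -> : r * (px * (u * vy - v * uy) - py * (u * vx - v * ux)) =
  px * (r * (u * vy - v * uy)) - py * (r * (u * vx - v * ux)) by ring.
rewrite Ex Ey.
have -> : px * (px - r / (gamma * p) * u * (u * px + v * py)) -
  py * (- py + r / (gamma * p) * v * (u * px + v * py)) =
  px ^+ 2 + py ^+ 2 - r * (u * px + v * py) ^+ 2 / (gamma * p).
  by field; rewrite !lt0r_neq0.
rewrite mulrBl mul1r lerB// ler_pdivrMr//.
apply: (@le_trans _ _ (r * ((u ^+ 2 + v ^+ 2) * (px ^+ 2 + py ^+ 2)))).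
  by rewrite ler_pM2l//; have := sqr_ge0 (u * py - v * px); nra.
rewrite mulrA [leRHS]mulrAC ler_wpM2r// addr_ge0 ?sqr_ge0//.
Qed.

End jacobian.

Section post_shock.
Context {R : realType} (gamma p0 u0 r0 : R).
Hypotheses (gamma1 : 1 < gamma) (p0_gt0 : 0 < p0) (u0_gt0 : 0 < u0)
  (r0_gt0 : 0 < r0).

Lemma post_state (p u r : R) :
  let J := polar_jump gamma p0 u0 r0 0 in 0 < J ->
  p = p0 + J -> u = u0 - J / (r0 * u0) -> bernoulli_law gamma p0 u0 r0 p u 0 r ->
  [/\ p = post_p gamma p0 u0 r0, u = post_u gamma p0 u0 r0 &
      r = post_rho gamma p0 u0 r0].
Proof.
move=> J J_gt0 pE uE; rewrite /bernoulli_law => B.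
have g_gt0 : 0 < gamma by exact: lt_trans gamma1.
have g1_gt0 : 0 < gamma + 1 by rewrite addr_gt0.
have gm_gt0 : 0 < gamma - 1 by rewrite subr_gt0.
have JE : J = 2 / (gamma + 1) * (r0 * u0 ^+ 2 - gamma * p0).
  by rewrite /J /polar_jump expr0n addr0 divr1.
have ppE : post_p gamma p0 u0 r0 = p0 + J.
  rewrite /post_p expr_div_n sonic_sqr// JE.
  by field; rewrite !lt0r_neq0.
have puE : post_u gamma p0 u0 r0 = u0 - J / (r0 * u0).
  by rewrite /post_u ppE addrAC subrr add0r.
split; [by rewrite ppE|by rewrite puE|].
rewrite /post_rho ppE.
have KE : r0 * u0 ^+ 2 = (gamma + 1) * J / 2 + gamma * p0.
  by rewrite JE; field; rewrite lt0r_neq0.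
have K_gt0 : 0 < r0 * u0 ^+ 2 by rewrite mulr_gt0 ?exprn_gt0.
have X_gt0 : 0 < (gamma - 1) * (p0 + J) + (gamma + 1) * p0.
  by apply: addr_gt0; apply: mulr_gt0 => //; apply: addr_gt0.
have p_gt0 : 0 < p0 + J by rewrite addr_gt0.
have XE : ((gamma - 1) * r0 * (u0 ^+ 2 - u ^+ 2 - 0 ^+ 2) + 2 * gamma * p0) *
  (r0 * u0 ^+ 2) = gamma * (p0 + J) * ((gamma - 1) * (p0 + J) + (gamma + 1) * p0).
  have -> : ((gamma - 1) * r0 * (u0 ^+ 2 - u ^+ 2 - 0 ^+ 2) + 2 * gamma * p0) *
    (r0 * u0 ^+ 2) = (gamma - 1) * (2 * J * (r0 * u0 ^+ 2) - J ^+ 2) +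
     2 * gamma * p0 * (r0 * u0 ^+ 2).
    by rewrite uE; field; rewrite !lt0r_neq0.
  by rewrite KE; field.
have gX : gamma * (p0 + J) * ((gamma - 1) * (p0 + J) + (gamma + 1) * p0) != 0.
  by rewrite lt0r_neq0// !mulr_gt0.
apply: (mulIf gX).
have -> : r * (gamma * (p0 + J) * ((gamma - 1) * (p0 + J) + (gamma + 1) * p0)) =
  2 * gamma * r0 * p * (r0 * u0 ^+ 2) by rewrite -XE mulrA -B.
rewrite pE.
have -> : (gamma + 1) * (p0 + J) + (gamma - 1) * p0 = 2 * (r0 * u0 ^+ 2).
  by rewrite KE; field.
by field; rewrite lt0r_neq0.
Qed.

End post_shock.

(** The comparison behind the choice of - 1 / (p0 + p): its derivative
    [a ^ 2] compensates the growth of [r * u2], which is at most that of the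
    pressure by the bound on the Mach number. *)
Lemma slope_control {R : realType} (g p0 p r u2 A m N Jn S a : R) :
  0 < g -> 0 < p0 -> 0 < p -> 0 < r -> 0 < u2 -> 0 < m -> 0 <= A -> 0 <= N ->
  a = (p0 + p)^-1 -> r * u2 <= g * p -> S <= A * N -> m * N <= Jn ->
  (a ^+ 2) ^+ 2 * S <= g * A / (p0 * m) * (a ^+ 2 * (Jn / (r * u2))).
Proof.
move=> g0 p00 p_gt0 r0 u20 m0 A0 N0 aE ru SN mN.
have a0 : 0 < a by rewrite aE invr_gt0 addr_gt0.
have ap : a * (p0 + p) = 1 by rewrite aE mulVf// lt0r_neq0// addr_gt0.
have X0 : 0 < p0 * m * (r * u2) by rewrite !mulr_gt0.
have -> : g * A / (p0 * m) * (a ^+ 2 * (Jn / (r * u2))) =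
  a ^+ 2 * (g * A * Jn / (p0 * m * (r * u2))) by field; rewrite !lt0r_neq0.
rewrite [_ ^+ 2 ^+ 2]expr2 -mulrA ler_pM2l ?exprn_gt0// ler_pdivlMr//.
have H1 : a ^+ 2 * (r * u2 * p0) <= g.
  apply: (@le_trans _ _ (a ^+ 2 * (g * (p0 + p) ^+ 2))).
    rewrite ler_pM2l ?exprn_gt0//; apply: (@le_trans _ _ (g * p * p0)).
      by rewrite ler_pM2r.
    by rewrite -mulrA ler_pM2l//; nra.
  have -> : a ^+ 2 * (g * (p0 + p) ^+ 2) = g * (a * (p0 + p)) ^+ 2 by ring.
  by rewrite ap expr1n mulr1.
have H2 : m * S <= A * Jn.
  apply: (@le_trans _ _ (A * (m * N))); last by rewrite ler_wpM2l.
  by rewrite mulrCA ler_pM2l.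
have Jn0 : 0 <= Jn by apply: le_trans mN; rewrite mulr_ge0// ltW.
have -> : a ^+ 2 * S * (p0 * m * (r * u2)) = a ^+ 2 * (r * u2 * p0) * (m * S) by ring.
apply: (@le_trans _ _ (a ^+ 2 * (r * u2 * p0) * (A * Jn))).
  by rewrite ler_wpM2l// !mulr_ge0// ltW// exprn_gt0.
by rewrite -[g * A * Jn]mulrA ler_wpM2r// mulr_ge0.
Qed.

Section openness.
Context {R : realType} {f : R -> R}.
Hypothesis df : derivable01 f.

Lemma nbhs_Dplus z : Dplus f z -> nbhs z (Dplus f).
Proof.
case: z => a b [[/= a1 b01] fa].
have b01' : 0 <= b <= 1 by lra.
have e0 : 0 < (a - f b) / 2 by rewrite divr_gt0// subr_gt0.
have [d d0 dP] := derivable01_continuous df b01' e0.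
apply/nbhs_box; exists (Num.min (Num.min d (Num.min b (1 - b)))
  (Num.min (a + 1) ((a - f b) / 2))).
  by rewrite !lt_min d0 e0 /= andbT; apply/andP; split; [apply/andP; split|]; lra.
move=> [x y]; rewrite !lt_min /= => /and3P[_ x1 x2] /and3P[/and3P[yd y1 y2] _ _].
have y01 : 0 < y < 1 by move: y1 y2; rewrite !ltr_norml; lra.
have y01' : 0 <= y <= 1 by lra.
have := dP y y01' yd; move: x1 x2; rewrite !ltr_norml => x1 x2 fy.
by split; [split|]; rewrite /=; lra.
Qed.

Lemma nbhs_Dminus z : Dminus f z -> nbhs z (Dminus f).
Proof.
case: z => a b [[/= a1 b01] fa].
have b01' : 0 <= b <= 1 by lra.
have e0 : 0 < (f b - a) / 2 by rewrite divr_gt0// subr_gt0.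
have [d d0 dP] := derivable01_continuous df b01' e0.
apply/nbhs_box; exists (Num.min (Num.min d (Num.min b (1 - b)))
  (Num.min (a + 1) ((f b - a) / 2))).
  by rewrite !lt_min d0 e0 /= andbT; apply/andP; split; [apply/andP; split|]; lra.
move=> [x y]; rewrite !lt_min /= => /and3P[_ x1 x2] /and3P[/and3P[yd y1 y2] _ _].
have y01 : 0 < y < 1 by move: y1 y2; rewrite !ltr_norml; lra.
have y01' : 0 <= y <= 1 by lra.
have := dP y y01' yd; move: x1 x2; rewrite !ltr_norml => x1 x2 fy.
by split; [split|]; rewrite /=; lra.
Qed.

End openness.

Section subsonic.
Context {R : realType} {gamma p0 u0 r0 ustar Mstar : R} {f : R -> R} {U : flow R}.
Hypotheses (gamma1 : 1 < gamma) (p0_gt0 : 0 < p0) (u0_gt0 : 0 < u0)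
  (r0_gt0 : 0 < r0) (ustar_gt0 : 0 < ustar) (Mstar1 : Mstar < 1)
  (hU : transonic_shock gamma p0 u0 r0 f U)
  (hu : forall z, Dplus f z -> ustar < vlx U z)
  (hM : forall z, Dplus f z -> mach gamma U z < Mstar).

Let df : derivable01 f. Proof. by case: (shock_C2 hU). Qed.
Let fC2 := shock_C2 hU.
Let fgt := shock_gt hU.

Lemma subsonic_mach z : Dplus f z ->
  [/\ 0 < 1 - Mstar ^+ 2, 0 < prs U z, 0 < rho U z, 0 < vlx U z &
  rho U z * (vlx U z ^+ 2 + vly U z ^+ 2) <= Mstar ^+ 2 * (gamma * prs U z)].
Proof.
move=> Dz; have Dz' : (Dminus f `|` Dplus f) z by right.
have [p_gt0 r_gt0] := flow_pos hU Dz'.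
have g_gt0 : 0 < gamma by exact: lt_trans gamma1.
have m0 : 0 <= mach gamma U z by rewrite divr_ge0// sqrtr_ge0.
have mM := hM Dz.
have M0 : 0 < Mstar by exact: le_lt_trans mM.
split => //; first by rewrite subr_gt0 expr_lt1// ltW.
  exact: lt_trans (hu Dz).
have : mach gamma U z ^+ 2 <= Mstar ^+ 2 by rewrite ler_sqr ?nnegrE ?(ltW M0)// ltW.
have q0 : 0 <= vlx U z ^+ 2 + vly U z ^+ 2 by rewrite addr_ge0// sqr_ge0.
rewrite /mach expr_div_n sqr_sqrtr// sonic_sqr//.
have c_gt0 : 0 < gamma * prs U z / rho U z by rewrite divr_gt0// mulr_gt0.
rewrite (ler_pdivrMr _ _ c_gt0) -(ler_pM2l r_gt0).
have -> // : rho U z * (Mstar ^+ 2 * (gamma * prs U z / rho U z)) =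
  Mstar ^+ 2 * (gamma * prs U z) by field; rewrite lt0r_neq0.
Qed.

Lemma euler_plus z : Dplus f z ->
  primitive_euler gamma (prs U z) (vlx U z) (vly U z) (rho U z)
    (dx (prs U) z) (dy (prs U) z) (dx (vlx U) z) (dy (vlx U) z)
    (dx (vly U) z) (dy (vly U) z).
Proof.
move=> Dz; have [[dp _] [du _] [dv _] [dr _]] := flow_C1_plus hU.
apply: (euler_primitive gamma1 r0_gt0 (nbhs_Dplus df Dz)); try by auto.
- by move=> w Dw; apply: (flow_pos hU); right.
- by move=> w Dw; apply: (flow_euler hU); right.
Qed.

Lemma velocity_bound z : Dplus f z ->
  vly U z ^+ 2 <= u0 ^+ 2 + 2 * gamma * p0 / ((gamma - 1) * r0).
Proof.
move=> Dz; have [_ p_gt0 r_gt0 _ _] := subsonic_mach Dz.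
have := bernoulli_plus gamma1 r0_gt0 hU Dz; rewrite /bernoulli_law => E.
have g_gt0 : 0 < gamma by exact: lt_trans gamma1.
have c_gt0 : 0 < (gamma - 1) * r0 by rewrite mulr_gt0// subr_gt0.
have : 0 < rho U z * ((gamma - 1) * r0 * (u0 ^+ 2 - vlx U z ^+ 2 - vly U z ^+ 2) +
  2 * gamma * p0) by rewrite -E !mulr_gt0.
rewrite pmulr_rgt0// => H.
rewrite -(ler_pM2l c_gt0).
have -> : (gamma - 1) * r0 * (u0 ^+ 2 + 2 * gamma * p0 / ((gamma - 1) * r0)) =
  (gamma - 1) * r0 * u0 ^+ 2 + 2 * gamma * p0.
  by field; rewrite lt0r_neq0// subr_eq0 gt_eqF.
have : 0 <= (gamma - 1) * r0 * vlx U z ^+ 2 by rewrite mulr_ge0 ?sqr_ge0// ltW.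
by move: H; lra.
Qed.

Hypothesis hminus : forall z, Dminus f z -> flow_is U z p0 u0 0 r0.

Let J (y : R) := polar_jump gamma p0 u0 r0 (deriv01 f y).

Lemma strip_boundary (y : R) : 0 <= y <= 1 ->
  [/\ 0 < J y, strip f (prs U) (0, y) = p0 + J y,
      strip f (vlx U) (0, y) = u0 - J y / (r0 * u0) &
      strip f (vly U) (0, y) = deriv01 f y * J y / (r0 * u0)].
Proof.
move=> y01; have cm := closure_Dminus_front hU y01.
rewrite /strip behindE// addr0.
have [e1 e2 e3 e4] : [/\ trace (Dminus f) (prs U) (f y, y) = p0,
    trace (Dminus f) (vlx U) (f y, y) = u0,
    trace (Dminus f) (vly U) (f y, y) = 0 &
    trace (Dminus f) (rho U) (f y, y) = r0].
  by split; apply: trace_const_on => // w /hminus[].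
exact: (state_behind gamma1 u0_gt0 r0_gt0 hU y01 e1 e2 e3 e4).
Qed.

Let P := strip f (prs U).
Let Px := strip f (dx (prs U)).
Let Py z := deriv01 f (clamp z.2) * Px z + strip f (dy (prs U)) z.
Let V := strip f (vlx U).
Let Vx := strip f (dx (vlx U)).
Let Vy z := deriv01 f (clamp z.2) * Vx z + strip f (dy (vlx U)) z.
Let T := strip f (vly U).
Let Tx := strip f (dx (vly U)).
Let Ty z := deriv01 f (clamp z.2) * Tx z + strip f (dy (vly U)) z.

Let leafP : leaf_C1 P Px Py.
Proof. by apply: leaf_C1_strip => //; case: (flow_C1_plus hU). Qed.
Let leafV : leaf_C1 V Vx Vy.
Proof. by apply: leaf_C1_strip => //; case: (flow_C1_plus hU). Qed.
Let leafT : leaf_C1 T Tx Ty.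
Proof. by apply: leaf_C1_strip => //; case: (flow_C1_plus hU). Qed.

Lemma strip_V_ge z : ustar <= V z.
Proof.
have cz := closure_behind fC2 fgt (z := z).
have [_ tu _ _] := plus_traces hU cz.
by apply: trace_le => // w Dw; exact/ltW/hu.
Qed.

Lemma strip_P_ge0 z : 0 <= P z.
Proof.
have cz := closure_behind fC2 fgt (z := z).
have [tp _ _ _] := plus_traces hU cz.
apply: trace_le => // w Dw; have Dw' : (Dminus f `|` Dplus f) w by right.
by have [/ltW] := flow_pos hU Dw'.
Qed.

(** A bounded, strictly increasing function of the pressure, chosen so that the
    gradient of [Q] is controlled by the Jacobian without any lower or upper
    bound on the density far downstream. *)
Let Q z := - (p0 + P z)^-1.
Let Qx z := (p0 + P z)^-1 ^+ 2 * Px z.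
Let Qy z := (p0 + P z)^-1 ^+ 2 * Py z.
Let W z := T z * (V z)^-1.
Let Wx z := T z * (- (V z)^-1 ^+ 2 * Vx z) + (V z)^-1 * Tx z.
Let Wy z := T z * (- (V z)^-1 ^+ 2 * Vy z) + (V z)^-1 * Ty z.

Let pP_neq0 z : p0 + P z != 0.
Proof. by rewrite lt0r_neq0// ltr_pwDl// strip_P_ge0. Qed.

Let V_neq0 z : V z != 0.
Proof. by rewrite lt0r_neq0// (lt_le_trans ustar_gt0)// strip_V_ge. Qed.

Let leafQ : leaf_C1 Q Qx Qy.
Proof.
have [cq cqs cqy dqs dqy] := leaf_C1V pP_neq0 (leaf_C1_addl p0 leafP).
split; first exact: contN.
- have -> : Qx = (fun z => - (- (p0 + P z)^-1 ^+ 2 * Px z)).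
    by apply/funext => z; rewrite /Qx mulNr opprK.
  exact: contN.
- have -> : Qy = (fun z => - (- (p0 + P z)^-1 ^+ 2 * Py z)).
    by apply/funext => z; rewrite /Qy mulNr opprK.
  exact: contN.
- move=> s y s0 y01; apply: (is_derive_subst (is_deriveN (dqs s y s0 y01))).
  by rewrite /Qx mulNr opprK.
- move=> s y s0 y01; apply: (is_derive_subst (is_deriveN (dqy s y s0 y01))).
  by rewrite /Qy mulNr opprK.
Qed.

Let leafW : leaf_C1 W Wx Wy.
Proof. exact: (leaf_C1M leafT (leaf_C1V V_neq0 leafV)). Qed.

Lemma interior_values (s y : R) : 0 < s -> 0 < y < 1 ->
  let z := (f y + s, y) in
  [/\ P (s, y) = prs U z, V (s, y) = vlx U z & T (s, y) = vly U z] /\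
  [/\ Px (s, y) = dx (prs U) z, Vx (s, y) = dx (vlx U) z & Tx (s, y) = dx (vly U) z] /\
  [/\ Py (s, y) = deriv01 f y * dx (prs U) z + dy (prs U) z,
      Vy (s, y) = deriv01 f y * dx (vlx U) z + dy (vlx U) z &
      Ty (s, y) = deriv01 f y * dx (vly U) z + dy (vly U) z].
Proof.
move=> s0 y01 z; have y01' : 0 <= y <= 1 by lra.
have [[_ tp] [_ tu] [_ tv] _] := flow_C1_plus hU.
rewrite /Py /Vy /Ty /P /V /T /Px /Vx /Tx /= clamp_id//.
by rewrite !stripE//; move=> w cw; case: (tp w cw); case: (tu w cw); case: (tv w cw).
Qed.

Let A := r0 * u0 ^+ 2 / (gamma * p0).

Lemma slope_lt (y : R) : 0 <= y <= 1 -> 1 + deriv01 f y ^+ 2 < A.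
Proof.
move=> y01; have [J0 _ _ _] := strip_boundary y01.
have g_gt0 : 0 < gamma by exact: lt_trans gamma1.
rewrite /A ltr_pdivlMr ?mulr_gt0// mulrC.
exact: (polar_jump_slope gamma1 J0).
Qed.

Lemma interior_jacobian (s y : R) : 0 < s -> 0 < y < 1 ->
  let z := (f y + s, y) in
  let K := Qx (s, y) * Wy (s, y) - Qy (s, y) * Wx (s, y) in
  [/\ 0 <= K, Qy (s, y) ^+ 2 <= gamma * A / (p0 * (1 - Mstar ^+ 2)) * K &
      K = 0 -> dx (prs U) z = 0 /\ dy (prs U) z = 0].
Proof.
move=> s0 y01 z; have y01' : 0 <= y <= 1 by lra.
have Dz : Dplus f z by exact: Dplus_behind.
have [m_gt0 p_gt0 r_gt0 u_gt0 hm] := subsonic_mach Dz.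
have [[eP eV eT] [[ePx eVx eTx] [ePy eVy eTy]]] := interior_values s0 y01.
have E := euler_plus Dz.
have Kge := jacobian_ge gamma1 E p_gt0 u_gt0 r_gt0 hm.
have g_gt0 : 0 < gamma by exact: lt_trans gamma1.
rewrite /Qx /Qy /Wx /Wy eP eV eT ePx eVx eTx ePy eVy eTy -/z.
have sA := slope_lt y01'.
have ru : rho U z * vlx U z ^+ 2 <= gamma * prs U z.
  apply: (@le_trans _ _ (rho U z * (vlx U z ^+ 2 + vly U z ^+ 2))).
    by rewrite ler_pM2l// lerDl sqr_ge0.
  by apply: (le_trans hm); rewrite ger_pMl ?mulr_gt0//; move: m_gt0; rewrite subr_gt0 => /ltW.
move: (prs U z) (vlx U z) (vly U z) (rho U z) (dx (prs U) z) (dy (prs U) z)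
  (dx (vlx U) z) (dy (vlx U) z) (dx (vly U) z) (dy (vly U) z) (deriv01 f y)
  E Kge p_gt0 r_gt0 u_gt0 ru sA {hm}
  => p u v r px py ux uy vx vy sg E Kge p_gt0 r_gt0 u_gt0 ru sA.
set K := (p0 + p)^-1 ^+ 2 * px * _ - _.
set Jn := r * _ in Kge.
have u2_gt0 : 0 < u ^+ 2 by rewrite exprn_gt0.
have pp_gt0 : 0 < p0 + p by rewrite addr_gt0.
have KE : K = (p0 + p)^-1 ^+ 2 * (Jn / (r * u ^+ 2)).
  by rewrite /K /Jn; field; rewrite !lt0r_neq0.
have N0 : 0 <= px ^+ 2 + py ^+ 2 by rewrite addr_ge0 ?sqr_ge0.
have Jn0 : 0 <= Jn by apply: le_trans Kge; rewrite mulr_ge0// ltW.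
have A0 : 0 <= A by rewrite ltW// (lt_trans _ sA)// ltr_pwDl ?sqr_ge0.
have ru0 : 0 < r * u ^+ 2 by rewrite mulr_gt0.
split.
- by rewrite KE mulr_ge0 ?sqr_ge0// divr_ge0// ltW.
- rewrite KE exprMn; apply: (slope_control (N := px ^+ 2 + py ^+ 2) (p := p)) => //.
  apply: (@le_trans _ _ ((1 + sg ^+ 2) * (px ^+ 2 + py ^+ 2))).
    by have := sqr_ge0 (px - sg * py); nra.
  by rewrite ler_wpM2r// ltW.
- rewrite KE => /eqP; rewrite mulf_eq0 (gt_eqF (exprn_gt0 _ _)) ?invr_gt0//=.
  rewrite mulf_eq0 invr_eq0 (gt_eqF ru0) orbF => /eqP J0.
  have /eqP : px ^+ 2 + py ^+ 2 = 0.
    apply/eqP; rewrite eq_le N0 andbT -(ler_pM2l m_gt0) mulr0.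
    by rewrite J0 in Kge.
  by rewrite paddr_eq0 ?sqr_ge0// !sqrf_eq0 => /andP[/eqP -> /eqP ->].
Qed.

Lemma strip_T_wall (s y : R) : 0 <= s -> y = 0 \/ y = 1 -> T (s, y) = 0.
Proof.
move=> s0 yw; have y01 : 0 <= y <= 1 by case: yw => ->; rewrite lexx ler01.
apply: (flow_wall_plus hU); first exact: closure_behind.
by rewrite /= clamp_id.
Qed.

(** On the shock, pressure and direction move along the shock polar, starting
    and ending at the normal shock. *)
Lemma front_circulation : int01 (fun y => Q (0, y) * Wy (0, y)) = 0.
Proof.
have [dw cdw [cq dwP]] := polar_C1 gamma1 p0_gt0 u0_gt0 r0_gt0.
have cQ0 : continuous (fun y => Q (0, y)).
  by apply: continuous_leaf; case: leafQ.
have cWy0 : continuous (fun y => Wy (0, y)).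
  by apply: continuous_leaf; case: leafW.
have ddf : derivable01 (deriv01 f) by case: fC2.
apply: (@int01_loop _ (polar_q gamma p0 u0 r0) (polar_w gamma p0 u0 r0) dw
  (fun y => deriv01 f (clamp y)) (deriv01 (deriv01 f)) _ A) => //.
- exact: continuous_clamp_comp.
- move=> y; have := slope_lt (clamp01 y).
  set x := deriv01 f _ => xA; apply: le_lt_trans xA.
  have := real_normK (num_real x); have := sqr_ge0 (`|x| - 1); nra.
- rewrite !clamp_id ?lexx ?ler01//.
  by rewrite !(front_normal_at_walls hU); [|right|left].
- move=> y y01; have y01' : 0 <= y <= 1 by lra.
  apply: (near_eq_is_derive _ (is_derive_deriv01 ddf y01)).
  have : y \in `]0, 1[ by rewrite in_itv.
  move=> /near_in_itvoo; apply: filterS => x; rewrite in_itv/= => x01.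
  by rewrite clamp_id//; lra.
- exact: contM.
- move=> y y01; have y01' : 0 <= y <= 1 by lra.
  rewrite clamp_id//.
  have [_ eP eV eT] := strip_boundary y01'.
  congr (_ * _); first by rewrite /Q /P eP.
  have d1 := leaf_C1_boundary leafW y01.
  have d2 : is_derive y 1 (fun y => W (0, y)) (dw (deriv01 f y) * deriv01 (deriv01 f) y).
    have := is_derive1_comp (f := polar_w gamma p0 u0 r0) (g := deriv01 f)
      (dwP (deriv01 f y)) (is_derive_deriv01 ddf y01).
    apply: near_eq_is_derive.
    have : y \in `]0, 1[ by rewrite in_itv.
    move=> /near_in_itvoo; apply: filterS => x; rewrite in_itv/= => x01.
    have x01' : 0 <= x <= 1 by lra.
    have [_ _ eV' eT'] := strip_boundary x01'.
    have V0 := V_neq0 (0, x).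
    rewrite /W /V /T eV' eT' /polar_w -/(J x).
    rewrite /V eV' in V0.
    have K0 : r0 * u0 ^+ 2 - J x != 0.
      by rewrite lt0r_neq0//; case: (polar_jump_bounds gamma1 p0_gt0 u0_gt0 r0_gt0 (deriv01 f x)).
    have m_neq0 : r0 * u0 != 0 by rewrite lt0r_neq0// mulr_gt0.
    have -> : u0 - J x / (r0 * u0) = (r0 * u0 ^+ 2 - J x) / (r0 * u0).
      by field; rewrite !lt0r_neq0.
    by field; rewrite K0 !lt0r_neq0.
  exact: is_derive_unique d1 d2.
Qed.

(** The Jacobian vanishes, hence the pressure gradient, hence the gradient of
    the flow direction. *)
Lemma interior_gradient (s y : R) : 0 < s -> 0 < y < 1 ->
  [/\ Px (s, y) = 0, Wx (s, y) = 0 & Wy (s, y) = 0].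
Proof.
move=> s0 y01; pose z := (f y + s, y).
have Dz : Dplus f z by exact: Dplus_behind.
have [m_gt0 p_gt0 r_gt0 u_gt0 hm] := subsonic_mach Dz.
have g_gt0 : 0 < gamma by exact: lt_trans gamma1.
have y01h : 0 < (2^-1 : R) < 1 by apply/andP; split; lra.
have A0 : 0 <= A by rewrite /A divr_ge0 ?mulr_ge0 ?exprn_ge0// ltW.
(* The bound on the square of v given by the Bernoulli law. *)
pose b : R := u0 ^+ 2 + 2 * gamma * p0 / ((gamma - 1) * r0).
have K0 : Qx (s, y) * Wy (s, y) - Qy (s, y) * Wx (s, y) = 0.
  apply: (@leaf_rigidity _ Q Qx Qy W Wx Wy (Num.sqrt b / ustar)
    (gamma * A / (p0 * (1 - Mstar ^+ 2)))) => //.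
  - move=> x x0.
    by rewrite /W !strip_T_wall ?mul0r// ?ltW//; [right|left].
  - exact: front_circulation.
  - by rewrite divr_ge0 ?sqrtr_ge0// ltW.
  - by apply: divr_ge0; apply: mulr_ge0 => //; exact: ltW.
  - move=> x h x0 h01.
    have Dx : Dplus f (f h + x, h) by exact: Dplus_behind.
    have [[_ eV eT] _] := interior_values x0 h01.
    have ux := hu Dx.
    rewrite /W eV eT normrM ler_pM//.
      by rewrite -sqrtr_sqr ler_wsqrtr// velocity_bound.
    by rewrite normfV gtr0_norm ?lef_pV2 ?posrE// ?(lt_trans ustar_gt0 ux)// ltW.
  - by move=> x h x0 h01; have [] := interior_jacobian x0 h01.
have [_ _ /(_ K0)[px0 py0]] := interior_jacobian s0 y01.
have [[eP eV eT] [[ePx eVx eTx] [ePy eVy eTy]]] := interior_values s0 y01.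
have [E1 E2] := jacobian_direction gamma1 (euler_plus Dz) p_gt0 u_gt0 r_gt0.
have E1' : vlx U z * dx (vly U) z - vly U z * dx (vlx U) z = 0.
  by apply: (mulfI (lt0r_neq0 r_gt0)); rewrite E1 px0 py0; ring.
have E2' : vlx U z * dy (vly U) z - vly U z * dy (vlx U) z = 0.
  by apply: (mulfI (lt0r_neq0 r_gt0)); rewrite E2 px0 py0; ring.
rewrite ePx px0 /Wx /Wy eV eT eVx eTx eVy eTy -/z.
have -> : vly U z * (- (vlx U z)^-1 ^+ 2 * dx (vlx U) z) +
  (vlx U z)^-1 * dx (vly U) z = (vlx U z)^-1 ^+ 2 *
  (vlx U z * dx (vly U) z - vly U z * dx (vlx U) z).
  by field; rewrite lt0r_neq0.
have -> : vly U z * (- (vlx U z)^-1 ^+ 2 *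
    (deriv01 f y * dx (vlx U) z + dy (vlx U) z)) +
  (vlx U z)^-1 * (deriv01 f y * dx (vly U) z + dy (vly U) z) =
  (vlx U z)^-1 ^+ 2 * (deriv01 f y *
  (vlx U z * dx (vly U) z - vly U z * dx (vlx U) z) +
  (vlx U z * dy (vly U) z - vly U z * dy (vlx U) z)).
  by field; rewrite lt0r_neq0.
by rewrite E1' E2' !mulr0 addr0 mulr0.
Qed.

(** The flow direction is constant along each leaf and vanishes at its ends on
    the walls; being constant along horizontal lines it vanishes on the front
    as well. *)
Lemma interior_vly (s y : R) : 0 < s -> 0 < y < 1 -> T (s, y) = 0 /\ T (0, y) = 0.
Proof.
move=> s0 y01; have [y0 y1] := andP y01.
have [cW _ _ dWx dWy] := leafW.
have W0 : W (s, y) = 0.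
  have W00 : W (s, 0) = 0.
    by rewrite /W strip_T_wall ?mul0r ?ltW//; left.
  have cWs : continuous (fun y => W (s, y)) by exact: continuous_leaf.
  have dW0 (x : R) : 0 < x < y -> is_derive x 1 (fun y => W (s, y)) 0.
    move=> /andP[x0 xy]; have x01 : 0 < x < 1 by rewrite x0 (lt_trans xy).
    have [_ _ Wy0] := interior_gradient s0 x01.
    exact: (is_derive_subst (dWy s x s0 x01) Wy0).
  exact: (etrans (esym (derive0_eq (ltW y0) cWs dW0)) W00).
have WT z : W z = 0 -> T z = 0.
  by move/eqP; rewrite /W mulf_eq0 invr_eq0 (negbTE (V_neq0 z)) orbF => /eqP.
split; apply: WT; first exact: W0.
have cWy : continuous (fun s => W (s, y)).
  apply: (cont_comp (g := fun s => (s, y))) => //.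
  by apply: cont_pair; [move=> ?; exact: cvg_id|exact: contC].
have dW0 (x : R) : 0 < x < s -> is_derive x 1 (fun s => W (s, y)) 0.
  move=> /andP[x0 _]; have [_ Wx0 _] := interior_gradient x0 y01.
  exact: (is_derive_subst (dWx x y x0 y01) Wx0).
exact: (etrans (derive0_eq (ltW s0) cWy dW0) W0).
Qed.

(** Hence the shock is straight, and the state behind it is carried unchanged
    along the horizontal streamlines. *)
Lemma subsonic_rigidity (s y : R) : 0 < s -> 0 < y < 1 ->
  deriv01 f y = 0 /\
  flow_is U (f y + s, y) (post_p gamma p0 u0 r0) (post_u gamma p0 u0 r0) 0
                    (post_rho gamma p0 u0 r0).
Proof.
move=> s0 y01; have y01' : 0 <= y <= 1 by lra.
have [J0 eP0 eV0 eT0] := strip_boundary y01'.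
have m_neq0 : r0 * u0 != 0 by rewrite lt0r_neq0// mulr_gt0.
have sg0 : deriv01 f y = 0.
  have [_] := interior_vly s0 y01; rewrite /T eT0 => /eqP.
  rewrite mulf_eq0 invr_eq0 (negbTE m_neq0) orbF mulf_eq0 (gt_eqF J0) orbF.
  by move=> /eqP.
split=> //.
have along (g : R * R -> R) (gx gy : R * R -> R) : leaf_C1 g gx gy ->
    (forall x, 0 < x -> gx (x, y) = 0) -> g (s, y) = g (0, y).
  move=> [cg _ _ dg _] g0.
  have cgy : continuous (fun s => g (s, y)).
    apply: (cont_comp (g := fun s => (s, y))) => //.
    by apply: cont_pair; [move=> ?; exact: cvg_id|exact: contC].
  have dg0 (x : R) : 0 < x < s -> is_derive x 1 (fun s => g (s, y)) 0.
    move=> /andP[x0 _]; exact: (is_derive_subst (dg x y x0 y01) (g0 x x0)).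
  exact: (esym (derive0_eq (ltW s0) cgy dg0)).
have Ps : P (s, y) = P (0, y).
  by apply: (along _ _ _ leafP) => x x0; have [] := interior_gradient x0 y01.
have Vs : V (s, y) = V (0, y).
  apply: (along _ _ _ leafV) => x x0.
  have Dx : Dplus f (f y + x, y) by exact: Dplus_behind.
  have [_ p_gt0 r_gt0 u_gt0 _] := subsonic_mach Dx.
  have [[_ _ eT] [[ePx eVx _] _]] := interior_values x0 y01.
  have [T0 _] := interior_vly x0 y01; rewrite eT in T0.
  have [Px0 _ _] := interior_gradient x0 y01; rewrite ePx in Px0.
  have [_ E2 _] := euler_plus Dx.
  move: E2; rewrite Px0 T0 mul0r !addr0 eVx => /eqP.
  by rewrite !mulf_eq0 (gt_eqF r_gt0) (gt_eqF u_gt0) => /eqP.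
have Dz : Dplus f (f y + s, y) by exact: Dplus_behind.
have [[eP eV eT] _] := interior_values s0 y01.
have [T0 _] := interior_vly s0 y01.
have B := bernoulli_plus gamma1 r0_gt0 hU Dz.
rewrite -eT T0 in B.
rewrite /J sg0 in J0 eP0 eV0.
have Pz : prs U (f y + s, y) = p0 + polar_jump gamma p0 u0 r0 0 by rewrite -eP Ps.
have Vz : vlx U (f y + s, y) = u0 - polar_jump gamma p0 u0 r0 0 / (r0 * u0).
  by rewrite -eV Vs.
have [e1 e2 e3] := post_state gamma1 p0_gt0 u0_gt0 r0_gt0 J0 Pz Vz B.
by split => //; rewrite -eT.
Qed.

End subsonic.

(** * Linearization at the uniform stream *)

(** Growth along a characteristic, measured by a fast exponential: half of the
    weight is available for the initial value. *)
Lemma halving_along_line {R : realType} (g dg : R -> R) (a c B K : R) : a < c ->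
  (forall x : R, a < x <= c -> is_derive x 1 g (dg x)) ->
  (forall x : R, a < x <= c -> `|dg x| <= K * (B * expR (2 * K * x))) ->
  (forall e : R, 0 < e -> exists2 x : R, a < x <= c &
     `|g x| <= 2^-1 * (B * expR (2 * K * x)) + e) ->
  `|g c| <= 2^-1 * (B * expR (2 * K * c)).
Proof.
move=> ac dgP dgB ga; apply/ler_addgt0Pr => e /ga[x xac gx].
have [E [EE dE]] : exists E : R -> R,
    (forall y, E y = 2^-1 * (B * expR (2 * K * y))) /\
    (forall y : R, is_derive y 1 E (K * (B * expR (2 * K * y)))).
  exists (fun y => 2^-1 * (B * expR (2 * K * y))); split=> // y.
  have d1 := is_derive1_comp (f := expR) (g := fun y => 2 * K * y)
    (is_derive_expR (2 * K * y)) (is_deriveZ (2 * K) (is_derive_id y 1)).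
  have d2 := is_deriveZ 2^-1 (is_deriveZ B d1).
  by apply: (is_derive_subst d2); rewrite /GRing.scale/=; field.
have xc : x <= c by case/andP: xac.
have itv_ac (z : R) : x <= z <= c -> a < z <= c.
  move=> /andP[xz ->]; rewrite andbT; apply: lt_le_trans xz.
  by case/andP: xac.
have dm (z : R) : x <= z <= c ->
    is_derive z 1 (fun y => E y - g y) (K * (B * expR (2 * K * z)) - dg z).
  by move=> /itv_ac zac; exact: (is_deriveB (dE z) (dgP z zac)).
have dp (z : R) : x <= z <= c ->
    is_derive z 1 (fun y => E y + g y) (K * (B * expR (2 * K * z)) + dg z).
  by move=> /itv_ac zac; exact: (is_deriveD (dE z) (dgP z zac)).
have dB (z : R) : x <= z <= c -> `|dg z| <= K * (B * expR (2 * K * z)).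
  by move=> /itv_ac; exact: dgB.
rewrite -!EE in gx *.
have m1 : E x - g x <= E c - g c.
  by apply: (ge0_derive_le xc dm) => z /dB; rewrite ler_norml; lra.
have m2 : E x + g x <= E c + g c.
  by apply: (ge0_derive_le xc dp) => z /dB; rewrite ler_norml; lra.
by move: gx m1 m2; rewrite !ler_norml; lra.
Qed.

Section linearization.
Context {R : realType} (gamma p0 u0 r0 : R).
Hypotheses (gamma1 : 1 < gamma) (p0_gt0 : 0 < p0) (u0_gt0 : 0 < u0)
  (r0_gt0 : 0 < r0).

(** Replacing the coefficients of the Euler system by their values at the
    uniform stream costs products of bounded first derivatives with differences
    of coefficients, and these are of the order of the distance [e] to the
    uniform stream; the density is controlled through the Bernoulli law. *)
Lemma linearized_bound (D : R) : 0 <= D -> exists2 K, 0 <= K &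
  forall e p u v r px py ux uy vx vy : R,
  bernoulli_law gamma p0 u0 r0 p u v r ->
  primitive_euler gamma p u v r px py ux uy vx vy ->
  `|u| <= D -> `|v| <= D -> `|r| <= D -> `|px| <= D -> `|py| <= D ->
  `|ux| <= D -> `|uy| <= D -> `|vx| <= D -> `|vy| <= D ->
  `|p - p0| <= e -> `|u - u0| <= e -> `|v| <= e ->
  [/\ `|u0 * px + gamma * p0 * (ux + vy)| <= K * e,
      `|px + r0 * u0 * ux| <= K * e & `|py + r0 * u0 * vx| <= K * e].
Proof.
move=> D0.
have g_gt0 : 0 < gamma by exact: lt_trans gamma1.
have gm_gt0 : 0 < gamma - 1 by rewrite subr_gt0.
pose c1 := 2 * gamma * p0; have c1_gt0 : 0 < c1 by rewrite /c1 !mulr_gt0.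
pose k1 := (2 * gamma * r0 + D * ((gamma - 1) * r0 * (2 * D + u0))) / c1.
have k1_ge0 : 0 <= k1.
  apply: divr_ge0; last exact: ltW.
  apply: addr_ge0; first by rewrite !mulr_ge0// ltW.
  have u0_ge0 := ltW u0_gt0; have r0_ge0 := ltW r0_gt0.
  apply: mulr_ge0 => //; apply: mulr_ge0; first by apply: mulr_ge0 => //; exact: ltW.
  by apply: addr_ge0 => //; exact: mulr_ge0.
pose k3 := (D + u0 * k1) * D + D * D.
have k3_ge0 : 0 <= k3.
  apply: addr_ge0; apply: mulr_ge0 => //; apply: addr_ge0 => //.
  by apply: mulr_ge0 => //; exact: ltW.
pose k4 := (2 + 2 * gamma) * D.
have k4_ge0 : 0 <= k4 
  by apply: mulr_ge0 => //; apply: addr_ge0 => //; apply: mulr_ge0 => //; exact: ltW.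
exists (k3 + k4); first exact: addr_ge0.
move=> e p u v r px py ux uy vx vy Bl [E1 E2 E3].
move=> uD vD rD pxD pyD uxD uyD vxD vyD pe ue ve.
have e0 : 0 <= e by exact: le_trans ve.
have re : `|r - r0| <= k1 * e.
  rewrite /k1 mulrAC ler_pdivlMr// mulrC -{1}(gtr0_norm c1_gt0) -normrM.
  have -> : c1 * (r - r0) = 2 * gamma * r0 * (p - p0) +
     r * ((gamma - 1) * r0 * ((u - u0) * (u + u0) + v * v)).
    by move: Bl; rewrite /bernoulli_law /c1; lra.
  apply: (le_trans (ler_normD _ _)); rewrite [leRHS]mulrDl; apply: lerD.
    have c_gt0 : 0 < 2 * gamma * r0 by rewrite !mulr_gt0.
    by rewrite normrM (gtr0_norm c_gt0) ler_pM2l.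
  rewrite normrM -[leRHS]mulrA; apply: ler_pM => //.
  have c2_gt0 : 0 < (gamma - 1) * r0 by rewrite mulr_gt0.
  rewrite normrM gtr0_norm// -[leRHS]mulrA ler_pM2l//.
  apply: (le_trans (ler_normD _ _)); rewrite !normrM.
  have : `|u - u0| * `|u + u0| <= e * (D + u0).
    apply: ler_pM => //; apply: (le_trans (ler_normD _ _)).
    by rewrite (gtr0_norm u0_gt0) lerD2r.
  have : `|v| * `|v| <= e * D by exact: ler_pM.
  lra.
have rue : `|r * u - r0 * u0| <= (D + u0 * k1) * e.
  have -> : r * u - r0 * u0 = r * (u - u0) + u0 * (r - r0) by ring.
  apply: (le_trans (ler_normD _ _)); rewrite [leRHS]mulrDl; apply: lerD.
    by rewrite normrM; exact: ler_pM.
  by rewrite normrM (gtr0_norm u0_gt0) -mulrA ler_pM2l.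
have H (a b : R) : `|a| <= D -> `|b| <= D ->
    `|- (r * u - r0 * u0) * a - r * v * b| <= (k3 + k4) * e.
  move=> aD bD; apply: (@le_trans _ _ (k3 * e)); last first.
    by rewrite ler_wpM2r// lerDl.
  apply: (le_trans (ler_normB _ _)); rewrite !normrM normrN /k3.
  have h1 : `|r * u - r0 * u0| * `|a| <= (D + u0 * k1) * e * D by exact: ler_pM.
  have h2 : `|r| * `|v| * `|b| <= D * e * D 
    by apply: ler_pM => //; exact: ler_pM.
  lra.
split.
- have -> : u0 * px + gamma * p0 * (ux + vy) =
    - ((u - u0) * px + v * py + gamma * ((p - p0) * (ux + vy))).
    by apply/eqP; rewrite -addr_eq0 -E1; apply/eqP; ring.
  rewrite normrN; apply: (@le_trans _ _ (k4 * e)); last first.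
    by rewrite ler_wpM2r// lerDr.
  apply: (le_trans (ler_normD _ _)).
  have h1 : `|(u - u0) * px + v * py| <= e * D + e * D.
    by apply: (le_trans (ler_normD _ _)); rewrite !normrM lerD// ler_pM.
  have h2 : `|gamma * ((p - p0) * (ux + vy))| <= gamma * (e * (D + D)).
    rewrite normrM (gtr0_norm g_gt0) ler_pM2l// normrM ler_pM//.
    by apply: (le_trans (ler_normD _ _)); rewrite lerD.
  by rewrite /k4; lra.
- have -> : px + r0 * u0 * ux = - (r * u - r0 * u0) * ux - r * v * uy by lra.
  exact: H.
- have -> : py + r0 * u0 * vx = - (r * u - r0 * u0) * vx - r * v * vy by lra.
  exact: H.
Qed.

End linearization.

(** * The supersonic region *)

Section riemann.
Context {R : realType} (gamma p0 u0 r0 : R).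
Hypotheses (gamma1 : 1 < gamma) (p0_gt0 : 0 < p0) (u0_gt0 : 0 < u0)
  (r0_gt0 : 0 < r0) (sup : gamma * p0 < r0 * u0 ^+ 2).

(** Slope dy/dx of the characteristics of the uniform stream. *)
Definition mach_slope : R := Num.sqrt (gamma * p0 / (r0 * u0 ^+ 2 - gamma * p0)).

Let q_gt0 : 0 < r0 * u0 ^+ 2 - gamma * p0. Proof. by rewrite subr_gt0. Qed.
Let gp_gt0 : 0 < gamma * p0.
Proof. by rewrite mulr_gt0//; exact: lt_trans gamma1. Qed.

Lemma mach_slope_gt0 : 0 < mach_slope.
Proof. by rewrite sqrtr_gt0 divr_gt0. Qed.

Lemma mach_slope_sqr :
  mach_slope ^+ 2 = gamma * p0 / (r0 * u0 ^+ 2 - gamma * p0).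
Proof. by rewrite sqr_sqrtr// ltW// divr_gt0. Qed.

(** Riemann invariants of the linearized system: [e = 1] and [e = -1] select
    the two families of characteristics, of slope [e * mach_slope]. *)
Definition riemann (e p v : R) : R := (p - p0) + e * (r0 * u0 * mach_slope) * v.

Lemma riemann_transport (K E e px py ux vx vy : R) : e = 1 \/ e = -1 ->
  `|u0 * px + gamma * p0 * (ux + vy)| <= K * E ->
  `|px + r0 * u0 * ux| <= K * E -> `|py + r0 * u0 * vx| <= K * E ->
  `|(px + e * mach_slope * py) +
    e * (r0 * u0 * mach_slope) * (vx + e * mach_slope * vy)| <=
  ((r0 * u0 + gamma * p0) / (r0 * u0 ^+ 2 - gamma * p0) + mach_slope) * (K * E).
Proof.
move=> he G1 F2 F3.
have e2 : e * e = 1 by case: he => ->; ring.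
have ne : `|e| = 1 by case: he => ->; rewrite ?normrN normr1.
have lam0 := mach_slope_gt0.
have q0 := q_gt0; set q := r0 * u0 ^+ 2 - gamma * p0 in q0 *.
have -> : px + e * mach_slope * py +
    e * (r0 * u0 * mach_slope) * (vx + e * mach_slope * vy) =
  (r0 * u0 * (u0 * px + gamma * p0 * (ux + vy)) -
   gamma * p0 * (px + r0 * u0 * ux)) / q +
  e * mach_slope * (py + r0 * u0 * vx).
  have -> : px + e * mach_slope * py +
      e * (r0 * u0 * mach_slope) * (vx + e * mach_slope * vy) =
    px + r0 * u0 * mach_slope ^+ 2 * (e * e) * vy + e * mach_slope * (py + r0 * u0 * vx).
    by ring.
  by rewrite e2 mach_slope_sqr -/q /q; field; rewrite lt0r_neq0.
apply: (le_trans (ler_normD _ _)); rewrite [leRHS]mulrDl; apply: lerD; last first.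
  by rewrite !normrM ne mul1r (gtr0_norm lam0) ler_pM2l.
rewrite normrM normfV (gtr0_norm q0) [leRHS]mulrAC ler_pM2r ?invr_gt0//.
apply: (le_trans (ler_normB _ _)); rewrite [leRHS]mulrDl; apply: lerD.
  by rewrite normrM gtr0_norm ?ler_pM2l// mulr_gt0.
by rewrite normrM gtr0_norm ?ler_pM2l.
Qed.

End riemann.

Lemma halves_eq0 {R : realType} (x C : R) :
  0 <= x -> (forall n, x <= 2^-1 ^+ n * C) -> x = 0.
Proof.
move=> x0 H; apply/eqP; rewrite eq_le x0 andbT leNgt; apply/negP => x_gt0.
have C0 : 0 <= C by apply: le_trans x0 _; have := H 0%N; rewrite expr0 mul1r.
pose n := Num.bound (C / x).
have : C / x < 2 ^+ n.
  apply: (@lt_le_trans _ _ n%:R).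
    by apply: archi_boundP; rewrite divr_ge0// ltW.
  by rewrite -natrX ler_nat ltnW// ltn_expl.
rewrite ltr_pdivrMr// => nC; have := H n.
rewrite exprVn mulrC ler_pdivlMr ?exprn_gt0// leNgt => /negP; apply.
by rewrite mulrC.
Qed.

Section supersonic.
Context {R : realType} {gamma p0 u0 r0 : R} {f : R -> R} {U : flow R}.
Hypotheses (gamma1 : 1 < gamma) (p0_gt0 : 0 < p0) (u0_gt0 : 0 < u0)
  (r0_gt0 : 0 < r0) (sup : gamma * p0 < r0 * u0 ^+ 2)
  (hU : transonic_shock gamma p0 u0 r0 f U).

Let df : derivable01 f. Proof. by case: (shock_C2 hU). Qed.

Lemma front_upper_bound : exists M, forall y : R, 0 <= y <= 1 -> f y <= M.
Proof.
have [c _ cP] := EVT_max (@ler01 R)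
  (continuous_subspaceT (continuous_clamp_comp df)).
by exists (f (clamp c)) => y y01; rewrite -{1}(clamp_id y01); apply: cP; rewrite in_itv.
Qed.

Lemma bounded_Dminus (q : R * R -> R) :
  (forall w, closure (Dminus f) w -> has_trace (Dminus f) q w) ->
  exists2 C, 0 <= C & forall z, Dminus f z -> `|q z| <= C.
Proof.
move=> hq; have [M fM] := front_upper_bound.
have cK : compact (`[-1, M] `*` `[0, 1] : set (R * R)).
  by apply: compact_setX; exact: segment_compact.
have [C CP] := bounded_of_trace hq cK.
exists `|C| => // -[x y] Dz; apply: le_trans (ler_norm C).
apply: CP => //; have [[/= x1 y01] fx] := Dz.
have y01' : 0 <= y <= 1 by lra.
have := fM y y01'; split; rewrite /= in_itv/=; lra.
Qed.

Lemma euler_minus z : Dminus f z ->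
  primitive_euler gamma (prs U z) (vlx U z) (vly U z) (rho U z)
    (dx (prs U) z) (dy (prs U) z) (dx (vlx U) z) (dy (vlx U) z)
    (dx (vly U) z) (dy (vly U) z).
Proof.
move=> Dz; have [[dp _] [du _] [dv _] [dr _]] := flow_C1_minus hU.
apply: (euler_primitive gamma1 r0_gt0 (nbhs_Dminus df Dz)); try by auto.
- by move=> w Dw; apply: (flow_pos hU); left.
- by move=> w Dw; apply: (flow_euler hU); left.
Qed.

Lemma linearized_minus : exists2 K, 0 <= K & forall z E, Dminus f z ->
  `|prs U z - p0| <= E -> `|vlx U z - u0| <= E -> `|vly U z| <= E ->
  [/\ `|u0 * dx (prs U) z + gamma * p0 * (dx (vlx U) z + dy (vly U) z)| <= K * E,
      `|dx (prs U) z + r0 * u0 * dx (vlx U) z| <= K * E &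
      `|dy (prs U) z + r0 * u0 * dx (vly U) z| <= K * E].
Proof.
have [[_ tp] [_ tu] [_ tv] [_ tr]] := flow_C1_minus hU.
have [|C1 C10 C1P] := bounded_Dminus (q := vlx U); first by move=> w /tu[].
have [|C2 C20 C2P] := bounded_Dminus (q := vly U); first by move=> w /tv[].
have [|C3 C30 C3P] := bounded_Dminus (q := rho U); first by move=> w /tr[].
have [|C4 C40 C4P] := bounded_Dminus (q := dx (prs U)); first by move=> w /tp[].
have [|C5 C50 C5P] := bounded_Dminus (q := dy (prs U)); first by move=> w /tp[].
have [|C6 C60 C6P] := bounded_Dminus (q := dx (vlx U)); first by move=> w /tu[].
have [|C7 C70 C7P] := bounded_Dminus (q := dy (vlx U)); first by move=> w /tu[].
have [|C8 C80 C8P] := bounded_Dminus (q := dx (vly U)); first by move=> w /tv[].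
have [|C9 C90 C9P] := bounded_Dminus (q := dy (vly U)); first by move=> w /tv[].
pose D := C1 + C2 + C3 + C4 + C5 + C6 + C7 + C8 + C9.
have D0 : 0 <= D by rewrite /D; lra.
have [K K0 KP] := linearized_bound gamma1 p0_gt0 u0_gt0 r0_gt0 D0.
exists K => // z E Dz pE uE vE.
apply: KP pE uE vE; [exact: (bernoulli_minus gamma1 r0_gt0 hU Dz)|exact: euler_minus|..].
- by apply: (le_trans (C1P z Dz)); rewrite /D; lra.
- by apply: (le_trans (C2P z Dz)); rewrite /D; lra.
- by apply: (le_trans (C3P z Dz)); rewrite /D; lra.
- by apply: (le_trans (C4P z Dz)); rewrite /D; lra.
- by apply: (le_trans (C5P z Dz)); rewrite /D; lra.
- by apply: (le_trans (C6P z Dz)); rewrite /D; lra.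
- by apply: (le_trans (C7P z Dz)); rewrite /D; lra.
- by apply: (le_trans (C8P z Dz)); rewrite /D; lra.
- by apply: (le_trans (C9P z Dz)); rewrite /D; lra.
Qed.

(** [Om] is a domain of determinacy: with each point it contains the part of the
    duct inside the backward characteristic cone of the uniform stream. *)
Context {Om : set (R * R)}.
Hypotheses (OmD : Om `<=` Dminus f)
  (cone : forall x y x' y' : R, Om (x, y) -> -1 < x' -> x' <= x -> 0 < y' < 1 ->
     `|y' - y| <= mach_slope gamma p0 u0 r0 * (x - x') -> Om (x', y')).

Let lam := mach_slope gamma p0 u0 r0.
Let b := r0 * u0 * lam.
Let rie e z := riemann gamma p0 u0 r0 e (prs U z) (vly U z).
Let nor z := (prs U z - p0) + r0 * u0 * (vlx U z - u0).

(** One plus the distance to the wall where the family [e] enters the duct.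
    At that wall the entering family has weight 1 and the family that it
    reflects has weight 2, so that the reflection is contracting. *)
Let phi (e y : R) : R := 3 / 2 + e * (y - 1 / 2).

Let lam_gt0 : 0 < lam. Proof. exact: mach_slope_gt0. Qed.
Let m_gt0 : 0 < r0 * u0. Proof. exact: mulr_gt0. Qed.
Let b_gt0 : 0 < b. Proof. exact: mulr_gt0. Qed.

Let weighted (B k : R) (z : R * R) :=
  (forall e, e = 1 \/ e = -1 -> `|phi e z.2 * rie e z| <= B * expR (k * z.1)) /\
  `|nor z| <= B * expR (k * z.1).

Let phi_bounds (e y : R) : e = 1 \/ e = -1 -> 0 < y < 1 -> 1 <= phi e y <= 2.
Proof. by case=> -> y01; rewrite /phi; apply/andP; split; lra. Qed.

Let rie_le (B k e : R) z : weighted B k z -> e = 1 \/ e = -1 -> 0 < z.2 < 1 ->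
  `|rie e z| <= B * expR (k * z.1).
Proof.
move=> [w _] he z01; have /andP[f1 _] := phi_bounds he z01.
apply: le_trans (w e he); rewrite normrM ler_peMl//.
by rewrite ger0_norm ?(le_trans ler01).
Qed.

Let weighted_state (B k : R) z : weighted B k z -> 0 < z.2 < 1 ->
  let E := (1 + b^-1 + 2 / (r0 * u0)) * (B * expR (k * z.1)) in
  [/\ `|prs U z - p0| <= E, `|vlx U z - u0| <= E & `|vly U z| <= E].
Proof.
move=> wz z01 E.
have h1 := rie_le wz (or_introl erefl) z01.
have h2 := rie_le wz (or_intror erefl) z01.
have [_ h3] := wz.
move: h1 h2 h3; rewrite /rie /riemann /nor /E -/lam -/b.
set e0 := B * _; set P := prs U z - p0; set u := vlx U z - u0; set v := vly U z.
move=> h1 h2 h3.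
have e0_ge0 : 0 <= e0 by exact: le_trans h3.
have b1 : 0 <= b^-1 * e0 by rewrite mulr_ge0// invr_ge0 ltW.
have m1 : 0 <= 2 / (r0 * u0) * e0 by rewrite mulr_ge0// divr_ge0// ltW.
have Pe : `|P| <= e0 by move: h1 h2; rewrite !ler_norml; lra.
have be : `|b * v| <= e0 by move: h1 h2; rewrite !ler_norml; lra.
have ue : `|r0 * u0 * u| <= 2 * e0 by move: h3 Pe; rewrite !ler_norml; lra.
split.
- by rewrite !mulrDl mul1r; lra.
- have : `|u| <= 2 / (r0 * u0) * e0.
    by rewrite mulrAC ler_pdivlMr// mulrC -{1}(gtr0_norm m_gt0) -normrM.
  by rewrite !mulrDl mul1r; lra.
- have : `|v| <= b^-1 * e0.
    by rewrite mulrC ler_pdivlMr// mulrC -{1}(gtr0_norm b_gt0) -normrM.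
  by rewrite !mulrDl mul1r; lra.
Qed.

Let chi (e x y t : R) : R * R := (t, y + e * lam * (t - x)).

(** A backward characteristic starts at the inlet, where the state is known, or
    at the wall where its family enters the duct, where [v] vanishes and the
    weight of the family is 1. *)
Let characteristic_start (e x y : R) : Om (x, y) -> e = 1 \/ e = -1 ->
  exists2 a, -1 <= a < x &
  (forall t, a < t <= x -> Om (chi e x y t)) /\
  forall eta, 0 < eta -> exists2 t, a < t <= x &
    `|vly U (chi e x y t)| <= eta /\
    (`|prs U (chi e x y t) - p0| <= eta \/ phi e (chi e x y t).2 <= 1 + eta).
Proof.
move=> Oxy he.
have [[/= x1 y01] xf] := OmD Oxy.
(* The distance to the wall that the backward characteristic approaches. *)
pose d := 1 / 2 + e * (y - 1 / 2).
have d01 : 0 < d < 1 by rewrite /d; case: he => ->; apply/andP; split; lra.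
have [d0 d1] := andP d01.
have dl0 : 0 < d / lam by rewrite divr_gt0.
pose a := Num.max (-1) (x - d / lam).
have a1 : -1 <= a by rewrite /a le_max lexx.
have a2 : x - d / lam <= a by rewrite /a le_max lexx orbT.
have ax : a < x by rewrite /a gt_max x1; lra.
have le2 : `|e * lam| = lam.
  by rewrite normrM (gtr0_norm lam_gt0); case: he => ->; rewrite ?normrN normr1 mul1r.
have lax : lam * (x - a) <= d.
  by rewrite mulrC -ler_pdivlMr//; lra.
have chi01 t : a <= t -> t <= x -> 0 <= (chi e x y t).2 <= 1 /\
    (a < t -> 0 < (chi e x y t).2 < 1).
  move=> at_ tx.
  have h1 : 0 <= lam * (t - a) by rewrite mulr_ge0 ?subr_ge0// ltW.
  have h2 : 0 <= lam * (x - t) by rewrite mulr_ge0 ?subr_ge0// ltW.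
  have h3 : a < t -> 0 < lam * (t - a) by move=> ?; rewrite mulr_gt0 ?subr_gt0.
  move: d0 d1 lax; rewrite /chi /= /d.
  by case: he => ->; split => [|/h3]; lra.
have OmC t : a < t <= x -> Om (chi e x y t).
  move=> /andP[at_ tx]; apply: (cone Oxy) => //.
  - exact: le_lt_trans at_.
  - by have [_] := chi01 t (ltW at_) tx; exact.
  - by rewrite addrAC subrr add0r normrM le2 -/lam ler_pM2l// ler0_norm ?subr_le0// opprB.
exists a; first by rewrite a1.
split=> // eta eta0.
have cont_chi (h : R) : 0 < h -> exists2 t, a < t <= x &
    `|(chi e x y t).1 - (chi e x y a).1| < h /\
    `|(chi e x y t).2 - (chi e x y a).2| < h.
  move=> h0; pose s := Num.min (x - a) (Num.min (h / 2) (h / (2 * lam))).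
  have s0 : 0 < s by rewrite !lt_min subr_gt0 ax !divr_gt0// mulr_gt0.
  have [s1 s2 s3] : [/\ s <= x - a, s <= h / 2 & s <= h / (2 * lam)].
    by rewrite !ge_min !lexx !orbT.
  exists (a + s); first by apply/andP; split; lra.
  rewrite /chi /= addrAC subrr add0r gtr0_norm//; split; first lra.
  have -> : y + e * lam * (a + s - x) - (y + e * lam * (a - x)) = e * lam * s by ring.
  rewrite normrM le2 gtr0_norm// mulrC.
  have : s * (2 * lam) <= h by rewrite -ler_pdivlMr// mulr_gt0.
  by lra.
have cl : closure (Dminus f) (chi e x y a).
  apply/closure_box => h /cont_chi[t ta th]; exists (chi e x y t) => //.
  exact/OmD/OmC.
have [tp _ tv _] := minus_traces hU cl.
have [a01 _] := chi01 a (lexx a) (ltW ax).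
have [hv hv0 hvP] := trace_box cl tv _ eta0.
have [ha|ha] := eqVneq a (-1).
  have [ep _ ev _] := flow_inlet hU a01.
  have eqa : chi e x y a = (-1, (chi e x y a).2) by rewrite /chi /= ha.
  have [hp hp0 hpP] := trace_box cl tp _ eta0.
  have [|t ta []] := cont_chi (Num.min hv hp); first by rewrite lt_min hv0.
  rewrite !lt_min => /andP[t1 t2] /andP[t3 t4].
  exists t => //; have Ot := OmD (OmC t ta).
  have := hvP _ Ot t1 t3; have := hpP _ Ot t2 t4.
  by rewrite eqa ep ev subr0 => /ltW hP /ltW hV; split=> //; left.
have aE : a = x - d / lam.
  by move: ha; rewrite /a; case: leP => // _; rewrite eqxx.
have ya : (chi e x y a).2 = 0 \/ (chi e x y a).2 = 1.
  rewrite /chi /= aE.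
  have -> : y + e * lam * (x - d / lam - x) = y - e * d by field; rewrite lt0r_neq0.
  by rewrite /d; case: he => ->; [left|right]; lra.
have ev := flow_wall_minus hU cl ya.
have [|t ta []] := cont_chi (Num.min hv eta); first by rewrite lt_min hv0.
rewrite !lt_min => /andP[t1 t2] /andP[t3 t4].
exists t => //; have Ot := OmD (OmC t ta).
have phia : phi e (chi e x y a).2 = 1.
  rewrite /phi /chi /= aE.
  have -> : y + e * lam * (x - d / lam - x) = y - e * d by field; rewrite lt0r_neq0.
  by rewrite /d; case: he => ->; lra.
have phit : phi e (chi e x y t).2 <= 1 + eta.
  move: t4 phia; rewrite /phi.
  move: (chi e x y t).2 (chi e x y a).2 => z1 z2.
  rewrite ltr_norml => /andP[z3 z4] z5.
  by case: he z5 => -> z5; lra.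
have := hvP _ Ot t1 t3; rewrite ev subr0 => /ltW hV.
by split=> //; right.
Qed.

(** Along characteristics half of the exponential weight pays for the error of
    the linearization, and the other half for the value at the start: zero at
    the inlet, the reflected family with twice the weight at a wall. *)
Let halving : exists2 k, 0 <= k & forall B, 0 <= B ->
  (forall z, Om z -> weighted B k z) -> forall z, Om z -> weighted (2^-1 * B) k z.
Proof.
have [K K0 KP] := linearized_minus.
pose c := 1 + b^-1 + 2 / (r0 * u0).
have c0 : 0 <= c.
  by rewrite /c !addr_ge0// ?divr_ge0// ?invr_ge0 ltW.
pose k5 := ((r0 * u0 + gamma * p0) / (r0 * u0 ^+ 2 - gamma * p0) + lam) * (K * c).
have k50 : 0 <= k5.
  rewrite mulr_ge0 ?mulr_ge0// addr_ge0 ?(ltW lam_gt0)// divr_ge0//.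
    by rewrite addr_ge0 ?(ltW m_gt0)// mulr_ge0 ?(ltW p0_gt0)// ltW// (lt_trans ltr01).
  by rewrite subr_ge0 ltW.
pose K1 := lam + 2 * k5 + K * c.
have Kc0 : 0 <= K * c by exact: mulr_ge0.
have lam0 := ltW lam_gt0.
have b0 := ltW b_gt0.
exists (2 * K1).
  by rewrite mulr_ge0// /K1 !addr_ge0// mulr_ge0.
move=> B B0 wB -[x y] Oxy.
have Dxy := OmD Oxy; have [[/= x1 y01] xf] := Dxy.
have [[dp _] [du _] [dv _] _] := flow_C1_minus hU.
have E0 t : 0 <= B * expR (2 * K1 * t) by rewrite mulr_ge0// expR_ge0.
split=> [e he|]; rewrite -[leRHS]mulrA /=.
  have [a /andP[a1 ax] [aOm start]] := characteristic_start Oxy he.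
  have ne : `|e| = 1 by case: he => ->; rewrite ?normrN normr1.
  have e2 : e * e = 1 by case: he => ->; ring.
  pose g t := phi e (chi e x y t).2 * rie e (chi e x y t).
  pose tr z := (dx (prs U) z + e * lam * dy (prs U) z) +
    e * b * (dx (vly U) z + e * lam * dy (vly U) z).
  pose dg t := phi e (chi e x y t).2 * tr (chi e x y t) +
    rie e (chi e x y t) * (e * (e * lam)).
  have -> : phi e y * rie e (x, y) = g x by rewrite /g /chi subrr mulr0 addr0.
  apply: (@halving_along_line _ g dg a x B K1 ax) => [t tax|t tax|eta eta0].
  - have Dt := OmD (aOm t tax).
    have ce : is_derive t 1 (fun t => y + e * lam * (t - x)) (e * lam).
      have d1 := is_deriveB (is_derive_id t 1) (is_derive_cst x t 1).
      have d2 := is_deriveD (is_derive_cst y t 1) (is_deriveZ (e * lam) d1).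
      by apply: (is_derive_subst d2); rewrite /GRing.scale/= subr0 mulr1 add0r.
    have dP := is_derive_curve (a := id) (dp _ Dt) (is_derive_id t 1) ce.
    have dV := is_derive_curve (a := id) (dv _ Dt) (is_derive_id t 1) ce.
    have d1 := is_deriveB dP (is_derive_cst p0 t 1).
    have d2 := is_deriveD d1 (is_deriveZ (e * b) dV).
    have d3 := is_deriveB ce (is_derive_cst (1 / 2 : R) t 1).
    have d4 := is_deriveD (is_derive_cst (3 / 2 : R) t 1) (is_deriveZ e d3).
    have d5 := is_deriveM d4 d2.
    apply: (is_derive_subst d5).
    rewrite /dg /tr /rie /riemann /phi /chi /GRing.scale/= !fctE /= -/lam -/b.
    by rewrite -[e *: _]/(e * _) -[(e * b) *: _]/(e * b * _); ring.
  - have Ot := aOm t tax; have Dt := OmD Ot.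
    have [[_ t01] _] := Dt.
    have [s1 s2 s3] := weighted_state (wB _ Ot) t01.
    have [G1 F2 F3] := KP _ _ Dt s1 s2 s3.
    have T := riemann_transport gamma1 p0_gt0 u0_gt0 r0_gt0 sup he G1 F2 F3.
    rewrite -/lam -/b -/(tr (chi e x y t)) mulrA -/c in T.
    have Rt := rie_le (wB _ Ot) he t01.
    have /andP[f1 f2] := phi_bounds he t01.
    have t2 : expR (2 * K1 * (chi e x y t).1) = expR (2 * K1 * t) by [].
    rewrite t2 in T Rt.
    rewrite /dg; apply: (le_trans (ler_normD _ _)).
    have h1 : `|phi e (chi e x y t).2 * tr (chi e x y t)| <=
        2 * (k5 * (B * expR (2 * K1 * t))).
      rewrite normrM ger0_norm; last exact: le_trans f1.
      apply: ler_pM => //; first exact: le_trans f1.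
      by apply: (le_trans T); rewrite /k5 !mulrA.
    have h2 : `|rie e (chi e x y t) * (e * (e * lam))| <=
        (B * expR (2 * K1 * t)) * lam.
      by rewrite normrM mulrA e2 mul1r (gtr0_norm lam_gt0) ler_pM2r.
    have h3 : 0 <= K * c * (B * expR (2 * K1 * t)) by rewrite mulr_ge0.
    by rewrite /K1; lra.
  (* The start of the characteristic; [et] is so small that the contributions
     of [v] and of the varying weight sum up to at most [eta]. *)
  - pose Em := B * expR (2 * K1 * x).
    have Em0 : 0 <= Em by exact: E0.
    pose et := eta / (2 * Em + 4 * b + 2).
    have dn0 : 0 < 2 * Em + 4 * b + 2 by rewrite ltr_pwDr// addr_ge0// mulr_ge0.
    have et0 : 0 < et by rewrite divr_gt0.
    have etE : et * (2 * Em + 4 * b + 2) = eta by rewrite /et divfK// lt0r_neq0.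
    have e1 : 0 <= et * Em by rewrite mulr_ge0// ltW.
    have e3 : 0 <= et * b by rewrite mulr_ge0// ltW.
    have [t tax [vt alt]] := start et et0.
    exists t => //; have Ot := aOm t tax; have Dt := OmD Ot.
    have [[_ t01] _] := Dt.
    have /andP[f1 f2] := phi_bounds he t01.
    have bv : `|b * vly U (chi e x y t)| <= et * b.
      by rewrite normrM (gtr0_norm b_gt0) mulrC ler_pM2r.
    have Et0 := E0 t.
    rewrite /g normrM (ger0_norm (le_trans ler01 f1)).
    case: alt => [pt|ft].
      have Rt : `|rie e (chi e x y t)| <= et + et * b.
        rewrite /rie /riemann -/lam -/b; apply: (le_trans (ler_normD _ _)).
        by rewrite lerD// -mulrA normrM ne mul1r.
      have : phi e (chi e x y t).2 * `|rie e (chi e x y t)| <= 2 * (et + et * b).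
        by apply: ler_pM => //; exact: le_trans f1.
      by lra.
    have he' : - e = 1 \/ - e = -1 by case: he => ->; [right|left]; rewrite ?opprK.
    have [w _] := wB _ Ot; have := w _ he'; have R1 := rie_le (wB _ Ot) he' t01.
    have tx : B * expR (2 * K1 * t) <= Em.
      rewrite ler_wpM2l// ler_expR ler_wpM2l//; last by case/andP: tax.
      by rewrite mulr_ge0// /K1 !addr_ge0// mulr_ge0.
    have etx : et * `|rie (- e) (chi e x y t)| <= et * Em.
      by rewrite ler_pM2l//; exact: le_trans tx.
    have phiN : phi (- e) (chi e x y t).2 = 3 - phi e (chi e x y t).2.
      by rewrite /phi; field.
    have /andP[g1 g2] := phi_bounds he' t01.
    rewrite phiN in g1 g2 *; rewrite normrM (ger0_norm (le_trans ler01 g1)).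
    have RR : `|rie e (chi e x y t)| <= `|rie (- e) (chi e x y t)| + 2 * (et * b).
      have -> : rie e (chi e x y t) = rie (- e) (chi e x y t) +
          2 * (e * (b * vly U (chi e x y t))).
        by rewrite /rie /riemann -/lam -/b; ring.
      apply: (le_trans (ler_normD _ _)); rewrite lerD2l.
      by rewrite normrM normr_nat normrM ne mul1r ler_pM2l.
    have N0 : 0 <= `|rie (- e) (chi e x y t)| by [].
    move: (phi e (chi e x y t).2) (`|rie (- e) _|) (`|rie e _|) N0 f1 f2 ft g1 g2 RR etx R1
      => ph r1 r2 N0 f1 f2 ft g1 g2 RR etx R1 Hw.
    apply: (@le_trans _ _ (ph * (r1 + 2 * (et * b)))).
      by apply: ler_wpM2l => //; exact: le_trans f1.
    have h1 : (ph - 1) * r1 <= et * r1 by apply: ler_wpM2r => //; lra.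
    have h2 : ph * (2 * (et * b)) <= 2 * (2 * (et * b)) by apply: ler_wpM2r => //; lra.
    have h3 : (3 - ph) * r1 = 2 * r1 - (ph - 1) * r1 by ring.
    have -> : ph * (r1 + 2 * (et * b)) = r1 + (ph - 1) * r1 + ph * (2 * (et * b)) by ring.
    rewrite h3 in Hw.
    by lra.
have OmC t : -1 < t <= x -> Om (t, y).
  by move=> /andP[t1 tx]; apply: (cone Oxy) => //;
    rewrite subrr normr0 mulr_ge0// subr_ge0.
pose dg t := dx (prs U) (t, y) + r0 * u0 * dx (vlx U) (t, y).
have x1' : -1 < x by [].
apply: (@halving_along_line _ (fun t => nor (t, y)) dg (-1) x B K1 x1')
    => [t tax|t tax|eta eta0].
- have Dt := OmD (OmC t tax).
  have dP := is_derive_curve (a := id) (dp _ Dt) (is_derive_id t 1) (is_derive_cst y t 1).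
  have dV := is_derive_curve (a := id) (du _ Dt) (is_derive_id t 1) (is_derive_cst y t 1).
  have d1 := is_deriveB dP (is_derive_cst p0 t 1).
  have d2 := is_deriveB dV (is_derive_cst u0 t 1).
  have d3 := is_deriveD d1 (is_deriveZ (r0 * u0) d2).
  apply: (is_derive_subst d3); rewrite /dg /GRing.scale/=; ring.
- have Ot := OmC t tax; have Dt := OmD Ot.
  have [[_ t01] _] := Dt.
  have [s1 s2 s3] := weighted_state (wB _ Ot) t01.
  have [_ F2 _] := KP _ _ Dt s1 s2 s3.
  have F2' : `|dg t| <= K * c * (B * expR (2 * K1 * t)).
    by rewrite -mulrA; exact: F2.
  apply: (le_trans F2'); apply: ler_wpM2r; first exact: E0.
  by rewrite /K1 lerDr addr_ge0// mulr_ge0.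
- have y01' : 0 <= y <= 1 by lra.
  have cl : closure (Dminus f) (-1, y).
    apply/closure_box => h h0.
    pose t := -1 + Num.min (x + 1) (h / 2).
    have m0 : 0 < Num.min (x + 1) (h / 2) by rewrite lt_min divr_gt0// andbT; lra.
    have [m1 m2] : Num.min (x + 1) (h / 2) <= x + 1 /\ Num.min (x + 1) (h / 2) <= h / 2.
      by rewrite !ge_min !lexx !orbT.
    exists (t, y); first by apply/OmD/OmC/andP; rewrite /t; split; lra.
    by rewrite /= subrr normr0 /t ltr_norml; split=> //; apply/andP; split; lra.
  have [tp tu _ _] := minus_traces hU cl.
  have [ep eu _ _] := flow_inlet hU y01'.
  pose et := eta / (1 + r0 * u0).
  have et0 : 0 < et by rewrite divr_gt0// addr_gt0.
  have [h1 h10 h1P] := trace_box cl tp _ et0.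
  have [h2 h20 h2P] := trace_box cl tu _ et0.
  have h0 : 0 < Num.min h1 h2 by rewrite lt_min h10.
  pose t := -1 + Num.min (x + 1) (Num.min h1 h2 / 2).
  have m0 : 0 < Num.min (x + 1) (Num.min h1 h2 / 2) by rewrite lt_min divr_gt0// andbT; lra.
  have [m1 m2] : Num.min (x + 1) (Num.min h1 h2 / 2) <= x + 1 /\
      Num.min (x + 1) (Num.min h1 h2 / 2) <= Num.min h1 h2 / 2.
    by rewrite !ge_min !lexx !orbT.
  have tax : -1 < t <= x by apply/andP; rewrite /t; split; lra.
  have /andP[th1 th2] : (`|t - -1| < h1) && (`|t - -1| < h2).
    by rewrite -lt_min ltr_norml /t; apply/andP; split; lra.
  exists t => //; have Dt := OmD (OmC t tax).
  have := h1P _ Dt; rewrite /= subrr normr0 ep => /(_ th1 h10) /ltW P1.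
  have := h2P _ Dt; rewrite /= subrr normr0 eu => /(_ th2 h20) /ltW P2.
  apply: (@le_trans _ _ eta); last by rewrite lerDr mulr_ge0.
  rewrite /nor; apply: (le_trans (ler_normD _ _)).
  have -> : eta = et + r0 * u0 * et by rewrite /et; field; rewrite lt0r_neq0// addr_gt0.
  by rewrite lerD// normrM (gtr0_norm m_gt0) ler_pM2l.
Qed.

(** A bound that can be halved indefinitely is zero. *)
Lemma supersonic_uniform z : Om z -> flow_is U z p0 u0 0 r0.
Proof.
move=> Oz; have [k k0 kP] := halving.
have [[_ tp] [_ tu] [_ tv] _] := flow_C1_minus hU.
have [|C1 C10 C1P] := bounded_Dminus (q := prs U); first by move=> w /tp[].
have [|C2 C20 C2P] := bounded_Dminus (q := vlx U); first by move=> w /tu[].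
have [|C3 C30 C3P] := bounded_Dminus (q := vly U); first by move=> w /tv[].
pose B0 := 2 * (C1 + p0 + b * C3) + (C1 + p0 + r0 * u0 * (C2 + u0)).
have p0_ge0 := ltW p0_gt0; have u0_ge0 := ltW u0_gt0.
have b_ge0 := ltW b_gt0; have m_ge0 := ltW m_gt0.
have B1 : 0 <= C1 + p0 + b * C3.
  by apply: addr_ge0; [exact: addr_ge0|exact: mulr_ge0].
have B2 : 0 <= C1 + p0 + r0 * u0 * (C2 + u0).
  by apply: addr_ge0; [exact: addr_ge0|apply: mulr_ge0 => //; exact: addr_ge0].
have B00 : 0 <= B0 by rewrite /B0; lra.
pose B := B0 * expR k.
have wB0 n w : Om w -> weighted (2^-1 ^+ n * B) k w.
  elim: n w => [|n IH] w Ow; last first.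
    rewrite exprS -mulrA; apply: kP => //.
    by rewrite mulr_ge0 ?exprn_ge0 ?invr_ge0// mulr_ge0// expR_ge0.
  rewrite expr0 mul1r.
  have Dw := OmD Ow; have [[/= w1 w01] _] := Dw.
  have Bw : B0 <= B * expR (k * w.1).
    rewrite /B -mulrA -expRD -[k in k + _]mulr1 -mulrDr ler_peMr//.
    by rewrite -[leLHS]expR0 ler_expR; apply: mulr_ge0 => //; lra.
  have Pw : `|prs U w - p0| <= C1 + p0.
    by apply: (le_trans (ler_normB _ _)); rewrite (gtr0_norm p0_gt0) lerD2r C1P.
  have Vw : `|vly U w| <= C3 by exact: C3P.
  have Uw : `|vlx U w - u0| <= C2 + u0.
    by apply: (le_trans (ler_normB _ _)); rewrite (gtr0_norm u0_gt0) lerD2r C2P.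
  split=> [e he|].
    have ne : `|e| = 1 by case: he => ->; rewrite ?normrN normr1.
    have /andP[f1 f2] := phi_bounds he w01.
    apply: le_trans Bw; rewrite normrM (ger0_norm (le_trans ler01 f1)).
    apply: (@le_trans _ _ (2 * (C1 + p0 + b * C3))); last by rewrite /B0; lra.
    apply: ler_pM => //; first exact: le_trans f1.
    apply: (le_trans (ler_normD _ _)); apply: lerD => //.
    by rewrite -/lam -/b -mulrA normrM ne mul1r normrM (gtr0_norm b_gt0) ler_pM2l.
  apply: le_trans Bw; apply: (@le_trans _ _ (C1 + p0 + r0 * u0 * (C2 + u0))); last first.
    by rewrite /B0; lra.
  apply: (le_trans (ler_normD _ _)); apply: lerD => //.
  by rewrite normrM (gtr0_norm m_gt0) ler_pM2l.
have Dz := OmD Oz; have [[_ z01] _] := Dz.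
have st n := weighted_state (wB0 n z Oz) z01.
have zero (x y : R) : (forall n, `|x - y| <= (1 + b^-1 + 2 / (r0 * u0)) *
    (2^-1 ^+ n * B * expR (k * z.1))) -> x = y.
  move=> H; apply/eqP; rewrite -subr_eq0 -normr_eq0; apply/eqP.
  apply: (@halves_eq0 _ _ ((1 + b^-1 + 2 / (r0 * u0)) * (B * expR (k * z.1)))) => // n.
  by apply: (le_trans (H n)); rewrite -!mulrA mulrCA.
have ep : prs U z = p0 by apply: zero => n; case: (st n).
have eu : vlx U z = u0 by apply: zero => n; case: (st n).
have ev : vly U z = 0 by apply: zero => n; rewrite subr0; case: (st n).
split=> //.
have := bernoulli_minus gamma1 r0_gt0 hU Dz.
rewrite ep eu ev /bernoulli_law subrr expr0n/= subr0 mulr0 add0r => E.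
have c_neq0 : 2 * gamma * p0 != 0.
  by rewrite lt0r_neq0// !mulr_gt0//; exact: lt_trans gamma1.
by apply: (mulIf c_neq0); rewrite -E; ring.
Qed.

End supersonic.

(** * Determinacy up to the shock front *)

(** If the front met the backward cone at [y'], its position relative to the
    cone, followed from [y'] to [y], would go from nonpositive to positive; at its minimum the front is below the
    level [L], hence less steep than the cone, and the position would decrease
    further. *)
Lemma cone_below_front {R : realType} (f : R -> R) (lam L x y x' y' : R) :
  derivable01 f -> 0 < lam ->
  (forall z : R, 0 <= z <= 1 -> f z < L -> lam * `|deriv01 f z| < 1) ->
  0 <= y <= 1 -> 0 <= y' <= 1 -> x < f y -> x < L ->
  `|y' - y| <= lam * (x - x') -> x' < f y'.
Proof.
move=> df lam0 steep y01 y'01 xf xL yy'.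
rewrite ltNge; apply/negP => fx'.
set D := `|y' - y| in yy'; have D0 : 0 <= D by exact: normr_ge0.
pose pt (th : R) := y' + th * (y - y').
have pt01 (th : R) : 0 <= th <= 1 -> 0 <= pt th <= 1.
  move=> /andP[t0 t1].
  have -> : pt th = (1 - th) * y' + th * y by rewrite /pt; ring.
  have /andP[a0 a1] := y01; have /andP[b0 b1] := y'01.
  have t1' : 0 <= 1 - th by rewrite subr_ge0.
  apply/andP; split; first by rewrite addr_ge0// mulr_ge0.
  have := ler_wpM2l t1' b1; have := ler_wpM2l t0 a1; lra.
(* The position of the front relative to the cone, along the segment. *)
pose H (th : R) := lam * (f (clamp (pt th)) - x') - th * D.
have cH : continuous H.
  have cpt : continuous pt.
    by rewrite /pt; apply: contD; [exact: contC|apply: contM;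
      [move=> ?; exact: cvg_id|exact: contC]].
  apply: contD; last by apply: contN; apply: contM; [move=> ?; exact: cvg_id|exact: contC].
  apply: contM; first exact: contC.
  apply: contD; last exact: contC.
  exact: (cont_comp (g := pt) (h := fun z => f (clamp z)) cpt (continuous_clamp_comp df)).
have [c c01 cmin] := EVT_min (@ler01 R) (continuous_subspaceT cH).
have {}cmin (th : R) : 0 <= th <= 1 -> H c <= H th.
  by move=> th01; apply: cmin; rewrite in_itv.
have {}c01 : 0 <= c <= 1 by move: c01; rewrite in_itv.
have ptc01 := pt01 c c01.
have H0 : H c <= 0.
  have h0 : H 0 <= 0.
    rewrite /H /pt mul0r addr0 mul0r subr0 clamp_id//.
    by rewrite pmulr_rle0// subr_le0.
  by apply: le_trans (cmin 0 _) h0; rewrite lexx ler01.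
have H1 : 0 < H 1.
  rewrite /H /pt !mul1r [y' + _]addrC subrK clamp_id// subr_gt0.
  by apply: le_lt_trans yy' _; rewrite ltr_pM2l// ltrD2r.
have c_lt1 : c < 1.
  rewrite lt_neqAle (andP c01).2 andbT; apply/eqP => c1.
  by move: H0; rewrite c1 leNgt H1.
have fcL : f (pt c) < L.
  apply: le_lt_trans xL; rewrite -(ler_pM2l lam0).
  have : c * D <= D by rewrite ler_piMl// (andP c01).2.
  by move: H0 yy'; rewrite /H clamp_id//; lra.
have sl := steep _ ptc01 fcL.
have D_gt0 : 0 < D.
  rewrite lt_neqAle D0 andbT; apply/eqP => D00.
  have yE : y' = y by apply/eqP; rewrite -subr_eq0 -normr_eq0 -/D -D00.
  move: H0 H1; rewrite /H /pt yE subrr !mulr0 !addr0 -D00 !mulr0; lra.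
pose e := (1 - lam * `|deriv01 f (pt c)|) / (2 * lam).
have e0 : 0 < e by rewrite divr_gt0 ?subr_gt0// mulr_gt0.
have [d d0 dP] := deriv01_box df ptc01 e0.
pose th := c + Num.min (1 - c) (d / (2 * D)).
have m0 : 0 < Num.min (1 - c) (d / (2 * D)).
  by rewrite lt_min subr_gt0 c_lt1 divr_gt0// mulr_gt0.
have [m1 m2] : Num.min (1 - c) (d / (2 * D)) <= 1 - c /\
    Num.min (1 - c) (d / (2 * D)) <= d / (2 * D) by rewrite !ge_min !lexx !orbT.
have th01 : 0 <= th <= 1 by rewrite /th; apply/andP; split; lra.
have := cmin th th01; rewrite leNgt => /negP; apply.
have pd : pt th - pt c = (th - c) * (y - y') by rewrite /pt; ring.
have thc : th - c = Num.min (1 - c) (d / (2 * D)) by rewrite /th addrAC subrr add0r.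
have npd : `|pt th - pt c| = (th - c) * D.
  by rewrite pd normrM /D (distrC y y') gtr0_norm// thc.
have pdd : `|pt th - pt c| < d.
  rewrite npd thc; move: m2; rewrite ler_pdivlMr ?mulr_gt0//; lra.
have := dP (pt th) (pt01 th th01) pdd.
rewrite npd => B.
have fd : f (pt th) - f (pt c) <= (`|deriv01 f (pt c)| + e) * ((th - c) * D).
  have -> : f (pt th) - f (pt c) =
    (f (pt th) - f (pt c) - deriv01 f (pt c) * (pt th - pt c)) +
    deriv01 f (pt c) * (pt th - pt c) by ring.
  rewrite addrC mulrDl; apply: lerD; last exact: le_trans (ler_norm _) B.
  by apply: le_trans (ler_norm _) _; rewrite normrM npd.
have tD0 : 0 < (th - c) * D by rewrite mulr_gt0// thc.
have le1 : lam * (`|deriv01 f (pt c)| + e) < 1.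
  have -> : lam * (`|deriv01 f (pt c)| + e) = (1 + lam * `|deriv01 f (pt c)|) / 2.
    by rewrite /e; field; rewrite lt0r_neq0.
  by lra.
have : lam * (f (pt th) - f (pt c)) < (th - c) * D.
  apply: (@le_lt_trans _ _ (lam * (`|deriv01 f (pt c)| + e) * ((th - c) * D))).
    by rewrite -mulrA ler_pM2l.
  by rewrite gtr_pMl.
by rewrite /H !clamp_id ?pt01//; lra.
Qed.

Section upstream.
Context {R : realType} {gamma p0 u0 r0 : R} {f : R -> R} {U : flow R}.
Hypotheses (gamma1 : 1 < gamma) (p0_gt0 : 0 < p0) (u0_gt0 : 0 < u0)
  (r0_gt0 : 0 < r0) (sup : gamma * p0 < r0 * u0 ^+ 2)
  (hU : transonic_shock gamma p0 u0 r0 f U).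

Let df : derivable01 f. Proof. by case: (shock_C2 hU). Qed.
Let ddf : derivable01 (deriv01 f). Proof. by case: (shock_C2 hU). Qed.
Let lam := mach_slope gamma p0 u0 r0.
Let lam_gt0 : 0 < lam. Proof. exact: mach_slope_gt0. Qed.

Lemma uniform_below (L : R) :
  (forall z : R, 0 <= z <= 1 -> f z < L -> lam * `|deriv01 f z| < 1) ->
  forall z, Dminus f z -> z.1 < L -> flow_is U z p0 u0 0 r0.
Proof.
move=> steep z Dz zL.
apply: (supersonic_uniform gamma1 p0_gt0 u0_gt0 r0_gt0 sup hU
  (Om := [set z | Dminus f z /\ z.1 < L])) => //; first by move=> w [].
move=> x y x' y' [[[/= x1 y01] xf] xL] x'1 x'x y'01 yy'.
split; last exact: le_lt_trans xL.
split; first by split.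
apply: (cone_below_front df lam_gt0 steep _ _ xf xL yy'); lra.
Qed.

(** At the lowest point where the front would be as steep as a characteristic,
    the stream ahead of it is still uniform, and a compressive shock facing the
    uniform stream is strictly less steep. *)
Lemma front_slope_lt (y : R) : 0 <= y <= 1 -> lam * `|deriv01 f y| < 1.
Proof.
move=> y01; rewrite ltNge; apply/negP => steep_y.
pose K : set R := `[0, 1] `&` [set z | 1 <= lam * `|deriv01 f (clamp z)|].
have cs : continuous (fun z => lam * `|deriv01 f (clamp z)|).
  apply: contM; first exact: contC.
  apply: (cont_comp (g := fun z => deriv01 f (clamp z)) (h := Num.norm)).
    exact: continuous_clamp_comp.
  exact: norm_continuous.
have cK : compact K.
  apply: compact_closedI; first exact: segment_compact.
  exact: (preimage_closed (fun z _ => cs z) (@closed_ge R 1)).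
have K0 : K !=set0 by exists y; split; rewrite /= ?in_itv//= clamp_id.
have cf : {within K, continuous (fun z => f (clamp z))}.
  by apply: continuous_subspaceT; exact: continuous_clamp_comp.
have [c cK' cmin] := compact_EVT_min K0 cK cf.
move: cK'; rewrite inE => -[]; rewrite /= in_itv/= => c01; rewrite clamp_id// => steep_c.
have below (z : R) : 0 <= z <= 1 -> f z < f c -> lam * `|deriv01 f z| < 1.
  move=> z01 zc; rewrite ltNge; apply/negP => steep_z.
  have : z \in K by rewrite inE; split; rewrite /= ?in_itv//= clamp_id.
  by move/cmin; rewrite !clamp_id// leNgt zc.
have uni := uniform_below below.
have wall z : z = 0 \/ z = 1 -> z <> c.
  move=> /(front_normal_at_walls hU) z0 zc; move: steep_c.
  by rewrite -zc z0 normr0 mulr0 ler10.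
have c01' : 0 < c < 1.
  have [/eqP a0 /eqP a1] : c <> 0 /\ c <> 1.
    by split=> ?; [apply: (wall 0); [left|]|apply: (wall 1); [right|]].
  by rewrite !lt_neqAle eq_sym a0 a1.
have fc := shock_gt hU c01'.
have cm := closure_Dminus_front hU c01.
have [sp su sv sr] := minus_traces hU cm.
have appr (q : R * R -> R) (l : R) : has_trace (Dminus f) q (f c, c) ->
    (forall z, Dminus f z -> z.1 < f c -> q z = l) -> trace (Dminus f) q (f c, c) = l.
  move=> tq ql; apply: trace_approach => // e d e0 d0.
  pose m := Num.min (f c + 1) d.
  have m0 : 0 < m by rewrite lt_min d0 andbT; lra.
  have [m1 m2] : m <= f c + 1 /\ m <= d by rewrite !ge_min !lexx !orbT.
  have Dz : Dminus f (f c - m / 2, c) by split; [split|] => //=; lra.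
  exists (f c - m / 2, c) => //; rewrite ql//=; last lra.
  by rewrite !subrr !normr0; split=> //; rewrite ltr_norml; lra.
have [||||J0 _ _ _] := state_behind gamma1 u0_gt0 r0_gt0 hU c01; last 1 first.
  have := polar_jump_slope gamma1 J0.
  set s := deriv01 f c in steep_c *.
  have : 1 <= lam ^+ 2 * s ^+ 2.
    rewrite -[s ^+ 2]real_normK ?num_real// -exprMn.
    by rewrite exprn_ege1.
  rewrite mach_slope_sqr// mulrAC ler_pdivlMr ?subr_gt0// mul1r.
  lra.
- by apply: appr => // z Dz zc; case: (uni z Dz zc).
- by apply: appr => // z Dz zc; case: (uni z Dz zc).
- by apply: appr => // z Dz zc; case: (uni z Dz zc).
- by apply: appr => // z Dz zc; case: (uni z Dz zc).
Qed.

Lemma uniform_upstream z : Dminus f z -> flow_is U z p0 u0 0 r0.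
Proof.
move=> Dz; have [M fM] := front_upper_bound hU.
apply: (uniform_below (L := M + 1)) => //; first by move=> y y01 _; exact: front_slope_lt.
have [[/= _ z01] zf] := Dz.
have := fM z.2; move: zf; lra.
Qed.

End upstream.

Theorem theorem2p2 (R : realType) (gamma p0 u0 r0 : R) (ustar Mstar : R)
    (f : R -> R) (U : flow R) (t : R)
    (hgamma : 1 < gamma)
    (hp0 : 0 < p0) (hu0 : 0 < u0) (hr0 : 0 < r0)
    (hM0 : 1 < u0 / sonic gamma p0 r0)
    (hustar : 0 < ustar) (hMstar : Mstar < 1)
    (hU : transonic_shock gamma p0 u0 r0 f U)
    (hu : forall z, Dplus f z -> ustar < vlx U z)
    (hM : forall z, Dplus f z -> mach gamma U z < Mstar)
    (ht : closure (@duct R) (t, 0)) (hft : f 0 = t) :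
  [/\ forall y, 0 <= y <= 1 -> f y = t,
      forall z, @duct R z -> z.1 < t -> flow_is U z p0 u0 0 r0 &
      forall z, @duct R z -> t < z.1 ->
        flow_is U z (post_p gamma p0 u0 r0) (post_u gamma p0 u0 r0) 0
                    (post_rho gamma p0 u0 r0)].
Proof.
have gp_gt0 : 0 < gamma * p0 by rewrite mulr_gt0//; exact: lt_trans hgamma.
have sup : gamma * p0 < r0 * u0 ^+ 2.
  have c_gt0 : 0 < sonic gamma p0 r0 by rewrite sqrtr_gt0 divr_gt0.
  move: hM0; rewrite ltr_pdivlMr// mul1r => cu.
  have : sonic gamma p0 r0 ^+ 2 < u0 ^+ 2 by rewrite ltr_sqr ?nnegrE// ltW.
  by rewrite sonic_sqr// ltr_pdivrMr// [u0 ^+ 2 * r0]mulrC.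
have up := uniform_upstream hgamma hp0 hu0 hr0 sup hU.
have down := subsonic_rigidity hgamma hp0 hu0 hr0 hustar hMstar hU hu hM up.
have df : derivable01 f by case: (shock_C2 hU).
have ft (y : R) : 0 <= y <= 1 -> f y = t.
  move=> y01; rewrite -hft -(clamp_id y01) -[in RHS](@clamp_id _ 0); last first.
    by rewrite lexx ler01.
  have [y0 y1] := andP y01.
  apply/esym/(@derive0_eq _ (fun y => f (clamp y)) 0 y y0).
    exact: continuous_clamp_comp.
  move=> x /andP[x0 xy]; have x01 : 0 < x < 1 by rewrite x0 (lt_le_trans xy).
  have [s0 _] := down 1 x ltr01 x01.
  have := is_derive_deriv01 df x01; rewrite s0.
  apply: near_eq_is_derive.
  have : x \in `]0, 1[ by rewrite in_itv.
  move=> /near_in_itvoo; apply: filterS => z; rewrite in_itv/= => z01.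
  by rewrite clamp_id//; lra.
split=> // -[x y] Dz zt; have [/= _ y01] := Dz; have y01' : 0 <= y <= 1 by lra.
  by apply: up; split=> //=; rewrite ft.
have x0 : 0 < x - t by rewrite subr_gt0.
have [_] := down (x - t) y x0 y01.
by rewrite ft// addrC subrK.
Qed.
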